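(* Let $r\in(1,\infty)$. Given initial conditions $\varphi(0)=\mathrm{id}\in\mathrm{Diff}_{-\infty}(\mathbb R)$ and $\varphi_t(0)=u_0\in T_{\mathrm{id}}\mathrm{Diff}_{-\infty}(\mathbb R)=\mathfrak g_{-\infty}$, the unique solution to the geodesic equation of $F$ is given (for as long as it remains in $\mathrm{Diff}_{-\infty}(\mathbb R)$) by $$\varphi(t,x)=x+\int_{-\infty}^x\left(\left(\frac{t\,u_0'(y)}{r}+1\right)^r-1\right)dy .$$ Consequently, the solution with initial condition $u(0)=u_0\in\mathfrak g_{-\infty}$ to the $r$-Hunter--Saxton equation $$\left(u_x|u_x|^{r-2}\right)_{xt}+\left(u_x|u_x|^{r-2}\right)_xu_x+\left((u_x|u_x|^{r-2})_xu\right)_x=0$$ (equivalently, to the generalized Proudman--Johnson equation $u_{txx}+(1+2\lambda)u_xu_{xx}+uu_{xxx}=0$ with $\lambda=r^{-1}$) is given by $u(t,x)=\varphi_t(t,\varphi^{-1}(t,x))$ with $\varphi(t,x)=x+\int_{-\infty}^x\left(\left(\frac{t\,u_0'(y)}{r}+1\right)^r-1\right)dy$. In particular, the geodesic equation is well-defined on $\mathrm{Diff}_{-\infty}(\mathbb R)$, and these solutions are length minimizing paths with respect to the distance function induced by the metric $F$.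
   Context: $W^{\infty,1}(\mathbb R)=\bigcap_{k\ge 0}W^{k,1}(\mathbb R)$. The group $\mathrm{Diff}_{-\infty}(\mathbb R)=\{\varphi=\mathrm{id}+f: f'\in W^{\infty,1}(\mathbb R),\ f'>-1,\ \lim_{x\to-\infty}f(x)=0\}$ is a Fréchet Lie group with Lie algebra $\mathfrak g_{-\infty}=\{u: u'\in W^{\infty,1}(\mathbb R),\ \lim_{x\to-\infty}u(x)=0\}$. Tangent vectors at $\varphi$ are of the form $h=X\circ\varphi$ with $X\in\mathfrak g_{-\infty}$, and the right-invariant Finsler metric $F$ is $$F_\varphi(h)=\left(\int_{\mathbb R}|(h\circ\varphi^{-1})'|^r\,dx\right)^{1/r}=\left(\int_{\mathbb R}|X'|^r\,dx\right)^{1/r}.$$ The length of a path is $L(\varphi)=\int F_\varphi(\varphi_t)\,dt$, and the induced distance is the infimum of lengths of paths in $\mathrm{Diff}_{-\infty}(\mathbb R)$ joining two points. Geodesics are paths locally minimizing length, parametrized with constant speed; the geodesic equation of $F$ is $$r\,\frac{d}{dt}\left(\frac{\varphi_{tx}}{\varphi_x}\left|\frac{\varphi_{tx}}{\varphi_x}\right|^{r-2}\right)+(r-1)\left|\frac{\varphi_{tx}}{\varphi_x}\right|^r=0,$$ and the $r$-Hunter--Saxton equation is this equation in the Eulerian variable $u=\varphi_t\circ\varphi^{-1}$. It is formally equivalent to the Proudman--Johnson equation with $\lambda=1/r$ (integrate in $x$, divide by $|u_x|^{r-2}$, differentiate in $x$). Here $\varphi^{-1}(t,\cdot)$ is the inverse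 of $\varphi(t,\cdot)$, and subscripts $t,x$ denote partial derivatives. *)

(* Defs.v *)
(* Mathematical Components and MathComp-Analysis. *)
From HB Require Import structures.
From mathcomp Require Import all_boot all_order all_algebra.
From mathcomp Require Import all_classical all_reals all_analysis.
Set Implicit Arguments.
Unset Strict Implicit.
Unset Printing Implicit Defensive.
Import Order.TTheory GRing.Theory Num.Theory.
Import numFieldNormedType.Exports.
Local Open Scope classical_set_scope.
Local Open Scope ring_scope.

Local Notation "f ^`()" := (derive1 f) : ring_scope.
Local Notation "f ^` ( n )" := (derive1n n f) : ring_scope.

Section Spaces.
Context {R : realType}.
Implicit Types (f g u v h phi chi : R -> R).

Definition smooth f : Prop := forall n x, derivable (f^`(n)) x 1.

Definition test_function chi : Prop :=
  smooth chi /\ compact (closure [set x | chi x != 0]).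

Definition weak_derivative f g : Prop :=
  forall chi, test_function chi ->
    \int[lebesgue_measure]_x (f x * chi^`() x) =
    - \int[lebesgue_measure]_x (g x * chi x).

Fixpoint sobolev1 (k : nat) f : Prop :=
  lebesgue_measure.-integrable [set: R] (EFin \o f) /\
  if k is k'.+1 then exists2 g, weak_derivative f g & sobolev1 k' g else True.

Definition sobolev1_infty f : Prop := forall k, sobolev1 k f.

(* The derivative f' is taken to be the continuous representative of an element
   of W^{oo,1}, so that pointwise conditions on f' (such as f' > -1) make
   sense. *)
Definition lie_algebra u : Prop :=
  [/\ forall x, derivable u x 1,
      continuous (u^`()),
      sobolev1_infty (u^`()) &
      u x @[x --> -oo] --> (0 : R)].

Definition diff_group phi : Prop :=
  let f x := phi x - x in
  lie_algebra f /\ (forall x, -1 < f^`() x).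

Definition inverse phi : R -> R := pinv [set: R] phi.

End Spaces.

Section Paths.
Context {R : realType}.
Implicit Types (I : set R) (c v : R -> R -> R) (u : R -> R).

(* Convergence in the Frechet space [lie_algebra], whose topology is given by
   the seminorms u |-> || (d/dx)^k u' ||_{L^1}, k >= 0. *)
Definition frechet_cvg (F : set_system R) c u : Prop :=
  forall k : nat,
    (\int[lebesgue_measure]_x (`| (c s \- u)^`(k.+1) x |%:E))%E
      @[s --> F] --> 0%E.

(* The derivative relative to I, hence one-sided at the endpoints of I. *)
Definition has_deriv_within I (f : R -> R) (t d : R) : Prop :=
  (f s - f t) / (s - t) @[s --> within I t^'] --> d.

(* On I, the curve c is continuously differentiable for the Frechet topology,
   with velocity v.  Both Diff_{-oo} (an open subset of the affine space
   id + g_{-oo}) and g_{-oo} are modelled on [lie_algebra], where the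
   difference quotients of c and the velocity live. *)
Definition C1_curve I c v : Prop :=
  [/\ forall t, I t -> lie_algebra (v t),
      forall t, I t ->
        frechet_cvg (within I t^') (fun s x => (c s x - c t x) / (s - t)) (v t) &
      forall t, I t -> frechet_cvg (within I (nbhs t)) v (v t)].

Definition diff_path I c v : Prop :=
  (forall t, I t -> diff_group (c t)) /\ C1_curve I c v.

Definition time_derivative c : R -> R -> R :=
  fun t x => (fun s => c s x)^`() t.

End Paths.

Section Metric.
Context {R : realType}.
Variable r : R.

Definition finsler (phi h : R -> R) : \bar R :=
  Lnorm lebesgue_measure r%:E (EFin \o (h \o inverse phi)^`()).

(* Over the open interval, where the two-sided derivative [time_derivative c]
   of a path defined on [a, b] is meaningful. *)
Definition path_length (a b : R) (c : R -> R -> R) : \bar R :=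
  (\int[lebesgue_measure]_(t in `]a, b[) finsler (c t) (time_derivative c t))%E.

Definition finsler_dist (phi0 phi1 : R -> R) : \bar R :=
  ereal_inf [set l | exists a b c v,
    [/\ a < b, diff_path `[a, b] c v, c a = phi0, c b = phi1 &
        l = path_length a b c]].

(* z |z|^(r-2), with value 0 at z = 0 for every r > 1: for r < 2 the junk value
   0 `^ (r - 2) = 0 of the library is multiplied by 0. *)
Definition signed_power (z : R) : R := z * `|z| `^ (r - 2).

Definition geodesic_equation (I : set R) (phi phit : R -> R -> R) : Prop :=
  let q t x := (phit t)^`() x / (phi t)^`() x in
  forall t x, I t ->
    exists2 d, has_deriv_within I (fun s => signed_power (q s x)) t d &
      r * d + (r - 1) * `|q t x| `^ r = 0.

Definition geodesic (I : set R) (phi0 h0 : R -> R) (phi : R -> R -> R) : Prop :=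
  exists phit, [/\ diff_path I phi phit, geodesic_equation I phi phit,
                   phi 0 = phi0 & phit 0 = h0].

(* The library's x `^ r is 0 at x = 0 and a junk value for x < 0.  Where the base
   first vanishes, the x-derivative is 0, so the path has left [diff_group] at
   or before any time at which the base takes negative values. *)
Definition explicit_path (u0 : R -> R) : R -> R -> R :=
  fun t x => x +
    \int[lebesgue_measure]_(y in `]-oo, x])
      ((t * u0^`() y / r + 1) `^ r - 1).

End Metric.

Section Eulerian.
Context {R : realType}.

(* < m_x , chi >, for the distributional derivative m_x of m *)
Definition dx_pairing (m chi : R -> R) : R :=
  - \int[lebesgue_measure]_x (m x * chi^`() x).

(* m = u_x |u_x|^(r-2) need not be differentiable in x where u_x = 0, so the
   equation m_xt + m_x u_x + (m_x u)_x = 0 is read, at each time t, in the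
   sense of distributions on the line.  As u(t, .) is smooth, the products of
   the distribution m_x with u_x and u are the usual ones:
   < m_x u_x, chi > = < m_x, u_x chi > and
   < (m_x u)_x, chi > = - < m_x, u chi' >. *)
Definition HS_equation (r : R) (I : set R) (u : R -> R -> R) : Prop :=
  let m t x := signed_power r ((u t)^`() x) in
  forall t chi, I t -> test_function chi ->
    exists2 d, has_deriv_within I (fun s => dx_pairing (m s) chi) t d &
      d + dx_pairing (m t) ((u t)^`() \* chi)
        - dx_pairing (m t) (u t \* chi^`()) = 0.

Definition PJ_equation (lambda : R) (I : set R) (u ut : R -> R -> R) : Prop :=
  forall t x, I t ->
    (ut t)^`(2) x + (1 + 2 * lambda) * (u t)^`() x * (u t)^`(2) x
      + u t x * (u t)^`(3) x = 0.

Definition lie_algebra_path (I : set R) (u ut : R -> R -> R) : Prop :=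
  (forall t, I t -> lie_algebra (u t)) /\ C1_curve I u ut.

Definition HS_solution (r : R) (I : set R) (u0 : R -> R) (u : R -> R -> R) :
    Prop :=
  exists ut, [/\ lie_algebra_path I u ut, HS_equation r I u & u 0 = u0].

Definition PJ_solution (lambda : R) (I : set R) (u0 : R -> R)
    (u : R -> R -> R) : Prop :=
  exists ut, [/\ lie_algebra_path I u ut, PJ_equation lambda I u ut & u 0 = u0].

End Eulerian.

(* Main.v *)
(* Along a trajectory put P = phi_x and Q = phi_tx / phi_x.  The geodesic equation
   is r (Q |Q|^(r-2))' + (r-1) |Q|^r = 0; together with P' = Q P it makes
   Q P^(1/r) constant, so P^(1/r) is affine in time.  Conversely, every derivative
   of the explicit path lies in a differential algebra generated by t, the
   derivatives of u0', powers of 1 + t u0'/r and antiderivatives, where pointwise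
   differentiation and domination give convergence for the Frechet topology.

   A solution v of the Proudman-Johnson or of the Hunter-Saxton equation is
   followed along its own flow f, where Q = v_x(t, f) obeys the same ordinary
   differential equation.  For Proudman-Johnson this is the equation integrated
   once in x.  Hunter-Saxton, which holds only in the sense of distributions, is
   tested against a bump that moves with f, compensated by a bump going to -oo.
   Hence f is the explicit path, which determines v.

   The map phi |-> r phi_x^(1/r) turns F into the L^r norm.  By Hoelder's inequality
   a path is at least as long as the L^r distance of the images of its endpoints,
   and the explicit path is mapped to a straight line. *)
Require Import Defs.
From HB Require Import structures.
From mathcomp Require Import all_boot all_order all_algebra.
From mathcomp Require Import all_classical all_reals all_analysis.
From mathcomp Require Import ring lra.
From mathcomp Require Import measurable_realfun.
Set Implicit Arguments.
Unset Strict Implicit.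
Unset Printing Implicit Defensive.
Import Order.TTheory GRing.Theory Num.Theory.
Import numFieldNormedType.Exports.
Local Open Scope classical_set_scope.
Local Open Scope ring_scope.

(** * Derivatives relative to an interval *)


(** Two obstacles shape the development. The spaces are given by weak derivatives, while the
    argument along trajectories is pointwise: testing against differences of smoothed Heaviside
    functions recovers values at Lebesgue points, hence smooth representatives. As elements of the
    algebra vanish at -oo, the L^1 norm of the derivative of order k + 1 bounds the sup norm of the
    one of order k, so a curve that is C^1 for the Frechet topology can be differentiated at each x.

    Second, z |z|^(r-2) need not be differentiable at 0, so the chain rule gives no time derivative
    of m = u_x |u_x|^(r-2). Explicit solutions escape by factorisation: in labels, m phi_x is a
    function of y times an affine function of t. For an arbitrary solution the derivative of m along
    a trajectory is a limit of derivatives of bump averages, uniform on the segment between 0 and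
    the given time. The pairing with m_x involves the derivative of the test function, so the bump
    must be such a derivative; it then has mean zero, whence the compensating bump. Its contribution
    vanishes because u_x tends to 0 at -oo uniformly in time. *)

Section Calculus.
Context {R : realType}.
Implicit Types (I : set R) (f g : R -> R) (t x d : R).

Local Notation hdw := has_deriv_within.

Lemma is_derive_cont f x d : is_derive x (1 : R) f d -> {for x, continuous f}.
Proof.
move=> h; apply: differentiable_continuous.
by apply/derivable1_diffP; exact: ex_derive.
Qed.

Lemma is_derive_continuous f g :
  (forall x, is_derive x (1 : R) f (g x)) -> continuous f.
Proof. by move=> h x; apply: is_derive_cont. Qed.

Lemma is_derive_der f g :
  (forall x, is_derive x (1 : R) f (g x)) -> f^`()%classic = g.
Proof. by move=> h; apply/funext => x; rewrite derive1E derive_val. Qed.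

Lemma derivable_is_derive f x :
  derivable f x 1 -> is_derive x (1 : R) f (f^`()%classic x).
Proof. by move=> h; apply: DeriveDef => //; rewrite derive1E. Qed.

Lemma hdw_cvg I f t d :
  hdw I f t d <-> (f s - f t) / (s - t) @[s --> within I t^'] --> d.
Proof. by []. Qed.

(** Multiplied by [s - t], the condition also holds at [s = t]. The punctured filter disappears and
    later estimates are inequalities on all points of [I] near [t]. *)
Lemma hdwP I f t d : hdw I f t d <->
  forall e, 0 < e -> exists2 k, 0 < k & forall s, I s -> `|s - t| < k ->
    `|f s - f t - d * (s - t)| <= e * `|s - t|.
Proof.
split=> [h e e0|h].
  move/hdw_cvg/cvgrPdist_le : h => /(_ _ e0) [k /= k0 H].
  exists k => // s Is st.
  have [->|/eqP nst] := eqVneq s t; first by rewrite !subrr mulr0 subr0 normr0 mulr0.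
  have /H : ball t k s by rewrite /ball /= distrC.
  move=> /(_ (introN eqP nst) Is) {}H.
  have st0 : s - t != 0 by rewrite subr_eq0; apply/eqP.
  have -> : f s - f t - d * (s - t) = - (d - (f s - f t) / (s - t)) * (s - t).
    by field.
  by rewrite normrM normrN ler_wpM2r.
apply/hdw_cvg/cvgrPdist_le => e e0.
have [k k0 H] := h e e0; exists k => //= s ts nst Is.
have st0 : s - t != 0 by rewrite subr_eq0.
have -> : d - (f s - f t) / (s - t) = - (f s - f t - d * (s - t)) / (s - t).
  by field.
rewrite normrM normrN normfV ler_pdivrMr ?normr_gt0//.
by apply: H => //; rewrite distrC.
Qed.

Lemma is_derive_hdwT f t d : is_derive t (1 : R) f d <-> hdw setT f t d.
Proof.
split=> [h|h].
  have [dv de] := h.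
  have : (fun h0 : R => h0^-1 *: ((f \o shift t) (h0 *: 1) - f t)) @ 0^' --> d.
    by rewrite -de; exact: dv.
  move=> /cvgrPdist_le hh; apply/hdwP => e e0.
  have [k /= k0 H] := hh _ e0; exists k => // s _ st.
  have [->|nst] := eqVneq s t; first by rewrite !subrr mulr0 subr0 normr0 mulr0.
  have st0 : s - t != 0 by rewrite subr_eq0.
  have := H (s - t); rewrite /ball /= sub0r normrN => /(_ st st0).
  rewrite [(s - t) *: 1]mulr1 subrK.
  have -> : f s - f t - d * (s - t) =
      - (d - (s - t)^-1 *: (f s - f t)) * (s - t).
    by rewrite /GRing.scale /=; field.
  by move=> ?; rewrite normrM normrN ler_wpM2r.
move: h => /hdwP h.
have hc : (fun h0 : R => h0^-1 *: ((f \o shift t) (h0 *: 1) - f t)) @ 0^' --> d.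
  apply/cvgrPdist_le => e e0.
  have [k k0 H] := h e e0; exists k => //= s; rewrite /ball /= sub0r normrN => sk ns.
  have := H (s + t) I; rewrite addrK => /(_ sk).
  rewrite [s *: 1]mulr1 => {}H.
  have -> : d - s^-1 *: (f (s + t) - f t) = - (f (s + t) - f t - d * s) / s.
    by rewrite /GRing.scale /=; field.
  by rewrite normrM normrN normfV ler_pdivrMr ?normr_gt0.
split; first by apply/cvg_ex; exists d.
exact: cvg_lim hc.
Qed.

Lemma hdw_sub I J f t d : J `<=` I -> hdw I f t d -> hdw J f t d.
Proof.
move=> JI /hdwP h; apply/hdwP => e /h[k k0 H]; exists k => // s /JI; exact: H.
Qed.

Lemma is_derive_hdw I f t d : is_derive t (1 : R) f d -> hdw I f t d.
Proof. by move/is_derive_hdwT; exact: hdw_sub. Qed.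

Lemma hdw_is_derive (a b : R) f t d : a < t < b -> hdw `]a, b[ f t d ->
  is_derive t (1 : R) f d.
Proof.
move=> /andP[at_ tb] /hdwP h; apply/is_derive_hdwT/hdwP => e /h[k k0 H].
exists (Num.min k (Num.min (t - a) (b - t))).
  by rewrite !lt_min k0 !subr_gt0 at_ tb.
move=> s _; rewrite !lt_min => /and3P[sk sa sb]; apply: H => //.
rewrite /= in_itv/=; apply/andP; split.
  by move: sa; rewrite ltr_distl => /andP[? ?]; lra.
by move: sb; rewrite ltr_distl => /andP[? ?]; lra.
Qed.

Lemma hdw_eq I f g t d : I t -> (forall s, I s -> f s = g s) ->
  hdw I f t d -> hdw I g t d.
Proof.
move=> It fg /hdwP h; apply/hdwP => e /h[k k0 H]; exists k => // s Is.
by rewrite -!fg//; exact: H.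
Qed.

Lemma hdw_cts I f t d : hdw I f t d -> f s @[s --> within I (nbhs t)] --> f t.
Proof.
move=> /hdwP h; apply/cvgrPdist_le => e e0.
have [k k0 H] := h 1 ltr01.
have c0 : 0 < 1 + `|d| by rewrite ltr_pwDl.
have k20 : 0 < e / (1 + `|d|) by rewrite divr_gt0.
exists (Num.min k (e / (1 + `|d|))); first by rewrite /= lt_min k0.
move=> s; rewrite /ball_ /= lt_min distrC => /andP[sk se] Is.
have := H s Is sk; rewrite mul1r => {}H.
rewrite distrC -[f s - f t](subrK (d * (s - t))).
apply: (le_trans (ler_normD _ _)); rewrite normrM.
apply: (@le_trans _ _ ((1 + `|d|) * `|s - t|)); first by rewrite mulrDl mul1r lerD2r.
by move: se; rewrite ltr_pdivlMr// mulrC => /ltW.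
Qed.

Lemma hdw_ctsd I f t d : hdw I f t d -> f s @[s --> within I t^'] --> f t.
Proof.
move=> /hdw_cts h; apply: cvg_trans h; apply: cvg_app => A [k /= k0 H].
by exists k => //= s st _; exact: H.
Qed.

Lemma hdw_cst I c t : hdw I (fun=> c) t 0.
Proof. by apply: is_derive_hdw; exact: is_derive_cst. Qed.

Lemma hdw_id I t : hdw I id t 1.
Proof. by apply: is_derive_hdw; exact: is_derive_id. Qed.

Lemma hdwD I f g t df dg : hdw I f t df -> hdw I g t dg ->
  hdw I (fun s => f s + g s) t (df + dg).
Proof.
move=> hf hg; apply/hdw_cvg; apply: cvg_trans (cvgD hf hg).
by apply: near_eq_cvg; apply: nearW => s /=; rewrite fctE -mulrDl; congr (_ / _); ring.
Qed.

Lemma hdwM I f g t df dg : hdw I f t df -> hdw I g t dg ->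
  hdw I (fun s => f s * g s) t (df * g t + f t * dg).
Proof.
move=> hf hg; apply/hdw_cvg.
have h : (fun s => f t * ((g s - g t) / (s - t))) @ within I t^' --> f t * dg.
  by apply: cvgM => //; exact: cvg_cst.
apply: cvg_trans (cvgD (cvgM hf (hdw_ctsd hg)) h).
by apply: near_eq_cvg; apply: nearW => s /=; rewrite !fctE /=; ring.
Qed.

Lemma hdwZ I c f t df : hdw I f t df -> hdw I (fun s => c * f s) t (c * df).
Proof.
by move=> hf; have := hdwM (@hdw_cst I c t) hf; rewrite mul0r add0r.
Qed.

Lemma hdwN I f t df : hdw I f t df -> hdw I (fun s => - f s) t (- df).
Proof.
move=> hf; have := @hdwZ I (-1) _ _ _ hf; rewrite mulN1r.
by under eq_fun do rewrite mulN1r.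
Qed.

Lemma hdwB I f g t df dg : hdw I f t df -> hdw I g t dg ->
  hdw I (fun s => f s - g s) t (df - dg).
Proof. by move=> hf hg; apply: hdwD => //; exact: hdwN. Qed.

Lemma hdw_comp I (F : R -> R) f t df dF : is_derive (f t) (1 : R) F dF ->
  hdw I f t df -> hdw I (fun s => F (f s)) t (dF * df).
Proof.
move=> /is_derive_hdwT/hdwP hF hf; apply/hdwP => e e0.
have c0 : 0 < `|df| + 1 by rewrite ltr_wpDl.
have [k1 k10 H1] := hF (e / (2 * (`|df| + 1))) ltac:(by rewrite divr_gt0// mulr_gt0).
have d0 : 0 < `|dF| + 1 by rewrite ltr_wpDl.
have [k2 k20 H2] := (iffLR (hdwP I f t df) hf) (Num.min 1 (e / (2 * (`|dF| + 1))))
  ltac:(by rewrite lt_min ltr01 divr_gt0// mulr_gt0).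
have := hdw_cts hf => /cvgrPdist_lt/(_ _ k10)[k3 /= k30 H3].
exists (Num.min k2 k3); first by rewrite lt_min k20.
move=> s Is; rewrite lt_min => /andP[s2 s3].
have fk : `|f s - f t| < k1 by rewrite distrC; apply: H3 => //=; rewrite distrC.
have := H1 (f s) Logic.I fk => {}H1.
have {}H2 := H2 s Is s2.
have H2' : `|f s - f t - df * (s - t)| <= `|s - t|.
  apply: (le_trans H2); rewrite -[leRHS]mul1r ler_wpM2r//.
  by rewrite ge_min lexx.
have H2'' : `|f s - f t - df * (s - t)| <= e / (2 * (`|dF| + 1)) * `|s - t|.
  apply: (le_trans H2); rewrite ler_wpM2r//.
  by rewrite ge_min lexx orbT.
have fst : `|f s - f t| <= (`|df| + 1) * `|s - t|.
  rewrite -[f s - f t](subrK (df * (s - t))).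
  by apply: (le_trans (ler_normD _ _)); rewrite normrM addrC mulrDl mul1r lerD2l.
have -> : F (f s) - F (f t) - dF * df * (s - t) =
  (F (f s) - F (f t) - dF * (f s - f t)) + dF * (f s - f t - df * (s - t)).
  by ring.
apply: (le_trans (ler_normD _ _)); rewrite normrM.
have -> : e * `|s - t| = e / (2 * (`|df| + 1)) * ((`|df| + 1) * `|s - t|) +
    (`|dF| + 1) * (e / (2 * (`|dF| + 1)) * `|s - t|).
  by field; rewrite !gt_eqF.
apply: lerD.
  by apply: (le_trans H1); rewrite ler_wpM2l// ltW// divr_gt0// mulr_gt0.
apply: (@le_trans _ _ ((`|dF| + 1) * `|f s - f t - df * (s - t)|)).
  by rewrite ler_wpM2r// lerDl.
by rewrite ler_wpM2l// ltW.
Qed.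

(** The second point [s] excludes an interval reduced to [t], where every number is a relative
    derivative. *)
Lemma hdw_uniq I f t d d' (s : R) : is_interval I -> I t -> I s -> s != t ->
  hdw I f t d -> hdw I f t d' -> d = d'.
Proof.
move=> Ii It Is st /hdwP h /hdwP h'.
have st0 : 0 < `|s - t| by rewrite normr_gt0 subr_eq0.
apply/eqP; rewrite -subr_eq0 -normr_le0; apply/ler_addgt0Pl => e e0; rewrite addr0.
have e2 : 0 < e / 2 by rewrite divr_gt0.
have [k k0 H] := h _ e2; have [k' k'0 H'] := h' _ e2.
(* The point [z] below moves from [t] towards [s] without passing it, by at most half of either
   radius. *)
pose m := Num.min 1 (Num.min (k / 2 / `|s - t|) (k' / 2 / `|s - t|)).
have m0 : 0 < m by rewrite !lt_min ltr01 !divr_gt0.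
have m1 : m <= 1 by rewrite ge_min lexx.
pose z := t + m * (s - t).
have zt : z - t = m * (s - t) by rewrite /z addrC addKr.
have nz : `|z - t| = m * `|s - t| by rewrite zt normrM gtr0_norm.
have zs : z - s = (m - 1) * (s - t) by rewrite /z; ring.
have Iz : I z.
  have [ts|st'] := leP t s.
    by apply: (Ii t s It Is); rewrite -subr_ge0 zt mulr_ge0 ?subr_ge0 ?(ltW m0)//=
      -subr_le0 zs mulr_le0_ge0 ?subr_le0 ?subr_ge0.
  by apply: (Ii s t Is It); rewrite -subr_ge0 zs mulr_le0 ?subr_le0 ?(ltW st')//=
    -subr_le0 zt mulr_ge0_le0 ?subr_le0 ?(ltW m0) ?(ltW st').
have small w : 0 < w -> m <= w / 2 / `|s - t| -> `|z - t| < w.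
  move=> w0 mw; rewrite nz -ltr_pdivlMr//; apply: (le_lt_trans mw).
  by rewrite ltr_pM2r ?invr_gt0// ltr_pdivrMr// ltr_pMr// ltr1n.
have z0 : 0 < `|z - t| by rewrite nz mulr_gt0.
have A1 := H z Iz (small k k0 ltac:(by rewrite /m !ge_min lexx !orbT)).
have A2 := H' z Iz (small k' k'0 ltac:(by rewrite /m !ge_min lexx !orbT)).
rewrite -(ler_pM2r z0) -normrM.
have -> : (d - d') * (z - t) = (f z - f t - d' * (z - t)) - (f z - f t - d * (z - t)) by ring.
by rewrite (le_trans (ler_normB _ _))// (splitr e) mulrDl lerD.
Qed.

Lemma hdw_within_continuous (a b : R) f df :
  (forall t, a <= t <= b -> hdw `[a, b] f t (df t)) ->
  {within `[a, b], continuous f}.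
Proof.
move=> h; apply/subspace_continuousP => t; rewrite /= in_itv/= => tab.
exact: hdw_cts (h t tab).
Qed.

Lemma hdw_mvt (a b : R) f df : a < b ->
  (forall t, a <= t <= b -> hdw `[a, b] f t (df t)) ->
  exists2 c, a < c < b & f b - f a = df c * (b - a).
Proof.
move=> ab h.
have [|x|c] := @MVT R f df a b ab.
- move=> t; rewrite in_itv/= => /andP[at_ tb].
  apply: (@hdw_is_derive a b); first by rewrite at_ tb.
  apply: hdw_sub (h t _); last by rewrite !ltW.
  exact: subset_itv_oo_cc.
- exact: (hdw_within_continuous h).
- by rewrite in_itv/= => cab E; exists c.
Qed.

Lemma hdw_bound I f df M : is_interval I ->
  (forall t, I t -> hdw I f t (df t)) -> (forall t, I t -> `|df t| <= M) ->
  forall s t, I s -> I t -> `|f s - f t| <= M * `|s - t|.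
Proof.
move=> Ii h hM; suff H s t : I s -> I t -> s < t -> `|f s - f t| <= M * `|s - t|.
  move=> s t Is It; have [st|ts|->] := ltgtP s t; first exact: H.
    by rewrite distrC [`|s - t|]distrC; exact: H.
  by rewrite !subrr normr0 mulr0.
move=> Is It st.
have J : `[s, t] `<=` I by move=> z; rewrite /= in_itv/=; exact: Ii.
have [u ust|c /andP[sc ct] E] := @hdw_mvt s t f df st.
  by apply: hdw_sub (h u _) => //; apply: J; rewrite /= in_itv.
rewrite distrC E normrM [`|s - t|]distrC ler_wpM2r// hM//.
by apply: J; rewrite /= in_itv/= !ltW.
Qed.

Lemma hdw_const I f : is_interval I ->
  (forall t, I t -> hdw I f t 0) -> forall s t, I s -> I t -> f s = f t.
Proof.
move=> Ii h s t Is It; apply/eqP; rewrite -subr_eq0 -normr_le0.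
have := @hdw_bound I f (fun=> 0) 0 Ii h _ s t Is It.
by rewrite mul0r; apply => *; rewrite normr0.
Qed.

Lemma is_derive_bound f df M :
  (forall t, is_derive t (1 : R) f (df t)) -> (forall t, `|df t| <= M) ->
  forall s t, `|f s - f t| <= M * `|s - t|.
Proof.
move=> h hM s t; apply: (@hdw_bound setT f df M) => // u _.
by apply: is_derive_hdw.
Qed.

Lemma interval_ball (c e : R) : is_interval [set s | `|s - c| < e].
Proof.
move=> a b; rewrite /= !ltr_distl => /andP[a1 _] /andP[_ b2] z /andP[az zb].
by rewrite /= ltr_distl (lt_le_trans a1 az) (le_lt_trans zb b2).
Qed.

Lemma interval_cball (c e : R) : is_interval [set s | `|s - c| <= e].
Proof.
move=> a b; rewrite /= !ler_distl => /andP[a1 _] /andP[_ b2] z /andP[az zb].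
by rewrite /= ler_distl (le_trans a1 az) (le_trans zb b2).
Qed.

Lemma hdw_ball f t d (e : R) : 0 < e -> hdw [set s | `|s - t| < e] f t d ->
  is_derive t (1 : R) f d.
Proof.
move=> e0 /hdwP h; apply/is_derive_hdwT/hdwP => e' /h[k k0 hk].
exists (Num.min e k) => [|s _]; first by rewrite lt_min e0.
by rewrite lt_min => /andP[se sk]; exact: hk.
Qed.

(** The mean value bound applied to [f w - a * w]. With [a] the slope at a point, every first-order
    remainder estimate below is an instance. *)
Lemma deriv_affine_bound I f df (a e : R) : is_interval I ->
  (forall w, I w -> is_derive w (1 : R) f (df w)) -> (forall w, I w -> `|df w - a| <= e) ->
  forall y z, I y -> I z -> `|f y - f z - a * (y - z)| <= e * `|y - z|.
Proof.
move=> Ii h he y z Iy Iz.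
have -> : f y - f z - a * (y - z) = (f y - a * y) - (f z - a * z) by ring.
apply: (@hdw_bound I (fun w => f w - a * w) (fun w => df w - a)) => // w Iw.
apply: hdwB; first exact/is_derive_hdw/h.
by have := hdwZ (c := a) (hdw_id I w); rewrite mulr1.
Qed.

Lemma is_derive_const f : (forall t, is_derive t (1 : R) f 0) ->
  forall s t, f s = f t.
Proof.
move=> h s t; apply: (@hdw_const setT) => // u _.
by apply: is_derive_hdw.
Qed.

(** A guessed tower of derivatives: one check per level gives smoothness and identifies every
    [derive1n]. *)
Definition dseq (F : nat -> R -> R) :=
  forall n x, is_derive x (1 : R) (F n) (F n.+1 x).

Lemma dseq_derive1n F : dseq F -> forall n, derive1n n (F 0%N) = F n.
Proof.
move=> dF; elim=> [//|n IH]; rewrite derive1nS IH.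
exact: is_derive_der (dF n).
Qed.

Lemma dseq_smooth F : dseq F -> smooth (F 0%N).
Proof.
by move=> dF n x; rewrite dseq_derive1n//; apply: ex_derive; exact: dF.
Qed.

Lemma smooth_dseq f : smooth f -> dseq (fun n => derive1n n f).
Proof. by move=> sf n x; rewrite derive1nS; exact: derivable_is_derive. Qed.

Lemma smooth_der f : smooth f -> smooth f^`()%classic.
Proof. by move=> sf n x; rewrite -derive1Sn; exact: sf. Qed.

Lemma derivable_smooth f :
  (forall x, derivable f x 1) -> smooth f^`()%classic -> smooth f.
Proof. by move=> df sf [|n] x; rewrite ?derive1Sn//; exact: sf. Qed.

End Calculus.

(** * Integration on the line *)

Section Integration.
Context {R : realType}.
Implicit Types (f g h F G K : R -> R) (x y c C M : R).

Local Notation mu := (@lebesgue_measure R).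

Definition int1 f : Prop := mu.-integrable [set: R] (EFin \o f).

Lemma cont_meas f : continuous f -> measurable_fun [set: R] f.
Proof. exact: measurable_realfun.continuous_measurable_fun. Qed.

Lemma int1_meas f : int1 f -> measurable_fun [set: R] f.
Proof. by move=> /integrableP[/measurable_EFinP]. Qed.

Lemma int1_set f (D : set R) : measurable D -> int1 f ->
  mu.-integrable D (EFin \o f).
Proof. by move=> mD; apply: integrableS. Qed.

Lemma int1_le f K : measurable_fun [set: R] f -> int1 K ->
  (forall x, `|f x| <= K x) -> int1 f.
Proof.
move=> mf iK fK; apply: (le_integrable _ _ _ iK) => //=; first exact/measurable_EFinP.
by move=> x _; rewrite lee_fin (le_trans (fK x))// ler_norm.
Qed.

Lemma int1D f g : int1 f -> int1 g -> int1 (fun x => f x + g x).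
Proof.
by move=> h k; have := integrableD measurableT h k.
Qed.

Lemma int1Z c f : int1 f -> int1 (fun x => c * f x).
Proof. by move=> h; have := integrableZl measurableT c h. Qed.

Lemma int1N f : int1 f -> int1 (fun x => - f x).
Proof. by move=> h; have := integrableN h. Qed.

Lemma int1B f g : int1 f -> int1 g -> int1 (fun x => f x - g x).
Proof. by move=> h k; apply: int1D => //; exact: int1N. Qed.

Lemma int1_abs f : int1 f -> int1 (fun x => `|f x|).
Proof. exact: integrable_norm. Qed.

Lemma int1_0 : int1 (fun=> 0).
Proof. exact: integrable0. Qed.

Lemma int1_bdM f g M : int1 f -> measurable_fun [set: R] g ->
  (forall x, `|g x| <= M) -> int1 (fun x => f x * g x).
Proof.
move=> hf mg gM; apply: (@int1_le _ (fun x => M * `|f x|)).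
- by apply: measurable_funM => //; exact: int1_meas.
- by apply: int1Z; exact: int1_abs.
- by move=> x; rewrite normrM mulrC ler_wpM2r.
Qed.

Lemma int1_indic (a b : R) : int1 (\1_`[a, b]).
Proof. exact: integrable_indic_itv. Qed.

Lemma RintD f g : int1 f -> int1 g ->
  \int[mu]_x (f x + g x) = \int[mu]_x f x + \int[mu]_x g x.
Proof. by move=> hf hg; exact: RintegralD. Qed.

Lemma RintZ c f : int1 f -> \int[mu]_x (c * f x) = c * \int[mu]_x f x.
Proof. by move=> hf; exact: RintegralZl. Qed.

Lemma RintN f : int1 f -> \int[mu]_x (- f x) = - \int[mu]_x f x.
Proof.
move=> hf; rewrite -mulN1r -RintZ//; apply: eq_Rintegral => x _.
by rewrite mulN1r.
Qed.

Lemma RintB f g : int1 f -> int1 g ->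
  \int[mu]_x (f x - g x) = \int[mu]_x f x - \int[mu]_x g x.
Proof. by move=> hf hg; exact: RintegralB. Qed.

Lemma Rint_ge0 f : (forall x, 0 <= f x) -> 0 <= \int[mu]_x f x.
Proof. by move=> h; apply: Rintegral_ge0. Qed.

Lemma Rint_le f g : int1 f -> int1 g -> (forall x, f x <= g x) ->
  \int[mu]_x f x <= \int[mu]_x g x.
Proof. by move=> hf hg h; apply: le_Rintegral. Qed.

Lemma Rint_abs_le f g : int1 f -> int1 g -> (forall x, `|f x| <= g x) ->
  `|\int[mu]_x f x| <= \int[mu]_x g x.
Proof.
move=> hf hg h; apply: (le_trans (le_normr_Rintegral measurableT hf)).
by apply: Rint_le => //; exact: int1_abs.
Qed.

Lemma integral_EFin f : int1 f -> (\int[mu]_x (f x)%:E)%E = (\int[mu]_x f x)%:E.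
Proof.
by move=> hf; rewrite /Rintegral fineK//; apply: integrable_fin_num.
Qed.

Lemma abse_integral_le f c : continuous f -> (forall x, 0 <= f x) ->
  (\int[mu]_x (f x)%:E <= c%:E)%E -> int1 f.
Proof.
move=> cf f0 fc; apply/integrableP; split; first by apply/measurable_EFinP; exact: cont_meas.
apply: le_lt_trans (ltry c); apply: le_trans fc.
by under eq_integral do rewrite /= ger0_norm//.
Qed.

Lemma Rdct (f_ : nat -> R -> R) f g :
  (forall n, measurable_fun [set: R] (f_ n)) ->
  (forall x, f_ n x @[n --> \oo] --> f x) -> int1 g ->
  (forall n x, `|f_ n x| <= g x) -> measurable_fun [set: R] f ->
  \int[mu]_x f_ n x @[n --> \oo] --> \int[mu]_x f x.
Proof.
move=> mf ff ig fg mf0.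
have intf : int1 f.
  apply: int1_le ig _ => // x.
  have : `|f_ n x| @[n --> \oo] --> `|f x| by apply: cvg_norm; exact: ff.
  move=> h; rewrite -(cvg_lim _ h)//; apply: limr_le; last by apply: nearW => n; exact: fg.
  by apply/cvg_ex; exists `|f x|.
have h : (\int[mu]_(x in setT) (f_ n x)%:E)%E @[n --> \oo] --> (\int[mu]_x (f x)%:E)%E.
  apply: (@dominated_cvg _ _ _ mu setT measurableT (fun n x => (f_ n x)%:E)
    (EFin \o f) (EFin \o g)) => //=.
  - by move=> n; apply/measurable_EFinP; exact: mf.
  - by move=> x _; apply/fine_cvgP; split; [exact: nearW|exact: ff].
  - by move=> n x _; rewrite lee_fin; exact: fg.
move: h; rewrite integral_EFin// => h.
exact: (fine_cvg h).
Qed.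

Lemma continuous_itv (i : interval R) f : continuous f -> {within [set` i], continuous f}.
Proof. by move=> cf; apply: continuous_subspaceT. Qed.

Lemma derivable_oo_LR f g (a b : R) : (forall x, is_derive x (1 : R) f (g x)) ->
  derivable_oo_LRcontinuous f a b.
Proof.
move=> df; have cf : continuous f by exact: is_derive_continuous df.
split; [by move=> x _; exact: ex_derive| |].
  by apply: cvg_at_right_filter; exact: cf.
by apply: cvg_at_left_filter; exact: cf.
Qed.

Lemma FTC_itv f g (a b : R) : a <= b -> continuous g ->
  (forall x, is_derive x (1 : R) f (g x)) ->
  (\int[mu]_(x in `[a, b]) (g x)%:E)%E = (f b - f a)%:E.
Proof.
rewrite le_eqVlt => /predU1P[->|ab] cg df.
  by rewrite set_itv1 integral_set1 subrr.
rewrite (@continuous_FTC2 _ _ f)//.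
- exact: continuous_itv.
- exact: (derivable_oo_LR _ _ df).
- by move=> x _; rewrite (is_derive_der df).
Qed.

(** The integral over [-n, n] is [G n - G (- n)], at most [2 * C]; monotone convergence does the
    rest. *)
Lemma bounded_deriv_int1 g G (C : R) : continuous g -> (forall x, 0 <= g x) ->
  (forall x, is_derive x (1 : R) G (g x)) -> (forall x, `|G x| <= C) -> int1 g.
Proof.
move=> cg g0 dG GC; apply: (@abse_integral_le _ (2 * C)) => //.
have mg : measurable_fun [set: R] g by exact: cont_meas.
pose A (n : nat) : set (measurableTypeR R) := `[- n%:R, n%:R]%classic.
have UA : \bigcup_n A n = setT.
  apply/seteqP; split => // x _; exists (Num.truncn `|x|).+1 => //.
  rewrite /A /= in_itv/= -ler_norml ltW//.
  by have := truncnS_gt `|x|.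
have H : (\int[mu]_(x in A i) (EFin \o g) x)%E @[i --> \oo] --> (\int[mu]_x (EFin \o g) x)%E.
  rewrite -UA; apply: ge0_nondecreasing_set_cvg_integral => //.
  - move=> n m nm; apply/subsetPset => x; rewrite /A /= !in_itv/= => /andP[a b].
    have : (n%:R : R) <= m%:R by rewrite ler_nat.
    by move=> ?; apply/andP; split; lra.
  - by move=> i; exact: measurable_itv.
  - move=> i; apply/measurable_EFinP; exact: measurable_funS mg.
  - by move=> i x _; rewrite /= lee_fin.
rewrite -(cvg_lim _ H)//; apply: lime_le.
  by apply/cvg_ex; eexists; exact: H.
apply: nearW => n; rewrite (FTC_itv _ cg dG) ?lee_fin.
  have := GC n%:R; have := GC (- n%:R); move=> /ler_normlP[? ?] /ler_normlP[? ?].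
  by lra.
by have : (0 : R) <= n%:R by []; lra.
Qed.

Definition prim g x := \int[mu]_(y in `]-oo, x]) g y.

Lemma primE g x : prim g x = \int[mu]_y (g \_ `]-oo, x]) y.
Proof. by rewrite /prim Rintegral_mkcond. Qed.

Lemma int1_restrict g (D : set R) : measurable D -> int1 g -> int1 (g \_ D).
Proof.
move=> mD ig; rewrite /int1 -restrict_EFin.
by rewrite -integrable_mkcond//; exact: int1_set.
Qed.

Lemma prim_derive g x : continuous g -> int1 g -> is_derive x (1 : R) (prim g) (g x).
Proof.
move=> cg ig.
have [d e] := @continuous_FTC1 R g -oo%O x (x + 1) ltac:(lra)
  (int1_set (measurable_itv _) ig) (ltNyr x) (cg x).
by rewrite -e; apply: derivable_is_derive.
Qed.

Lemma prim_le g x : int1 g -> `|prim g x| <= \int[mu]_y `|g y|.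
Proof.
move=> ig; rewrite primE; apply: Rint_abs_le.
- exact: int1_restrict.
- exact: int1_abs.
- by move=> y; rewrite patchE; case: ifP => // _; rewrite normr0.
Qed.

Lemma cvgNy_comp_lt (u : nat -> R) x : u n @[n --> \oo] --> -oo ->
  \forall n \near \oo, u n < x.
Proof. by move=> h; have /cvgrNy_lt := h; apply. Qed.

Lemma prim_cvgNy g : int1 g -> prim g x @[x --> -oo] --> (0 : R).
Proof.
move=> ig; apply/cvg_ninftyP => u uoo.
have -> : (0 : R) = \int[mu]_(x in setT) (0 : R).
  by rewrite Rintegral_cst// mul0r.
under eq_fun do rewrite primE.
apply: (@Rdct _ _ (fun x => `|g x|)).
- by move=> n; apply: int1_meas; exact: int1_restrict.
- move=> x; apply: cvg_near_cst.
  apply: filterS (cvgNy_comp_lt x uoo) => n un.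
  rewrite patchE; case: ifPn => //; rewrite inE /= in_itv/= leNgt un//.
- exact: int1_abs.
- by move=> n x; rewrite patchE; case: ifP => // _; rewrite normr0.
- exact: measurable_cst.
Qed.

Lemma prim_cvgy g : int1 g -> prim g x @[x --> +oo] --> \int[mu]_x g x.
Proof.
move=> ig; apply/cvg_pinftyP => u uoo.
under eq_fun do rewrite primE.
apply: (@Rdct _ _ (fun x => `|g x|)).
- by move=> n; apply: int1_meas; exact: int1_restrict.
- move=> x; apply: cvg_near_cst.
  have : \forall n \near \oo, x < u n by have /cvgry_gt := uoo; apply.
  apply: filterS => n un.
  rewrite patchE; case: ifPn => //; rewrite notin_setE /= in_itv/= ltW//.
- exact: int1_abs.
- by move=> n x; rewrite patchE; case: ifP => // _; rewrite normr0.
- exact: int1_meas.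
Qed.

Lemma primitive_uniq f g : continuous g -> int1 g ->
  (forall x, is_derive x (1 : R) f (g x)) -> forall x y,
  f x - prim g x = f y - prim g y.
Proof.
move=> cg ig df; apply: (@is_derive_const R (fun x => f x - prim g x)) => t.
rewrite -(subrr (g t)).
by apply: is_deriveB; exact: prim_derive.
Qed.

Lemma prim_uniq f g : continuous g -> int1 g ->
  (forall x, is_derive x (1 : R) f (g x)) -> f x @[x --> -oo] --> (0 : R) ->
  f = prim g.
Proof.
move=> cg ig df f0; apply/funext => x; apply/eqP; rewrite -subr_eq0; apply/eqP.
have h : f y - prim g y @[y --> -oo] --> (0 : R).
  by rewrite -(subr0 0); apply: cvgB => //; exact: prim_cvgNy.
have : f y - prim g y @[y --> -oo] --> f x - prim g x.
  under eq_fun do rewrite (primitive_uniq cg ig df _ x).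
  exact: cvg_cst.
by move=> /(cvg_unique _ h) => ->.
Qed.

Lemma le_L1_deriv f g : continuous g -> int1 g ->
  (forall x, is_derive x (1 : R) f (g x)) -> f x @[x --> -oo] --> (0 : R) ->
  forall x, `|f x| <= \int[mu]_y `|g y|.
Proof. by move=> cg ig df /(prim_uniq cg ig df) -> x; exact: prim_le. Qed.

Lemma int1_tail_not_bounded f (c a : R) : 0 < c -> int1 f ->
  ~ (forall x, a <= x -> c <= `|f x|).
Proof.
move=> c0 fi h.
pose I := \int[mu]_x `|f x|.
have I0 : 0 <= I by apply: Rint_ge0.
(* The length is chosen so that the lower bound [c] alone contributes [I + 1], more than the norm
   [I]. *)
pose b := a + (I + 1) / c.
have ab : a <= b by rewrite /b lerDl divr_ge0// ?addr_ge0// ltW.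
have : \int[mu]_x (c * \1_`[a, b] x) <= I.
  apply: Rint_le; [by apply: int1Z; exact: int1_indic|exact: int1_abs|].
  move=> x; rewrite indicE; case: (boolP (x \in _)) => [|_].
    by rewrite inE /= in_itv/= mulr1 => /andP[ax _]; exact: h.
  by rewrite mulr0.
rewrite RintZ; last exact: int1_indic.
rewrite /Rintegral integral_indic//= setIT lebesgue_measure_itv/= lte_fin.
case: ltP => [_|ba].
  by rewrite -EFinB/= /b addrAC subrr add0r mulrC divfK ?gt_eqF//; lra.
have : 0 < (I + 1) / c by rewrite divr_gt0// ltr_wpDl.
by rewrite /b in ba; lra.
Qed.

(** A bounded primitive of [|f (- x)|] is the opposite of the reflected primitive of [|f|]. *)
Lemma int1_opp f : int1 f -> continuous f -> int1 (fun x => f (- x)).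
Proof.
move=> fi cf.
pose G x := - prim (fun y => `|f y|) (- x).
have cn : continuous (fun y => `|f y|).
  by move=> y; apply: cvg_norm; exact: cf.
have c2 : continuous (fun x => f (- x)).
  by move=> x; apply: continuous_comp; [exact: opp_continuous|exact: cf].
have : int1 (fun x => `|f (- x)|).
  apply: (@bounded_deriv_int1 _ G (\int[mu]_y `|f y|)) => //.
  - by move=> x; apply: cvg_norm; exact: c2.
  - move=> x; rewrite /G.
    have d := prim_derive (- x) cn (int1_abs fi).
    have d2 := is_derive1_comp d (is_deriveNid x (1 : R)).
    have := is_deriveN d2.
    by rewrite mulrN mulr1 opprK.
  - move=> x; rewrite normrN.
    by apply: (le_trans (prim_le _ (int1_abs fi))); under eq_Rintegral do rewrite normr_id.
by move=> h; apply: int1_le h _ => //; exact: cont_meas.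
Qed.

(** An integrable derivative gives [f] a limit at +oo; a nonzero limit would keep [|f|] away from 0
    on a half-line, against integrability. *)
Lemma int1_cvgy f g : continuous g -> int1 f -> int1 g ->
  (forall x, is_derive x (1 : R) f (g x)) -> f x @[x --> +oo] --> (0 : R).
Proof.
move=> cg fi gi df.
pose l := f 0 - prim g 0 + \int[mu]_x g x.
have fl : f x @[x --> +oo] --> l.
  have : (f 0 - prim g 0) + prim g y @[y --> +oo] --> l.
    by apply: cvgD; [exact: cvg_cst|exact: prim_cvgy].
  by under eq_fun => y do rewrite -(primitive_uniq cg gi df y 0) subrK.
have [l0|l0] := eqVneq l 0; first by rewrite -l0.
exfalso.
have l2 : 0 < `|l| / 2 by rewrite divr_gt0// normr_gt0.
have /cvgrPdist_lt/(_ _ l2) := fl => -[a [ar H]].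
apply: (@int1_tail_not_bounded f (`|l| / 2) (a + 1)) => // x ax.
have /= h1 := H x ltac:(lra).
have := ler_normD (l - f x) (f x); rewrite subrK; lra.
Qed.

Lemma int1_cvgNy f g : continuous g -> int1 f -> int1 g ->
  (forall x, is_derive x (1 : R) f (g x)) -> f x @[x --> -oo] --> (0 : R).
Proof.
move=> cg fi gi df; apply/cvgNy_compNP.
have cf := is_derive_continuous df.
apply: (@int1_cvgy _ (fun x => - g (- x))).
- by move=> x; apply: cvgN; apply: continuous_comp; [exact: opp_continuous|exact: cg].
- exact: int1_opp.
- by apply: int1N; exact: int1_opp.
- move=> x; have := is_derive1_comp (df (- x)) (is_deriveNid x (1 : R)).
  by rewrite mulrN mulr1.
Qed.

Lemma int1_sup f g : continuous g -> int1 f -> int1 g ->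
  (forall x, is_derive x (1 : R) f (g x)) ->
  forall x, `|f x| <= \int[mu]_y `|g y|.
Proof. by move=> cg fi gi df; apply: le_L1_deriv => //; exact: int1_cvgNy df. Qed.

End Integration.

Section MoreIntegration.
Context {R : realType}.
Implicit Types (f g h F G K : R -> R) (x y : R).

Local Notation mu := (@lebesgue_measure R).

(** The integrals from [-N], normalised to vanish at 0, agree wherever two of them are
    antiderivatives; at each point one takes [N] large enough. *)
Lemma cont_antideriv f : continuous f ->
  exists F, F 0 = 0 /\ forall x, is_derive x (1 : R) F (f x).
Proof.
move=> cf.
pose G (N : nat) x := \int[mu]_(y in `[- N%:R, x]) f y - \int[mu]_(y in `[- N%:R, 0]) f y.
have dG N x : - N%:R < x -> is_derive x (1 : R) (G N) (f x).
  move=> Nx.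
  have ci : mu.-integrable `[- N%:R, x + 1] (EFin \o f).
    apply: continuous_compact_integrable; first exact: segment_compact.
    exact: continuous_itv.
  have [d e] := @continuous_FTC1_closed R f (- N%:R) x (x + 1) ltac:(lra) ci Nx (cf x).
  have d1 : is_derive x (1 : R) (fun x0 => \int[mu]_(y in `[- N%:R, x0]) f y) (f x).
    by rewrite -e; exact: derivable_is_derive.
  by rewrite -[f x]subr0; apply: is_deriveB.
have G0 N : G N 0 = 0 by rewrite /G subrr.
have GG N N' x : (0 < N)%N -> (0 < N')%N -> - N%:R < x -> - N'%:R < x -> G N x = G N' x.
  move=> N0 N'0 Nx N'x; apply/eqP; rewrite -subr_eq0; apply/eqP.
  pose J := `]Num.max (- N%:R) (- N'%:R), +oo[%classic : set R.
  have -> : 0 = G N 0 - G N' 0 :> R by rewrite !G0 subrr.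
  apply: (@hdw_const R J (fun x => G N x - G N' x)).
  - exact: interval_is_interval.
  - move=> t; rewrite /J /= in_itv/= andbT gt_max => /andP[a b].
    rewrite -(subrr (f t)); apply: is_derive_hdw.
    by apply: is_deriveB; exact: dG.
  - by rewrite /J /= in_itv/= andbT gt_max Nx.
  - by rewrite /J /= in_itv/= andbT gt_max !oppr_lt0 !ltr0n N0.
(* One unit beyond the first integer above [|x|], so that the ball of radius 1 about [x] stays to
   the right of [- n x]. *)
pose n x : nat := (Num.truncn `|x|).+2.
exists (fun x => G (n x) x); split; first exact: G0.
move=> x; apply/is_derive_hdwT/hdwP => e e0.
have nx y : `|y - x| < 1 -> - (n x)%:R < y.
  have := truncnS_gt `|x| => h.
  have -> : (n x)%:R = (Num.truncn `|x|).+1%:R + 1 :> R by rewrite natr1.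
  by rewrite ltr_norml => /andP[a b]; move: h; rewrite ltr_norml => /andP[c d]; lra.
have /is_derive_hdwT/hdwP/(_ e e0)[k k0 H] := dG (n x) x ltac:(by apply: nx; rewrite subrr normr0).
exists (Num.min k 1); first by rewrite lt_min k0 ltr01.
move=> s _; rewrite lt_min => /andP[sk s1].
have -> : G (n s) s = G (n x) s.
  apply: GG => //; last exact: nx.
  have := truncnS_gt `|s|.
  by rewrite ltr_norml => /andP[a b]; rewrite /n -natr1; lra.
exact: H.
Qed.

(** The supremum of [|f|] over the ball of radius [M] about [x] is at most [|f x|] plus the integral
    of [|g|] over [x - M, x + M], which is integrable in [x]. Such a majorant survives composition
    with maps that move points by at most [M]. *)
Lemma int1_dom f g (M : R) : continuous g -> int1 f -> int1 g ->
  (forall x, is_derive x (1 : R) f (g x)) ->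
  exists2 K, int1 K & forall x y, `|y - x| <= M -> `|f y| <= K x.
Proof.
move=> cg fi gi df.
have [M0|M0] := ltP M 0.
  by exists f => // x y h; have := normr_ge0 (y - x); lra.
pose a x := `|g x|.
have ca : continuous a by move=> x; apply: cvg_norm; exact: cg.
have ai : int1 a by exact: int1_abs.
pose P := prim a.
have dP x : is_derive x (1 : R) P (a x) by exact: prim_derive.
have cP : continuous P := is_derive_continuous dP.
have mP x y : x <= y -> P x <= P y.
  move=> xy; rewrite -subr_ge0 -lee_fin -(FTC_itv xy ca dP).
  by apply: integral_ge0 => z _; rewrite lee_fin /a.
have [A [_ dA]] := cont_antideriv cP.
have shl z x F F' : (forall x, is_derive x (1 : R) F (F' x)) ->
    is_derive x (1 : R) (fun x => F (x + z)) (F' (x + z)).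
  move=> dF; have h : is_derive x (1 : R) (shift z) 1 by exact: is_derive_shift.
  by have := @is_derive1_comp R F (shift z) x (F' (x + z)) 1 (dF (x + z)) h; rewrite mulr1.
have sh z F : continuous F -> continuous (fun x => F (x + z)).
  move=> cF x; apply: continuous_comp; last exact: cF.
  by apply: cvgD; [exact: cvg_id|exact: cvg_cst].
pose k x := P (x + M) - P (x - M).
have ki : int1 k.
  apply: (@bounded_deriv_int1 _ _ (fun x => A (x + M) - A (x - M))
    ((\int[mu]_y `|a y|) * (2 * M))).
  - by move=> x; apply: cvgB; apply: sh.
  - by move=> x; rewrite subr_ge0; apply: mP; lra.
  - move=> x; have := @is_derive_bound _ _ _ _ dA _ (x + M) (x - M).
    move=> /(_ (\int[mu]_y `|a y|)).
    have -> : `|x + M - (x - M)| = 2 * M by rewrite ger0_norm; lra.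
    by apply => t; exact: prim_le.
exists (fun x => `|f x| + k x); first by apply: int1D => //; exact: int1_abs.
move=> x y xy.
suff : `|f y - f x| <= k x.
  by move=> h; rewrite -[f y](subrK (f x)) addrC (le_trans (ler_normD _ _))// lerD2l.
have H u v : u <= v -> `|f v - f u| <= P v - P u.
  move=> uv.
  have h1 : 0 <= (P v + f v) - (P u + f u).
    rewrite -lee_fin -(@FTC_itv _ (fun x => P x + f x) (fun x => a x + g x) _ _ uv).
    + apply: integral_ge0 => z _; rewrite lee_fin /a.
      by have := ler_norm (- g z); rewrite normrN; lra.
    + by move=> z; apply: cvgD; [exact: ca|exact: cg].
  have h2 : 0 <= (P v - f v) - (P u - f u).
    rewrite -lee_fin -(@FTC_itv _ (fun x => P x - f x) (fun x => a x - g x) _ _ uv).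
    + by apply: integral_ge0 => z _; rewrite lee_fin subr_ge0 ler_norm.
    + by move=> z; apply: cvgB; [exact: ca|exact: cg].
  by apply/ler_normlP; split; lra.
move: xy; rewrite ler_norml => /andP[xy1 xy2].
have m1 : P y <= P (x + M) by apply: mP; lra.
have m2 : P (x - M) <= P y by apply: mP; lra.
have m3 : P x <= P (x + M) by apply: mP; lra.
have m4 : P (x - M) <= P x by apply: mP; lra.
by have [xy|/ltW xy] := leP x y; [have := H _ _ xy|have := H _ _ xy; rewrite distrC]; rewrite /k; lra.
Qed.

(** Bounded displacement gives surjectivity and the limits of [phi]; the limits of [phi'] are what
    the substitution rule on the whole line asks for. *)
Definition diffeo (phi phi' : R -> R) : Prop :=
  [/\ forall x, is_derive x (1 : R) phi (phi' x), continuous phi',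
      forall x, 0 < phi' x,
      phi' x @[x --> -oo] --> (1 : R) /\ phi' x @[x --> +oo] --> (1 : R) &
      exists M : R, forall x, `|phi x - x| <= M].

Section Diffeo.
Variables (phi phi' : R -> R).
Hypothesis dphi : diffeo phi phi'.

Let psi := inverse phi.

Lemma diffeo_cont : continuous phi.
Proof. by have [h _ _ _ _] := dphi; exact: is_derive_continuous h. Qed.

Lemma diffeo_incr : {homo phi : x y / x < y}.
Proof.
move=> x y xy; have [h _ p _ _] := dphi.
have [|c _ E] := @hdw_mvt R x y phi phi' xy.
  by move=> t _; apply: is_derive_hdw.
by rewrite -subr_gt0 E mulr_gt0// subr_gt0.
Qed.

Lemma diffeo_inj : injective phi.
Proof.
move=> x y E; have [xy|xy|//] := ltgtP x y.
  by have := diffeo_incr xy; rewrite E ltxx.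
by have := diffeo_incr xy; rewrite E ltxx.
Qed.

Lemma diffeo_surj y : exists x, phi x = y.
Proof.
have [_ _ _ _ [M hM]] := dphi.
have M0 : 0 <= M by apply: le_trans (hM 0).
have /ler_normlP[a b] := hM (y - M); have /ler_normlP[c d] := hM (y + M).
have [//| | |x _ xy] := @IVT R phi (y - M) (y + M) y; last by exists x.
- lra.
- by apply: continuous_subspaceT; exact: diffeo_cont.
- by apply/andP; split; [rewrite ge_min; apply/orP; left|rewrite le_max; apply/orP; right]; lra.
Qed.

Lemma inverseK x : phi (psi x) = x.
Proof.
rewrite /psi /inverse pinvK// inE.
by have [z <-] := diffeo_surj x; exists z.
Qed.

Lemma inverseKV x : psi (phi x) = x.
Proof.
rewrite /psi /inverse pinvKV// ?inE//.
by move=> a b _ _; exact: diffeo_inj.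
Qed.

Lemma inverse_derive x : is_derive x (1 : R) psi (phi' (psi x))^-1.
Proof.
have [h _ p _ _] := dphi.
have := @is_derive_inverse R phi psi (phi' (psi x)) (psi x).
rewrite inverseK; apply.
- by exists 1 => //= z _; exact: inverseKV.
- by exists 1 => //= z _; exact: diffeo_cont.
- by rewrite gt_eqF.
Qed.

Lemma diffeo_cvgNy : phi x @[x --> -oo] --> -oo.
Proof.
have [_ _ _ _ [M hM]] := dphi.
apply/cvgrNyPle => A; exists (A - M); split; first exact: num_real.
by move=> x xA; have /ler_normlP[] := hM x; lra.
Qed.

Lemma diffeo_cvgy : phi x @[x --> +oo] --> +oo.
Proof.
have [_ _ _ _ [M hM]] := dphi.
apply/cvgryPge => A; exists (A + M); split; first exact: num_real.
by move=> x xA; have /ler_normlP[] := hM x; lra.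
Qed.

Lemma ge0_integral_diffeo f : continuous f -> (forall x, 0 <= f x) ->
  (\int[mu]_x (f x)%:E = \int[mu]_x (f (phi x) * phi' x)%:E)%E.
Proof.
move=> cf f0; have [h c p [lN ly] _] := dphi.
rewrite (@increasing_ge0_integration_by_substitutionT _ phi f)//.
- by under eq_integral do rewrite /= (is_derive_der h).
- exact: diffeo_incr.
- by rewrite (is_derive_der h).
- by rewrite (is_derive_der h); apply/cvg_ex; exists 1.
- by rewrite (is_derive_der h); apply/cvg_ex; exists 1.
- exact: diffeo_cvgNy.
- exact: diffeo_cvgy.
Qed.

Lemma int1_diffeo f : continuous f -> int1 f -> int1 (fun x => f (phi x) * phi' x).
Proof.
move=> cf fi; have [h c p _ _] := dphi.
have cfp : continuous (fun x => f (phi x) * phi' x).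
  move=> x; apply: cvgM; last exact: c.
  by apply: continuous_comp; [exact: diffeo_cont|exact: cf].
have cn : continuous (fun x => `|f (phi x) * phi' x|).
  by move=> x; apply: cvg_norm; exact: cfp.
have : int1 (fun x => `|f (phi x) * phi' x|).
  apply: (@abse_integral_le _ _ (\int[mu]_x `|f x|)) => //.
  rewrite -integral_EFin; last exact: int1_abs.
  rewrite (@ge0_integral_diffeo (fun x => `|f x|))//; last first.
    by move=> x; apply: cvg_norm; exact: cf.
  by under eq_integral do rewrite normrM (gtr0_norm (p _)).
by move=> hi; apply: int1_le hi _ => //; exact: cont_meas.
Qed.

(** The substitution rule is available for nonnegative integrands, hence the splitting of [f] as
    [|f| - (|f| - f)]; unlike the positive and negative parts, both terms are visibly continuous. *)
Lemma Rint_diffeo f : continuous f -> int1 f ->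
  \int[mu]_x f x = \int[mu]_x (f (phi x) * phi' x).
Proof.
move=> cf fi; have [h c p _ _] := dphi.
have cn : continuous (fun x => `|f x|) by move=> x; apply: cvg_norm; exact: cf.
have ni := int1_abs fi.
have H f0 : continuous f0 -> (forall x, 0 <= f0 x) ->
    \int[mu]_x f0 x = \int[mu]_x (f0 (phi x) * phi' x).
  by move=> c0 p0; rewrite /Rintegral (ge0_integral_diffeo c0 p0).
have -> : \int[mu]_x f x = \int[mu]_x (`|f x|) - \int[mu]_x (`|f x| - f x).
  by rewrite RintB// opprB addrC subrK.
rewrite H// (H (fun x => `|f x| - f x)); last 2 first.
- by move=> x; apply: cvgB; [exact: cn|exact: cf].
- by move=> x; rewrite subr_ge0 ler_norm.
rewrite -RintB; last 2 first.
- by apply: (@int1_diffeo (fun x => `|f x|)).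
- apply: (@int1_diffeo (fun x => `|f x| - f x)); last exact: int1B.
  by move=> x; apply: cvgB; [exact: cn|exact: cf].
by apply: eq_Rintegral => x _; ring.
Qed.

Lemma int1_comp_diffeo f (c : R) : 0 < c -> (forall x, c <= phi' x) ->
  continuous f -> int1 f -> int1 (fun x => f (phi x)).
Proof.
move=> c0 cp cf fi.
apply: (@int1_le _ _ (fun x => c^-1 * `|f (phi x) * phi' x|)).
- apply: cont_meas => x.
  by apply: continuous_comp; [exact: diffeo_cont|exact: cf].
- by apply: int1Z; apply: int1_abs; exact: int1_diffeo.
- move=> x; have [_ _ p _ _] := dphi.
  rewrite normrM (gtr0_norm (p x)) mulrC ler_pdivlMr//.
  by rewrite ler_wpM2l.
Qed.

End Diffeo.

(** The classical form of W^{oo,1}. For continuous functions it is shown equivalent to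
    [sobolev1_infty] in [sobolev_wfun] and [wfun_sobolev]. *)
Definition wfun f : Prop := smooth f /\ forall n, int1 (derive1n n f).

Lemma wfun_dseq (F : nat -> R -> R) : dseq F -> (forall n, int1 (F n)) -> wfun (F 0%N).
Proof.
move=> dF iF; split; first exact: dseq_smooth.
by move=> n; rewrite dseq_derive1n.
Qed.

Lemma smooth_cont f n : smooth f -> continuous (derive1n n f).
Proof. by move=> sf; exact: (is_derive_continuous (smooth_dseq sf n)). Qed.

Lemma wfun_cont f n : wfun f -> continuous (derive1n n f).
Proof. by case=> sf _; exact: smooth_cont. Qed.

Lemma wfun_derive f n x : wfun f ->
  is_derive x (1 : R) (derive1n n f) (derive1n n.+1 f x).
Proof. by case=> sf _; exact: (smooth_dseq sf). Qed.

Lemma wfun_int f n : wfun f -> int1 (derive1n n f).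
Proof. by case. Qed.

Lemma wfun_der f : wfun f -> wfun f^`()%classic.
Proof.
by case=> sf fi; split; [exact: smooth_der|move=> n; rewrite -derive1Sn].
Qed.

Lemma wfun_sup f n x : wfun f ->
  `|derive1n n f x| <= \int[mu]_y `|derive1n n.+1 f y|.
Proof.
move=> wf; apply: int1_sup => [| | |z]; [exact: wfun_cont|exact: wfun_int|exact: wfun_int|].
exact: wfun_derive.
Qed.

Lemma wfun_cvgy f : wfun f -> f x @[x --> +oo] --> (0 : R).
Proof.
move=> wf; apply: (@int1_cvgy _ f (derive1n 1 f)).
- exact: wfun_cont.
- exact: (wfun_int 0).
- exact: wfun_int.
- by move=> x; exact: (wfun_derive 0).
Qed.

Lemma wfun_cvgNy f : wfun f -> f x @[x --> -oo] --> (0 : R).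
Proof.
move=> wf; apply: (@int1_cvgNy _ f (derive1n 1 f)).
- exact: wfun_cont.
- exact: (wfun_int 0).
- exact: wfun_int.
- by move=> x; exact: (wfun_derive 0).
Qed.

Lemma wfun_dom f n (M : R) : wfun f ->
  exists2 K, int1 K & forall x y, `|y - x| <= M -> `|derive1n n f y| <= K x.
Proof.
move=> wf; apply: (@int1_dom _ (derive1n n.+1 f)).
- exact: wfun_cont.
- exact: wfun_int.
- exact: wfun_int.
- by move=> x; exact: wfun_derive.
Qed.

End MoreIntegration.

(** * Bump functions and weak derivatives *)

Section SmoothStep.
Context {R : realType}.
Implicit Types (f g F : R -> R) (x y : R).

(** Derivatives are existential witnesses, so closure under products follows by induction from the
    first-order product rule, with no Leibniz formula of order [n]. *)
Fixpoint Cn (n : nat) f : Prop :=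
  if n is m.+1 then exists2 g, (forall x, is_derive x (1 : R) f (g x)) & Cn m g
  else True.

Lemma Cn_smooth f : (forall n, Cn n f) -> smooth f.
Proof.
move=> h n; have {h} := h n.+1; elim: n f => [|n IH] f.
  by move=> [g df _] x; rewrite derive1n0; apply: ex_derive; exact: df.
move=> [g df /IH hg] x; rewrite derive1Sn (is_derive_der df); exact: hg.
Qed.

Lemma smooth_Cn n f : smooth f -> Cn n f.
Proof.
elim: n f => [//|n IH] f sf; exists f^`()%classic; last exact/IH/smooth_der.
by move=> x; exact: (smooth_dseq sf 0).
Qed.

Lemma CnW n f : Cn n.+1 f -> Cn n f.
Proof.
elim: n f => [//|n IH] f [g df hg]; exists g => //; exact: IH.
Qed.

Lemma CnD n f g : Cn n f -> Cn n g -> Cn n (fun x => f x + g x).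
Proof.
elim: n f g => [//|n IH] f g [f' df hf] [g' dg hg].
exists (fun x => f' x + g' x); last exact: IH.
by move=> x; apply: is_deriveD.
Qed.

Lemma CnZ n c f : Cn n f -> Cn n (fun x => c * f x).
Proof.
elim: n f => [//|n IH] f [f' df hf].
exists (fun x => c * f' x); last exact: IH.
by move=> x; apply: is_deriveZ.
Qed.

Lemma CnM n f g : Cn n f -> Cn n g -> Cn n (fun x => f x * g x).
Proof.
elim: n f g => [//|n IH] f g hf hg.
have hf1 := CnW hf; have hg1 := CnW hg.
case: hf hg => [f' df hf] [g' dg hg].
exists (fun x => f x * g' x + g x * f' x).
  by move=> x; apply: is_deriveM.
by apply: CnD; apply: IH.
Qed.

Lemma Cn_affine n a b f : Cn n f -> Cn n (fun x => f (a * x + b)).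
Proof.
elim: n f => [//|n IH] f [f' df hf].
exists (fun x => a * f' (a * x + b)); last by apply: CnZ; exact: IH.
move=> x.
have h : is_derive x (1 : R) (fun x => a * x + b) a.
  rewrite -[X in is_derive _ _ _ X]addr0; apply: is_deriveD.
  by rewrite -[X in is_derive _ _ _ X]mulr1; apply: is_deriveZ.
by have := @is_derive1_comp R f (fun x => a * x + b) x _ _ (df _) h; rewrite mulrC.
Qed.

(** The functions x^(-k) exp(-1/x), extended by 0. Differentiation maps the family into its own
    span, so one computation gives smoothness. *)
Definition flat (k : nat) x : R :=
  if 0 < x then x^-1 ^+ k * expR (- x^-1) else 0.

(** From exp y >= y^(k+2) / (k+2)! at y = 1/x. A quadratic bound is what makes the derivative at 0
    vanish. *)
Lemma flat_le k x : `|flat k x| <= (k.+2)`!%:R * x ^+ 2.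
Proof.
rewrite /flat; case: ifPn => [x0|_]; last by rewrite normr0 mulr_ge0// sqr_ge0.
have y0 : 0 < x^-1 by rewrite invr_gt0.
rewrite ger0_norm ?mulr_ge0 ?exprn_ge0 ?expR_ge0//; last exact: ltW.
have := expR_ge1Dxn k.+1 (ltW y0) => h.
have {h} : x^-1 ^+ k.+2 / (k.+2)`!%:R <= expR x^-1 by lra.
rewrite ler_pdivrMr ?ltr0n ?fact_gt0// => h.
rewrite -(@ler_pM2r _ (x ^- 2)) ?invr_gt0 ?exprn_gt0//.
rewrite mulfK ?gt_eqF ?exprn_gt0// expRN.
rewrite mulrAC ler_pdivrMr ?expR_gt0// mulrC.
by rewrite -exprVn -exprD [leRHS]mulrC.
Qed.

Lemma flat_derive k x :
  is_derive x (1 : R) (flat k) (flat k.+2 x - k%:R * flat k.+1 x).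
Proof.
have [x0|x0|->] := ltgtP x 0.
- apply: (@hdw_is_derive _ (x - 1) 0); first by rewrite x0 andbT; lra.
  rewrite /flat !ltNge !(ltW x0)/= mulr0 subr0.
  apply: (@hdw_eq _ _ (fun=> 0)); last exact: hdw_cst.
    by rewrite /= in_itv/= x0 andbT; lra.
  by move=> s; rewrite /= in_itv/= => /andP[_ s0]; rewrite ltNge (ltW s0).
- apply: (@hdw_is_derive _ 0 (x + 1)); first by rewrite x0/=; lra.
  rewrite /flat !x0.
  apply: (@hdw_eq _ _ (fun x => x^-1 ^+ k * expR (- x^-1))).
  + by rewrite /= in_itv/= x0/=; lra.
  + by move=> s; rewrite /= in_itv/= => /andP[-> _].
  apply: is_derive_hdw.
  have xn0 : x != 0 by rewrite gt_eqF.
  have d1 : is_derive x (1 : R) (fun y : R => y^-1) (- x ^- 2).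
    by have := @is_deriveV R id x 1 1 xn0 _; rewrite /GRing.scale/= mulr1; apply.
  have d2 : is_derive x (1 : R) (fun y : R => expR (- y^-1)) (expR (- x^-1) * (x ^- 2)).
    have h := @is_deriveN _ _ _ _ _ _ _ d1; rewrite opprK in h.
    exact: (@is_derive1_comp R expR (fun y : R => - y^-1) x _ _ (is_derive_expR _) h).
  have d3 := @is_deriveX _ _ _ k x 1 _ d1.
  have := is_deriveM d3 d2.
  rewrite !fctE /GRing.scale/=.
  suff -> : x^-1 ^+ k * (expR (- x^-1) * x ^- 2) +
     expR (- x^-1) * (k%:R * x^-1 ^+ k.-1 * - x ^- 2) =
     x^-1 ^+ k.+2 * expR (- x^-1) - k%:R * (x^-1 ^+ k.+1 * expR (- x^-1)) by [].
  case: k d3 => [|k] _.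
    by rewrite mul0r mul0r mulr0 mul0r; field.
  by rewrite [k.+1.-1]/= !exprS; field.
- have F0 m : flat m 0 = 0 by rewrite /flat ltxx.
  rewrite !F0 mulr0 subrr; apply/is_derive_hdwT/hdwP => e e0.
  have C0 : (0 : R) < (k.+2)`!%:R by rewrite ltr0n fact_gt0.
  exists (e / (k.+2)`!%:R); first by rewrite divr_gt0.
  move=> s _; rewrite subr0 F0 subr0 mul0r subr0 => se.
  apply: (le_trans (flat_le k s)).
  rewrite -real_normK ?num_real// expr2 mulrA ler_wpM2r//.
  by rewrite mulrC -ler_pdivlMr// ltW.
Qed.

Lemma Cn_flat n k : Cn n (flat k).
Proof.
elim: n k => [//|n IH] k; exists (fun x => flat k.+2 x + (- k%:R) * flat k.+1 x).
  by move=> x; rewrite mulNr; exact: flat_derive.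
by apply: CnD => //; exact: CnZ.
Qed.

(** The normalised antiderivative of the bump [b], product of the flat function at x and at 1 - x,
    which is positive exactly between 0 and 1. *)
Lemma smooth_step_ex : exists H : R -> R, [/\ smooth H,
  forall x, x <= 0 -> H x = 0, forall x, 1 <= x -> H x = 1 &
  forall x, 0 <= H^`()%classic x].
Proof.
pose b x := flat 0 x * flat 0 (-1 * x + 1).
have sb : smooth b.
  by apply: Cn_smooth => n; apply: CnM; [|apply: Cn_affine]; exact: Cn_flat.
have f0 x : 0 <= flat 0 x.
  by rewrite /flat; case: ifP => // _; rewrite expr0 mul1r expR_ge0.
have b0 x : 0 <= b x by rewrite mulr_ge0.
have [A [A0 dA]] := cont_antideriv (@smooth_cont R _ 0 sb).
rewrite derive1n0 in dA.
have bl x : x <= 0 -> b x = 0 by move=> x0; rewrite /b /flat ltNge x0/= mul0r.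
have br x : 1 <= x -> b x = 0.
  by move=> x1; rewrite /b {2}/flat ltNge; case: lerP; rewrite ?mulr0//; lra.
have A1 : 0 < A 1.
  have [|c c01 E] := @hdw_mvt R 0 1 A b ltr01.
    by move=> t _; apply: is_derive_hdw.
  move: E; rewrite A0 !subr0 mulr1 => ->.
  case/andP: c01 => c0 c1; rewrite /b /flat c0.
  have -> : 0 < -1 * c + 1 by lra.
  by rewrite !expr0 !mul1r mulr_gt0// expR_gt0.
pose H x := (A 1)^-1 * A x.
have dH x : is_derive x (1 : R) H ((A 1)^-1 * b x).
  by apply: is_deriveZ; exact: dA.
have cst01 I x y : is_interval I -> (forall t, I t -> b t = 0) -> I x -> I y -> A x = A y.
  move=> Ii h; apply: (@hdw_const R I A) => // t It.
  by apply: is_derive_hdw; rewrite -(h t It); exact: dA.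
exists H; split.
- apply: Cn_smooth => n; apply: CnZ; case: n => [//|n].
  by exists b => //; exact: smooth_Cn.
- move=> x x0; rewrite /H (cst01 `]-oo, 0]%classic x 0).
  + by rewrite A0 mulr0.
  + exact: interval_is_interval.
  + by move=> t; rewrite /= in_itv/=; exact: bl.
  + by rewrite /= in_itv.
  + by rewrite /= in_itv/=.
- move=> x x0; rewrite /H (cst01 `[1, +oo[%classic x 1).
  + by rewrite mulVf// gt_eqF.
  + exact: interval_is_interval.
  + by move=> t; rewrite /= in_itv/= andbT; exact: br.
  + by rewrite /= in_itv/= andbT.
  + by rewrite /= in_itv/= lexx.
- by move=> x; rewrite (is_derive_der dH) mulr_ge0// invr_ge0 ltW.
Qed.

Definition step : R -> R := projT1 (cid smooth_step_ex).

Lemma stepP : [/\ smooth step,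
  forall x, x <= 0 -> step x = 0, forall x, 1 <= x -> step x = 1 &
  forall x, 0 <= step^`()%classic x].
Proof. by rewrite /step; case: cid. Qed.

Lemma deriv_outside F F' (a b c : R) : (forall x, is_derive x (1 : R) F (F' x)) ->
  (forall x, x < a \/ b < x -> F x = c) -> forall x, x < a \/ b < x -> F' x = 0.
Proof.
move=> dF F0 x [xa|bx].
  have h : is_derive x (1 : R) F 0.
    apply: (@hdw_is_derive _ (x - 1) a); first by rewrite xa andbT; lra.
    apply: (@hdw_eq _ _ (fun=> c)); last exact: hdw_cst.
      by rewrite /= in_itv/= xa andbT; lra.
    by move=> s; rewrite /= in_itv/= => /andP[_ sa]; rewrite F0//; left.
  by have [_ <-] := dF x; have [_ ->] := h.
have h : is_derive x (1 : R) F 0.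
  apply: (@hdw_is_derive _ b (x + 1)); first by rewrite bx/=; lra.
  apply: (@hdw_eq _ _ (fun=> c)); last exact: hdw_cst.
    by rewrite /= in_itv/= bx/=; lra.
  by move=> s; rewrite /= in_itv/= => /andP[sa _]; rewrite F0//; right.
by have [_ <-] := dF x; have [_ ->] := h.
Qed.

Lemma smooth_outside f (a b : R) : smooth f -> (forall x, x < a \/ b < x -> f x = 0) ->
  forall n x, x < a \/ b < x -> derive1n n f x = 0.
Proof.
move=> sf f0; elim=> [|n IH] //.
exact: (deriv_outside (smooth_dseq sf n) IH).
Qed.

Lemma cont_outside_bounded f (a b : R) : a <= b -> continuous f ->
  (forall x, x < a \/ b < x -> f x = 0) -> exists2 M, 0 <= M & forall x, `|f x| <= M.
Proof.
move=> ab cf f0.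
have cn : continuous (fun x => `|f x|) by move=> x; apply: cvg_norm; exact: cf.
have [c _ hc] := EVT_max ab (continuous_subspaceT cn).
exists `|f c| => // x.
have [xa|ax] := ltP x a; first by rewrite (f0 x (or_introl xa)) normr0.
have [bx|xb] := ltP b x; first by rewrite (f0 x (or_intror bx)) normr0.
by apply: hc; rewrite in_itv/= ax.
Qed.

Lemma test_functionP f (a b : R) : smooth f ->
  (forall x, x < a \/ b < x -> f x = 0) -> test_function f.
Proof.
move=> sf f0; split=> //.
apply: (@subclosed_compact _ _ `[a, b]%classic).
- exact: closed_closure.
- exact: segment_compact.
- rewrite closureE => x /(_ `[a, b]%classic); apply; split; first exact: itv_closed.
  move=> z /= /eqP z0; rewrite /= in_itv/=; apply/andP; split; rewrite leNgt; apply/negP => h; apply: z0; apply: f0; [by left|by right].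
Qed.

Lemma test_functionE f : test_function f -> exists2 A : R, 0 < A &
  forall n x, x < - A \/ A < x -> derive1n n f x = 0.
Proof.
move=> [sf /compact_bounded [M [Mr hM]]].
exists (`|M| + 1); first by rewrite ltr_wpDl.
apply: smooth_outside => // x xA; apply/eqP; apply: contrapT => /negP fx.
have : `|x| <= `|M| + 1.
  apply: hM; first by have := ler_norm M; lra.
  by apply: subset_closure.
by move=> /ler_normlP[? ?]; case: xA; lra.
Qed.

Lemma test_bounded f n : test_function f ->
  exists2 M, 0 <= M & forall x, `|derive1n n f x| <= M.
Proof.
move=> tf; have [A A0 hA] := test_functionE tf.
apply: (@cont_outside_bounded _ (- A) A); first lra.
  by case: tf => sf _; exact: smooth_cont.
exact: hA.
Qed.

Lemma int1_supported f (A : R) : continuous f ->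
  (forall x, x < - A \/ A < x -> f x = 0) -> int1 f.
Proof.
move=> cf f0; have [A0|A0] := ltP A 0.
  apply: (@int1_le _ _ (fun=> 0)); [exact: cont_meas|exact: int1_0|move=> x].
  have [xA|xA] := ltP x (- A); first by rewrite f0 ?normr0//; left.
  by rewrite f0 ?normr0//; right; lra.
have [M M0 hM] := @cont_outside_bounded f (- A) A ltac:(lra) cf f0.
apply: (@int1_le _ _ (fun x => M * \1_`[- A, A] x)).
- exact: cont_meas.
- by apply: int1Z; exact: int1_indic.
- move=> x; rewrite indicE; case: (boolP (x \in _)) => [_|]; first by rewrite mulr1.
  rewrite notin_setE /= in_itv/= => /negP; rewrite negb_and -!ltNge => /orP h.
  by rewrite f0 ?normr0 ?mulr0.
Qed.

End SmoothStep.

(** * Smoothed Heaviside functions, Lebesgue points and smooth representatives *)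

Section WeakDerivative.
Context {R : realType}.
Implicit Types (f g h F G : R -> R) (x y p q : R).

Local Notation mu := (@lebesgue_measure R).
Local Notation step := (@step R).

Lemma deriv_local F (d x e c : R) : 0 < e -> is_derive x (1 : R) F d ->
  (forall y, x - e < y < x + e -> F y = c) -> d = 0.
Proof.
move=> e0 dF Fc.
have h : is_derive x (1 : R) F 0.
  apply: (@hdw_is_derive _ (x - e) (x + e)); first by apply/andP; split; lra.
  apply: (@hdw_eq _ _ (fun=> c)); last exact: hdw_cst.
    by rewrite /= in_itv/=; apply/andP; split; lra.
  by move=> s; rewrite /= in_itv/= => /Fc.
by have [_ <-] := dF; have [_ ->] := h.
Qed.

Lemma step_derive n x : is_derive x (1 : R) (derive1n n step) (derive1n n.+1 step x).
Proof. by have [h _ _ _] := @stepP R; exact: (smooth_dseq h). Qed.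

Lemma step_cont n : continuous (derive1n n step).
Proof. exact: (is_derive_continuous (@step_derive n)). Qed.

Lemma dstep_out x : x < 0 \/ 1 < x -> derive1n 1 step x = 0.
Proof.
have [_ s0 s1 _] := @stepP R.
move=> [x0|x1]; have := step_derive 0 x.
  move/(@deriv_local _ _ _ (- x) 0); apply; first lra.
  by move=> y yx; apply: s0; lra.
move/(@deriv_local _ _ _ (x - 1) 1); apply; first lra.
by move=> y yx; apply: s1; lra.
Qed.

Lemma dstep_ge0 x : 0 <= derive1n 1 step x.
Proof. by have [_ _ _ h] := @stepP R; exact: h. Qed.

Lemma dstep_out_n n x : x < 0 \/ 1 < x -> derive1n n.+1 step x = 0.
Proof.
elim: n x => [|n IH] x; first exact: dstep_out.
have d := step_derive n.+1 x.
move=> [x0|x1].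
  by apply: (@deriv_local _ _ _ (- x) 0 _ d); [lra|move=> y yx; apply: IH; left; lra].
by apply: (@deriv_local _ _ _ (x - 1) 0 _ d); [lra|move=> y yx; apply: IH; right; lra].
Qed.

Lemma dstep_bounded n : exists2 M : R, 0 <= M & forall x, `|derive1n n.+1 step x| <= M.
Proof.
apply: (@cont_outside_bounded _ _ 0 1) => //; first exact: step_cont.
exact: dstep_out_n.
Qed.

Lemma step01 x : 0 <= step x <= 1.
Proof.
have [_ s0 s1 _] := @stepP R.
have [x0|x0] := leP x 0; first by rewrite s0// lexx ler01.
have [x1|x1] := leP 1 x; first by rewrite s1// lexx ler01.
have mono a b : a < b -> step a <= step b.
  move=> ab; have [|c _ E] := @hdw_mvt _ a b step (derive1n 1 step) ab.
    by move=> t _; apply: is_derive_hdw; exact: (step_derive 0).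
  by rewrite -subr_ge0 E mulr_ge0 ?dstep_ge0//; lra.
by rewrite -{1}(s0 0)// -(s1 1)// !mono.
Qed.

(** The n-th derivative of x |-> step ((k+1) x). Thus [stepk k 0] approximates the Heaviside
    function and [stepk k 1] is a nonnegative bump of mass 1 on [0, 1/(k+1)]. *)
Definition stepk (k : nat) (n : nat) x : R :=
  k.+1%:R ^+ n * derive1n n step (k.+1%:R * x).

Lemma stepk_derive k n x : is_derive x (1 : R) (stepk k n) (stepk k n.+1 x).
Proof.
have h : is_derive x (1 : R) (fun x => k.+1%:R * x) k.+1%:R.
  by rewrite -[X in is_derive _ _ _ X]mulr1; apply: is_deriveZ.
have := @is_derive1_comp R (derive1n n step) (fun x => k.+1%:R * x) x _ _ (step_derive n _) h.
move=> {}h; rewrite /stepk exprSr -mulrA [k.+1%:R * _]mulrC.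
by apply: is_deriveZ.
Qed.

Lemma stepkB_derive k n p x :
  is_derive x (1 : R) (fun z => stepk k n (z - p)) (stepk k n.+1 (x - p)).
Proof.
have h : is_derive x (1 : R) (shift (- p)) 1 by exact: is_derive_shift.
by have := @is_derive1_comp R _ (shift (- p)) x _ _ (stepk_derive k n (x - p)) h; rewrite mulr1.
Qed.

Lemma stepkB_cont k n p : continuous (fun z => stepk k n (z - p)).
Proof. exact: (is_derive_continuous (@stepkB_derive k n p)). Qed.

Lemma stepk_out k n x : x < 0 \/ k.+1%:R^-1 < x -> stepk k n.+1 x = 0.
Proof.
move=> h; rewrite /stepk dstep_out_n ?mulr0//.
have k0 : (0 : R) < k.+1%:R by [].
case: h => h; [left|right].
  by rewrite pmulr_rlt0.
by rewrite mulrC -ltr_pdivrMr// div1r.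
Qed.

Lemma invk_le1 k : (k.+1%:R : R)^-1 <= 1.
Proof. by rewrite invf_le1// ler1n. Qed.

Lemma invk_gt0 k : 0 < (k.+1%:R : R)^-1.
Proof. by rewrite invr_gt0. Qed.

Lemma stepkB_out k n p x : x < p \/ p + k.+1%:R^-1 < x -> stepk k n.+1 (x - p) = 0.
Proof.
move=> h; apply: stepk_out; case: h => h; [left|right].
  by rewrite subr_lt0.
by rewrite ltrBrDl.
Qed.

Lemma stepkB_int1 k n p : int1 (fun z => stepk k n.+1 (z - p)).
Proof.
apply: (@int1_supported _ _ (`|p| + 1)); first exact: stepkB_cont.
move=> x h; apply: stepkB_out.
move: (k.+1%:R^-1) (invk_le1 k) => i i1.
have := ler_norm p; have := ler_norm (- p); rewrite normrN => ? ?.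
by case: h => h; [left|right]; lra.
Qed.

Lemma stepk_ge0 k x : 0 <= stepk k 1 x.
Proof. by rewrite /stepk mulr_ge0 ?exprn_ge0 ?dstep_ge0. Qed.

Lemma stepk0_out k : (forall x, x <= 0 -> stepk k 0 x = 0) /\
  (forall x, k.+1%:R^-1 <= x -> stepk k 0 x = 1).
Proof.
have [_ s0 s1 _] := @stepP R.
have k0 : (0 : R) < k.+1%:R by [].
split=> x x0; rewrite /stepk expr0 mul1r derive1n0.
  by rewrite s0// pmulr_rle0.
by rewrite s1// mulrC -ler_pdivrMr// div1r.
Qed.

Lemma stepk0_01 k x : `|stepk k 0 x| <= 1.
Proof.
rewrite /stepk expr0 mul1r derive1n0.
by have /andP[a b] := step01 (k.+1%:R * x); rewrite ger0_norm.
Qed.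

Lemma stepkB_integral k p : \int[mu]_z stepk k 1 (z - p) = 1.
Proof.
have [h0 h1] := stepk0_out k.
have ci := @stepkB_cont k 1 p.
have ii := stepkB_int1 k 0 p.
have := prim_cvgy ii.
have -> : prim (fun z => stepk k 1 (z - p)) = (fun z => stepk k 0 (z - p)).
  apply/esym/prim_uniq => //; first by move=> x; exact: stepkB_derive.
  apply: cvg_near_cst; exists p; split; first exact: num_real.
  by move=> x xp; apply: h0; lra.
move=> /cvg_unique; apply => //.
apply: cvg_near_cst; exists (p + 1); split; first exact: num_real.
move=> x xp; apply: h1; move: (k.+1%:R^-1) (invk_le1 k) => i i1; lra.
Qed.

(** One step is not compactly supported, a difference of two is; its derivative is a bump at [p]
    minus a bump at [q]. *)
Definition two_steps k l p q x := stepk k 0 (x - p) - stepk l 0 (x - q).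

Lemma two_steps_dseq k l p q :
  dseq (fun n x => stepk k n (x - p) - stepk l n (x - q)).
Proof. by move=> n x; apply: is_deriveB; exact: stepkB_derive. Qed.

Lemma two_steps_deriv k l p q n : derive1n n (two_steps k l p q) =
  (fun x => stepk k n (x - p) - stepk l n (x - q)).
Proof. by rewrite -(dseq_derive1n (two_steps_dseq k l p q)). Qed.

Lemma two_steps_test k l p q : test_function (two_steps k l p q).
Proof.
have [h0 h1] := stepk0_out k; have [h0' h1'] := stepk0_out l.
have := invk_le1 k => k1; have := invk_le1 l => l1.
apply: (@test_functionP _ _ (Num.min p q) (Num.max p q + 1)).
  exact: (dseq_smooth (two_steps_dseq k l p q)).
move=> x; rewrite lt_min => -[/andP[a b]|h].
  by rewrite /two_steps h0 ?h0' ?subrr//; lra.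
have : p <= Num.max p q by rewrite le_max lexx.
have : q <= Num.max p q by rewrite le_max lexx orbT.
move=> ? ?; rewrite /two_steps h1 ?h1' ?subrr//.
  by move: (l.+1%:R^-1) l1 => i i1; lra.
by move: (k.+1%:R^-1) k1 => i i1; lra.
Qed.

Lemma stepkB_test k p : test_function (fun z => stepk k 1 (z - p)).
Proof.
have := invk_le1 k => k1.
apply: (@test_functionP _ _ p (p + k.+1%:R^-1)); last by move=> x; exact: stepkB_out.
have dq : dseq (fun n x => stepk k n.+1 (x - p)).
  by move=> n x; exact: stepkB_derive.
exact: (dseq_smooth dq).
Qed.

Lemma ae_mono (P Q : R -> Prop) : (forall x, P x -> Q x) ->
  {ae mu, forall x, P x} -> {ae mu, forall x, Q x}.
Proof.
move=> h [N [mN N0 s]]; exists N; split=> // x /= nQ.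
by apply: s => /= /h.
Qed.

Lemma ae_and (P Q : R -> Prop) : {ae mu, forall x, P x} ->
  {ae mu, forall x, Q x} -> {ae mu, forall x, P x /\ Q x}.
Proof. by move=> h1 h2; exact: (@filterI (measurableTypeR R) _ _ P Q h1 h2). Qed.

Lemma ae_exists_itv (P : R -> Prop) (a b : R) : a < b -> {ae mu, forall x, P x} ->
  exists2 x, a < x < b & P x.
Proof.
move=> ab [N [mN N0 sN]]; apply: contrapT => h.
have sub : `]a, b[%classic `<=` N.
  move=> x; rewrite /= in_itv/= => xab; apply: sN => Px; apply: h.
  by exists x.
have : (mu `]a, b[%classic <= mu N)%E by apply: le_measure => //; rewrite inE.
rewrite [X in (_ <= X)%E]N0 lebesgue_measure_itv/= lte_fin ab lee_fin.
lra.
Qed.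

Lemma ae_cont_eq f h : continuous f -> continuous h ->
  {ae mu, forall x, f x = h x} -> f = h.
Proof.
move=> cf ch ae; apply/funext => x; apply/eqP; rewrite -subr_eq0 -normr_le0.
apply/ler_addgt0Pl => e e0; rewrite addr0.
have cd : {for x, continuous (fun z => f z - h z)} by apply: cvgB; [exact: cf|exact: ch].
have /cvgrPdist_le/(_ _ e0)[d /= d0 H] := cd.
have [|y /andP[y1 y2] E] := @ae_exists_itv _ x (x + d) _ ae; first lra.
have := H y; rewrite /ball_/= E subrr subr0; apply.
by rewrite ltr_distl; apply/andP; split; lra.
Qed.

(** The bump has height at most (k+1) M on an interval of length 1/(k+1), so the error is at most a
    constant times the mean of [|f - f p|] over a ball shrinking to [p]. *)
Lemma lebesgue_pt_bump f p : int1 f -> lebesgue_pt f p ->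
  \int[mu]_z (f z * stepk k 1 (z - p)) @[k --> \oo] --> f p.
Proof.
move=> fi Lp; have [M M0 hM] := dstep_bounded 0.
have mf := int1_meas fi.
apply/cvgrPdist_le => e e0.
(* The factor 4 is the product of the ball length [4 / (k+1)] and the scaling k+1 of the bump
   height. *)
pose e' := e / (4 * (M + 1)).
have e'0 : 0 < e' by rewrite /e' divr_gt0// mulr_gt0//; lra.
have /fine_cvgP[_ /cvgrPdist_lt/(_ _ e'0)[d /= d0 Hd]] := Lp.
have [N HN] : exists N : nat, forall k, (N <= k)%N -> 2 / k.+1%:R < d.
  exists (Num.truncn (2 / d)) => k kN.
  rewrite ltr_pdivrMr// mulrC -ltr_pdivrMr//.
  apply: lt_le_trans (truncnS_gt _) _.
  by rewrite ler_nat.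
exists N => // k /= /HN kd.
(* Twice the length of the support, so that the open ball contains the closed support of the
   bump. *)
pose rk : R := 2 / k.+1%:R.
have rk0 : 0 < rk by rewrite divr_gt0.
have ibump : int1 (fun z => stepk k 1 (z - p)) by exact: stepkB_int1.
have mbump : measurable_fun [set: R] (fun z => stepk k 1 (z - p)).
  by apply: cont_meas; exact: stepkB_cont.
have bb z : `|stepk k 1 (z - p)| <= k.+1%:R * M.
  by rewrite /stepk expr1 normrM ger0_norm// ler_wpM2l.
have i1 : int1 (fun z => f z * stepk k 1 (z - p)) := int1_bdM fi mbump bb.
have i2 : int1 (fun z => f p * stepk k 1 (z - p)) by exact: int1Z.
have -> : f p - \int[mu]_z (f z * stepk k 1 (z - p)) =
    - \int[mu]_z (f z * stepk k 1 (z - p) - f p * stepk k 1 (z - p)).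
  by rewrite RintB// opprB RintZ// stepkB_integral mulr1.
rewrite normrN.
pose B : set (measurableTypeR R) := ball p rk.
have mB : measurable B by exact: measurable_ball.
have iB : mu.-integrable B (EFin \o (fun z => f z - f p)).
  have h1 : mu.-integrable B (EFin \o f) by exact: int1_set.
  have h2 : mu.-integrable B (EFin \o (fun=> f p)).
    apply: (@integrableS _ _ _ mu `[p - rk, p + rk]) => //.
      by rewrite /B ball_itv; exact: subset_itv_oo_cc.
    apply: continuous_compact_integrable; first exact: segment_compact.
    by apply: continuous_subspaceT => x; exact: cvg_cst.
  by have := integrableB mB h1 h2.
pose D := \int[mu]_(z in B) `|f z - f p|.
have bound : `|\int[mu]_z (f z * stepk k 1 (z - p) - f p * stepk k 1 (z - p))|
    <= k.+1%:R * M * D.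
  pose ph : R -> R := (fun z => `|f z - f p|) \_ B.
  have phi1 : int1 ph.
    by have := integrable_norm iB; rewrite (integrable_mkcond _ mB) restrict_EFin.
  have -> : D = \int[mu]_z ph z by rewrite /D Rintegral_mkcond.
  rewrite -RintZ//.
  apply: Rint_abs_le; [exact: int1B|exact: int1Z|].
  move=> z; rewrite -mulrBl normrM /ph patchE; case: ifPn => [_|].
    by rewrite mulrC ler_wpM2r.
  rewrite notin_setE /B ball_itv /= in_itv/= => /negP; rewrite negb_and -!leNgt => zB.
  rewrite stepkB_out ?normr0 ?mulr0//.
  have k2 : rk = 2 * k.+1%:R^-1 by [].
  move: (k.+1%:R^-1) (invk_gt0 k) k2 zB => i i0 -> /orP[]; [left|right]; lra.
apply: (le_trans bound).
have := Hd rk; rewrite /ball_/= sub0r normrN gtr0_norm// => /(_ kd rk0).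
rewrite sub0r normrN /davg /iavg (lebesgue_measure_ball _ (ltW rk0)).
have rk2 : rk *+ 2 != 0 by rewrite mulrn_eq0/= gt_eqF.
rewrite inver (negbTE rk2).
have -> : (\int[mu]_(y in ball p rk) `|((center (f p) \o f) y)%:E|)%E = D%:E.
  rewrite /D /Rintegral fineK//; apply: integrable_fin_num => //.
  exact: integrable_norm.
rewrite -EFinM/= ger0_norm; last first.
  rewrite mulr_ge0 ?invr_ge0 ?mulrn_wge0 ?(ltW rk0)//.
  by apply: Rintegral_ge0.
rewrite mulrC ltr_pdivrMr ?mulrn_wgt0// => DD.
have k0 : (0 : R) < k.+1%:R by [].
have D0 : 0 <= D by apply: Rintegral_ge0.
apply: (@le_trans _ _ (k.+1%:R * (M + 1) * (e' * (rk *+ 2)))).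
  apply: ler_pM => //; first by rewrite mulr_ge0//.
    by rewrite ler_wpM2l//; lra.
  exact: ltW.
rewrite /e' /rk -mulr_natr le_eqVlt; apply/orP; left; apply/eqP.
by field; rewrite gt_eqF//= gt_eqF//; lra.
Qed.

Lemma int1_stepk g k p : int1 g -> int1 (fun z => g z * stepk k 0 (z - p)).
Proof.
move=> gi; apply: (@int1_bdM _ _ _ 1) => //.
  by apply: cont_meas; exact: stepkB_cont.
by move=> x; exact: stepk0_01.
Qed.

Lemma Rint_stepk_cvg g p : int1 g ->
  \int[mu]_z (g z * stepk k 0 (z - p)) @[k --> \oo] --> \int[mu]_z g z - prim g p.
Proof.
move=> gi.
have ri : int1 (g \_ `]-oo, p]) by exact: int1_restrict.
rewrite primE -RintB//.
apply: (@Rdct _ _ _ (fun x => `|g x|)).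
- by move=> k; apply: int1_meas; exact: int1_stepk.
- move=> x; apply: cvg_near_cst; rewrite patchE; case: ifPn.
    rewrite inE /= in_itv/= => xp; apply: nearW => k.
    by rewrite subrr (stepk0_out k).1 ?mulr0//; lra.
  rewrite notin_setE /= in_itv/= => /negP; rewrite -ltNge => px.
  exists (Num.truncn (x - p)^-1) => // k /= kN.
  rewrite subr0 (stepk0_out k).2 ?mulr1// invf_ple ?posrE//; last by rewrite subr_gt0.
  apply: (le_trans (ltW (truncnS_gt _))).
  by rewrite ler_nat.
- exact: int1_abs.
- by move=> k x; rewrite normrM ler_piMr// stepk0_01.
- by apply: int1_meas; exact: int1B.
Qed.

Lemma Rint_ae_eq f g : int1 f -> int1 g -> {ae mu, forall x, f x = g x} ->
  \int[mu]_x f x = \int[mu]_x g x.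
Proof.
move=> fi gi h; rewrite /Rintegral; congr fine.
apply: ae_eq_integral => //.
- by apply/measurable_EFinP; exact: int1_meas.
- by apply/measurable_EFinP; exact: int1_meas.
- by apply: (ae_mono _ h) => x /= ->.
Qed.

Lemma prim_ae_eq f g p : int1 f -> int1 g -> {ae mu, forall x, f x = g x} ->
  prim f p = prim g p.
Proof.
move=> fi gi h; rewrite !primE; apply: Rint_ae_eq; [exact: int1_restrict|exact: int1_restrict|].
by apply: (ae_mono _ h) => x; rewrite !patchE => ->.
Qed.

Lemma int1_test f chi n : int1 f -> test_function chi -> int1 (fun x => f x * derive1n n chi x).
Proof.
move=> fi tf; have [M M0 hM] := test_bounded n tf.
apply: (@int1_bdM _ _ _ M) => //.
by apply: cont_meas; case: tf => s _; exact: smooth_cont.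
Qed.

(** Both sides of the defining identity are computed for the test functions [two_steps k k p q]:
    their derivatives recover [f] at the two Lebesgue points, while the steps themselves tend to
    indicators of half-lines and produce primitives of [g]. *)
Lemma weak_diff f g p q : int1 f -> int1 g -> weak_derivative f g ->
  lebesgue_pt f p -> lebesgue_pt f q -> f p - f q = prim g p - prim g q.
Proof.
move=> fi gi w Lp Lq.
have h1 : \int[mu]_z (f z * (two_steps k k p q)^`()%classic z) @[k --> \oo] --> f p - f q.
  have E k : \int[mu]_z (f z * (two_steps k k p q)^`()%classic z) =
     \int[mu]_z (f z * stepk k 1 (z - p)) - \int[mu]_z (f z * stepk k 1 (z - q)).
    have I x : int1 (fun z => f z * stepk k 1 (z - x)).
      by apply: (@int1_test _ _ 0) => //; exact: stepkB_test.
    rewrite -RintB//; apply: eq_Rintegral => z _.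
    by rewrite -[(two_steps k k p q)^`()%classic]/(derive1n 1 _) two_steps_deriv mulrBr.
  under eq_fun do rewrite E.
  by apply: cvgB; exact: lebesgue_pt_bump.
have h2 : \int[mu]_z (f z * (two_steps k k p q)^`()%classic z) @[k --> \oo]
    --> prim g p - prim g q.
  have E k : \int[mu]_z (f z * (two_steps k k p q)^`()%classic z) =
     \int[mu]_z (g z * stepk k 0 (z - q)) - \int[mu]_z (g z * stepk k 0 (z - p)).
    rewrite w; last exact: two_steps_test.
    rewrite -RintB; [|exact: int1_stepk|exact: int1_stepk].
    rewrite -RintN.
      by apply: eq_Rintegral => z _; rewrite /two_steps; ring.
    by apply: (@int1_test _ _ 0) => //; exact: two_steps_test.
  have -> : prim g p - prim g q = (\int[mu]_z g z - prim g q) - (\int[mu]_z g z - prim g p) by ring.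
  under eq_fun do rewrite E.
  by apply: cvgB; exact: Rint_stepk_cvg.
exact: (cvg_unique _ h1 h2).
Qed.

Lemma ae_lebesgue_pt f : int1 f -> {ae mu, forall x, lebesgue_pt f x}.
Proof.
move=> fi; apply: lebesgue_differentiation.
by apply: open_integrable_locally; first exact: openT.
Qed.

(** Bumps are themselves test functions; at a Lebesgue point of [g - h] the integrals against them,
    all zero, converge to the value there. *)
Lemma weak_uniq f g h : int1 g -> int1 h -> weak_derivative f g ->
  weak_derivative f h -> {ae mu, forall x, g x = h x}.
Proof.
move=> gi hi wg wh.
apply: (ae_mono _ (ae_lebesgue_pt (int1B gi hi))) => p Lp.
apply/eqP; rewrite -subr_eq0; apply/eqP.
have := lebesgue_pt_bump (int1B gi hi) Lp.
have E k : \int[mu]_z ((g z - h z) * stepk k 1 (z - p)) = 0.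
  have t := stepkB_test k p.
  under eq_Rintegral do rewrite mulrBl.
  rewrite RintB; [|by apply: (@int1_test _ _ 0)|by apply: (@int1_test _ _ 0)].
  by apply/eqP; rewrite subr_eq0 -eqr_opp -wg// -wh.
under eq_fun do rewrite E.
have h0 : (fun _ : nat => 0 : R) @ \oo --> (0 : R) by exact: cvg_cst.
by move=> H; exact: (cvg_unique _ H h0).
Qed.

Lemma int1_deriv0 F F' : continuous F' -> int1 F -> int1 F' ->
  (forall x, is_derive x (1 : R) F (F' x)) -> \int[mu]_x F' x = 0.
Proof.
move=> cF iF iF' dF.
have y0 := int1_cvgy cF iF iF' dF; have N0 := int1_cvgNy cF iF iF' dF.
have := prim_cvgy iF'; rewrite -(prim_uniq cF iF' dF N0) => h.
exact: (cvg_unique _ h y0).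
Qed.

Lemma classical_weak f f' : continuous f' -> int1 f -> int1 f' ->
  (forall x, is_derive x (1 : R) f (f' x)) -> weak_derivative f f'.
Proof.
move=> cf fi fi' df chi tf.
have cf0 : continuous f by exact: is_derive_continuous df.
have sc := tf.1.
have i1 : int1 (fun x => f x * chi^`()%classic x) by exact: (@int1_test _ _ 1).
have i0 : int1 (fun x => f' x * chi x) by exact: (@int1_test _ _ 0).
have i00 : int1 (fun x => f x * chi x) by exact: (@int1_test _ _ 0).
apply/eqP; rewrite -addr_eq0 -RintD//; apply/eqP.
apply: (@int1_deriv0 (fun x => f x * chi x)) => //; last 2 first.
- exact: int1D.
- move=> x; rewrite [f' x * _]mulrC; apply: is_deriveM; exact: (smooth_dseq sc 0).
- move=> x; apply: cvgD; apply: cvgM; [exact: cf0|exact: (@smooth_cont _ _ 1)|exact: cf|exact: (@smooth_cont _ _ 0)].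
Qed.

Lemma sobolev1_ae k g h : {ae mu, forall x, g x = h x} -> int1 h ->
  sobolev1 k g -> sobolev1 k h.
Proof.
case: k => [|k] ae hi [gi]; first by [].
move=> [g' w s]; split=> //; exists g' => // chi tc; rewrite -w//.
apply: Rint_ae_eq; [exact: (@int1_test _ _ 1)|exact: (@int1_test _ _ 1)|].
by apply: (ae_mono _ ae) => x ->.
Qed.

Lemma weak_ae f g : int1 f -> int1 g -> weak_derivative f g ->
  exists C : R, {ae mu, forall x, f x = C + prim g x}.
Proof.
move=> fi gi w; have ae := ae_lebesgue_pt fi.
have [q _ Lq] := ae_exists_itv ltr01 ae.
exists (f q - prim g q); apply: (ae_mono _ ae) => p Lp.
by have := weak_diff fi gi w Lp Lq; lra.
Qed.

Lemma prim_cont g : int1 g -> continuous (prim g).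
Proof.
move=> gi x; apply/cvgrPdist_lt => e e0.
have [d [d0 H]] := integral_normr_continuous gi e0.
have D u v : u <= v -> v - u < d -> `|prim g v - prim g u| < e.
  move=> uv vud.
  have iv : mu.-integrable [set` Interval -oo%O (BRight v)] (EFin \o g) by exact: int1_set.
  rewrite /prim (Rintegral_itvB iv)//.
  have mA : measurable (`]u, v]%classic : set (measurableTypeR R)) by exact: measurable_itv.
  apply: (le_lt_trans (le_normr_Rintegral mA _)); first exact: int1_set.
  apply: (H _ mA).
  suff : (mu `]u, v]%classic < d%:E)%E by [].
  rewrite lebesgue_measure_itv/= lte_fin.
  by case: ifP => _; rewrite ?lte_fin// -EFinB lte_fin.
exists d => // y /= xy; have [xley|/ltW ylex] := leP x y.
  by rewrite distrC; apply: D => //; move: xy => /ltr_normlP[]; lra.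
by apply: D => //; move: xy => /ltr_normlP[]; lra.
Qed.

Lemma int1_ae g h : {ae mu, forall x, g x = h x} -> measurable_fun [set: R] h ->
  int1 g -> int1 h.
Proof.
move=> ae mh gi; apply/integrableP; split; first exact/measurable_EFinP.
have /integrableP[mg] := gi.
rewrite (@ae_eq_integral _ _ _ mu setT (fun x => `|(EFin \o h) x|%E))//.
- by apply: measurableT_comp => //; exact/measurable_EFinP.
- by apply: measurableT_comp => //; exact/measurable_EFinP.
- by apply: (ae_mono _ ae) => x /= -> _.
Qed.

(** Two weak derivatives give one classical derivative: the first agrees almost everywhere with a
    continuous primitive [G] of the second, so [f], being continuous, equals a primitive of [G]
    everywhere. *)
Lemma sobolev_deriv f : continuous f -> sobolev1_infty f ->
  exists f', [/\ forall x, is_derive x (1 : R) f (f' x), continuous f' & sobolev1_infty f'].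
Proof.
move=> cf sf.
have [fi [g1 w1 [g1i [g2 w2 [g2i _]]]]] := sf 2%N.
have [C1 ae1] := weak_ae fi g1i w1.
have [C2 ae2] := weak_ae g1i g2i w2.
pose G x := C2 + prim g2 x.
have cG : continuous G.
  by move=> x; apply: cvgD; [exact: cvg_cst|exact: prim_cont].
have Gi : int1 G by apply: (int1_ae ae2) g1i; exact: cont_meas.
have dG x : is_derive x (1 : R) (fun y => C1 + prim G y) (G x).
  by rewrite -[G x]add0r; apply: is_deriveD; exact: prim_derive.
have fE : f = (fun y => C1 + prim G y).
  apply: ae_cont_eq => //; first exact: is_derive_continuous dG.
  by apply: (ae_mono _ ae1) => x ->; rewrite (prim_ae_eq x g1i Gi ae2).
exists G; split=> //; first by rewrite fE.
(* The weak derivative witnessing order [k + 1] may change with [k]; uniqueness identifies each of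
   them with [G] almost everywhere. *)
move=> k; have [_ [g w s]] := sf k.+1.
have gi : int1 g by case: k s => [[]|k []].
apply: (@sobolev1_ae k g) => //.
by apply: (ae_mono _ (ae_and (weak_uniq gi g1i w w1) ae2)) => x [-> ->].
Qed.

Lemma sobolev_wfun f : continuous f -> sobolev1_infty f -> wfun f.
Proof.
move=> cf sf.
have [F [dF F0 iF]] : exists F : nat -> R -> R, [/\ dseq F, F 0%N = f & forall n, int1 (F n)].
  pose P f := continuous f /\ sobolev1_infty f.
  pose T := {f : R -> R | P f}.
  have ex (u : T) : exists v : T, forall x, is_derive x (1 : R) (sval u) (sval v x).
    case: u => u [cu su]; have [v [dv cv sv]] := sobolev_deriv cu su.
    by exists (exist _ v (conj cv sv)).
  pose nx u := projT1 (cid (ex u)).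
  pose S n : T := iter n nx (exist _ f (conj cf sf)).
  exists (fun n => sval (S n)); split=> // [n x|n].
    by rewrite /S iterS /nx; case: cid.
  by have [_ /(_ 0%N)[]] := svalP (S n).
by rewrite -F0; exact: wfun_dseq.
Qed.

Lemma wfun_sobolev f : wfun f -> sobolev1_infty f.
Proof.
move=> wf k; elim: k f wf => [|k IH] f wf; split=> //; try exact: (wfun_int 0 wf).
exists f^`()%classic; last exact/IH/wfun_der.
apply: classical_weak.
- exact: (@wfun_cont _ _ 1).
- exact: (wfun_int 0 wf).
- exact: (wfun_int 1 wf).
- by move=> x; exact: (wfun_derive 0 x wf).
Qed.

Lemma lie_algebraP f : lie_algebra f <->
  [/\ forall x, derivable f x 1, wfun f^`()%classic & f x @[x --> -oo] --> (0 : R)].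
Proof.
split=> [[d c s l]|[d w l]]; first by split; [exact: d|exact: sobolev_wfun|exact: l].
by split; [exact: d|exact: (@wfun_cont _ _ 0)|exact: wfun_sobolev|exact: l].
Qed.

End WeakDerivative.

(** * The Frechet topology *)

Section Frechet.
Context {R : realType}.
Implicit Types (f g u : R -> R) (x y t s : R) (I : set R) (c v : R -> R -> R).

Local Notation mu := (@lebesgue_measure R).

Lemma ereal_cvg0P (F : set_system R) {FF : Filter F} (f : R -> \bar R) :
  (forall s, (0 <= f s)%E) ->
  f s @[s --> F] --> 0%E <->
  (forall e, 0 < e -> \forall s \near F, (f s <= e%:E)%E).
Proof.
move=> f0; split=> [h e e0|h].
  have /fine_cvgP[h1 /cvgrPdist_le/(_ _ e0) h2] := h.
  apply: filterS2 h1 h2 => s fs /=; rewrite sub0r normrN => fe.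
  by rewrite -(fineK fs) lee_fin (le_trans _ fe)// ler_norm.
apply/fine_cvgP; split.
  apply: filterS (h 1 ltr01) => s fs; apply: fin_real.
  by rewrite (lt_le_trans _ (f0 s))//= (le_lt_trans fs)// ltry.
apply/cvgrPdist_le => e e0; apply: filterS (h e e0) => s fs /=.
rewrite sub0r normrN ger0_norm ?fine_ge0// -lee_fin fineK//.
apply: fin_real.
by rewrite (lt_le_trans _ (f0 s))//= (le_lt_trans fs)// ltry.
Qed.

Lemma smooth_lin a b f g : smooth f -> smooth g ->
  smooth (fun x => a * f x + b * g x) /\
  forall n, derive1n n (fun x => a * f x + b * g x) =
    (fun x => a * derive1n n f x + b * derive1n n g x).
Proof.
move=> sf sg.
have dq : dseq (fun n x => a * derive1n n f x + b * derive1n n g x).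
  by move=> n x; apply: is_deriveD; apply: is_deriveZ; exact: smooth_dseq.
split; first exact: (dseq_smooth dq).
by move=> n; rewrite -(dseq_derive1n dq).
Qed.

Lemma smooth_diff f g : smooth f -> smooth g ->
  smooth (f \- g) /\ forall n, derive1n n (f \- g) = derive1n n f \- derive1n n g.
Proof.
move=> sf sg; have [s d] := @smooth_lin 1 (-1) _ _ sf sg.
have -> : f \- g = (fun x => 1 * f x + -1 * g x).
  by apply/funext => x /=; ring.
by split=> // n; rewrite d; apply/funext => x /=; ring.
Qed.

Lemma lie_smooth u : lie_algebra u -> smooth u.
Proof.
by move=> /lie_algebraP[d [s _] _]; exact: derivable_smooth.
Qed.

Lemma lie_derive u n x : lie_algebra u ->
  is_derive x (1 : R) (derive1n n u) (derive1n n.+1 u x).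
Proof. by move=> /lie_smooth s; exact: smooth_dseq. Qed.

Lemma lie_int1 u n : lie_algebra u -> int1 (derive1n n.+1 u).
Proof. by move=> /lie_algebraP[_ [_ h] _]; rewrite derive1Sn; exact: h. Qed.

Lemma lie_cont u n : lie_algebra u -> continuous (derive1n n u).
Proof. by move=> /lie_smooth s; exact: smooth_cont. Qed.

Lemma lie_cvgNy u n : lie_algebra u -> derive1n n u x @[x --> -oo] --> (0 : R).
Proof.
move=> lu; case: n => [|n]; first by case: lu.
apply: (@int1_cvgNy _ _ (derive1n n.+2 u)).
- exact: lie_cont.
- exact: lie_int1.
- exact: lie_int1.
- by move=> x; exact: lie_derive.
Qed.

(** Vanishing at -oo is used here. The case n = 0 is included although [u] itself need not be
    integrable, so Frechet convergence is uniform in x at every order of differentiation. *)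
Lemma lie_sup u n x : lie_algebra u ->
  `|derive1n n u x| <= \int[mu]_y `|derive1n n.+1 u y|.
Proof.
move=> lu; apply: le_L1_deriv; [exact: lie_cont|exact: lie_int1| |exact: lie_cvgNy].
by move=> z; exact: lie_derive.
Qed.

Lemma lie_lin a b f g : lie_algebra f -> lie_algebra g ->
  lie_algebra (fun x => a * f x + b * g x).
Proof.
move=> lf lg; have [s d] := @smooth_lin a b _ _ (lie_smooth lf) (lie_smooth lg).
apply/lie_algebraP; split; first exact: (s 0%N).
  split; first exact: smooth_der.
  move=> n; rewrite -derive1Sn d.
  by apply: int1D; apply: int1Z; exact: lie_int1.
have E : (0 : R) = a * 0 + b * 0 by rewrite !mulr0 addr0.
rewrite [X in _ --> X]E.
by apply: cvgD; (apply: cvgM; [exact: cvg_cst|]); [exact: (@lie_cvgNy f 0)|exact: (@lie_cvgNy g 0)].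
Qed.

Lemma lieB f g : lie_algebra f -> lie_algebra g -> lie_algebra (f \- g).
Proof.
move=> lf lg; have := @lie_lin 1 (-1) _ _ lf lg.
suff -> : (fun x => 1 * f x + -1 * g x) = f \- g by [].
by apply/funext => x /=; ring.
Qed.

Lemma lie0 : lie_algebra (fun _ : R => 0 : R).
Proof.
have dq : dseq (fun (_ : nat) (_ : R) => 0 : R).
  by move=> n x; exact: is_derive_cst.
apply/lie_algebraP; split.
- by move=> x; apply: ex_derive.
- rewrite (is_derive_der (dq 0%N)); apply: (wfun_dseq dq) => _; exact: int1_0.
- exact: cvg_cst.
Qed.

Lemma lie_prim f : wfun f -> lie_algebra (prim f).
Proof.
move=> wf; have d x : is_derive x (1 : R) (prim f) (f x).
  apply: prim_derive; [exact: (@wfun_cont _ _ 0)|exact: (wfun_int 0 wf)].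
apply/lie_algebraP; split.
- by move=> x; exact: ex_derive.
- by rewrite (is_derive_der d).
- apply: prim_cvgNy; exact: (wfun_int 0 wf).
Qed.

Lemma lie_bounded u n : lie_algebra u -> exists2 M, 0 <= M & forall x, `|derive1n n u x| <= M.
Proof.
move=> lu; exists (\int[mu]_y `|derive1n n.+1 u y|); first exact: Rint_ge0.
by move=> x; exact: lie_sup.
Qed.

(** A compactness principle: local thresholds that remain valid when enlarged have a common value on
    the segment. It yields bounds, tails and moduli of continuity that are uniform in time. *)
Lemma segment_uniform (A B : R) (Q : R -> R -> Prop) : A <= B ->
  (forall t, A <= t <= B -> exists d M : R, 0 < d /\
    forall s M', A <= s <= B -> `|s - t| < d -> M <= M' -> Q M' s) ->
  exists M, forall s, A <= s <= B -> Q M s.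
Proof.
move=> AB h.
have /compact_near_coveringP := @segment_compact _ A B.
move=> /(_ R +oo (fun M s => A <= s <= B -> Q M s) _).
case=> [t|M [Mr H]].
  rewrite /= in_itv/= => tAB; have [d [M [d0 H]]] := h t tAB.
  exists (ball t d, [set M' | M < M']) => /=.
    split; first exact: nbhsx_ballx.
    by exists M; split => //; exact: num_real.
  move=> [s M'] /= [sd MM'] sAB; apply: H => //; last exact: ltW.
  by rewrite distrC.
by exists (M + 1) => s sAB; apply: (H (M + 1)) => //; lra.
Qed.

Section C1.
Variables (I : set R) (c v : R -> R -> R).
Hypothesis sc : forall s, I s -> smooth (c s).
Hypothesis lc : forall s t, I s -> I t -> lie_algebra (c s \- c t).
Hypothesis C1 : C1_curve I c v.

Let lv t : I t -> lie_algebra (v t).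
Proof. by case: C1 => h _ _; exact: h. Qed.

(** Only differences of the curve are assumed to lie in the algebra. This treats curves in the
    affine space id + g, whose values do not lie in g, together with curves in g. *)
Lemma quot_lie s t : I s -> I t ->
  lie_algebra ((fun x => (c s x - c t x) / (s - t)) \- v t) /\
  forall n, derive1n n ((fun x => (c s x - c t x) / (s - t)) \- v t) =
    (fun x => (derive1n n (c s) x - derive1n n (c t) x) / (s - t) - derive1n n (v t) x).
Proof.
move=> Is It.
have E : (fun x => (c s x - c t x) / (s - t)) \- v t =
    (fun x => (s - t)^-1 * (c s \- c t) x + -1 * v t x).
  by apply/funext => x /=; ring.
rewrite E; split; first by apply: lie_lin; [exact: lc|exact: lv].
move=> n.
have [_ ->] := @smooth_lin (s - t)^-1 (-1) _ _ (lie_smooth (lc Is It)) (lie_smooth (lv It)).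
have [_ ->] := smooth_diff (sc Is) (sc It).
by apply/funext => x /=; ring.
Qed.

Lemma C1_L1 n t e : I t -> 0 < e -> exists2 d, 0 < d & forall s, I s -> `|s - t| < d ->
  \int[mu]_x `|derive1n n.+1 (c s) x - derive1n n.+1 (c t) x
     - (s - t) * derive1n n.+1 (v t) x| <= e * `|s - t|.
Proof.
move=> It e0; case: C1 => _ /(_ t It n) + _.
move/ereal_cvg0P => /(_ _ _ e0) [|d d0 H].
  by move=> s; apply: integral_ge0 => x _; rewrite lee_fin.
exists d => // s Is sd.
have [->|nst] := eqVneq s t.
  under eq_Rintegral do rewrite !subrr mul0r subr0 normr0.
  by rewrite Rintegral_cst// mul0r subrr normr0 mulr0.
have st0 : s - t != 0 by rewrite subr_eq0.
have h : (\int[mu]_x `|derive1n n.+1 ((fun x => (c s x - c t x) / (s - t)) \- v t) x|%:E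
    <= e%:E)%E by apply: (H s) => //; rewrite /ball_ /= distrC.
have [lq dq] := quot_lie Is It.
rewrite dq in h.
have hi : int1 (fun x => `|(derive1n n.+1 (c s) x - derive1n n.+1 (c t) x) / (s - t)
    - derive1n n.+1 (v t) x|).
  by apply: int1_abs; have := lie_int1 n lq; rewrite dq.
move: h; rewrite integral_EFin// lee_fin => h.
have -> : \int[mu]_x `|derive1n n.+1 (c s) x - derive1n n.+1 (c t) x
     - (s - t) * derive1n n.+1 (v t) x| = `|s - t| * \int[mu]_x
     `|(derive1n n.+1 (c s) x - derive1n n.+1 (c t) x) / (s - t)
      - derive1n n.+1 (v t) x|.
  rewrite -RintZ//; apply: eq_Rintegral => x _; rewrite -normrM mulrBr.
  by rewrite [_ * (_ / _)]mulrC divfK.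
by rewrite mulrC ler_wpM2r.
Qed.

Lemma C1_unif n t e : I t -> 0 < e -> exists2 d, 0 < d & forall s, I s -> `|s - t| < d ->
  forall x, `|derive1n n (c s) x - derive1n n (c t) x
     - (s - t) * derive1n n (v t) x| <= e * `|s - t|.
Proof.
move=> It e0; have [d d0 H] := C1_L1 n It e0; exists d => // s Is sd x.
apply: le_trans (H s Is sd).
have [_ e1] := smooth_diff (sc Is) (sc It).
have l1 : lie_algebra (fun x => 1 * (c s \- c t) x + (- (s - t)) * v t x).
  by apply: lie_lin; [exact: lc|exact: lv].
have [_ e2] := @smooth_lin 1 (- (s - t)) _ _ (lie_smooth (lc Is It)) (lie_smooth (lv It)).
have := lie_sup n x l1; rewrite !e2 !e1 /=.
rewrite mul1r mulNr => h; apply: (le_trans h).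
by under eq_Rintegral do rewrite mul1r mulNr.
Qed.

Lemma C1_hdw n t x : I t -> has_deriv_within I (fun s => derive1n n (c s) x) t (derive1n n (v t) x).
Proof.
move=> It; apply/hdwP => e e0; have [d d0 H] := C1_unif n It e0.
by exists d => // s Is sd; rewrite [_ * (s - t)]mulrC; exact: H.
Qed.

Lemma C1_v_L1 n t e : I t -> 0 < e -> exists2 d, 0 < d & forall s, I s -> `|s - t| < d ->
  \int[mu]_x `|derive1n n.+1 (v s) x - derive1n n.+1 (v t) x| <= e.
Proof.
move=> It e0; case: C1 => _ _ /(_ t It n).
move/ereal_cvg0P => /(_ _ _ e0) [|d d0 H].
  by move=> s; apply: integral_ge0 => x _; rewrite lee_fin.
exists d => // s Is sd.
have h : (\int[mu]_x `|derive1n n.+1 (v s \- v t) x|%:E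
    <= e%:E)%E by apply: (H s) => //; rewrite /ball_ /= distrC.
have lq := lieB (lv Is) (lv It).
have [_ dq] := smooth_diff (lie_smooth (lv Is)) (lie_smooth (lv It)).
have := lie_int1 n lq; rewrite dq => hi.
by move: h; rewrite dq integral_EFin ?lee_fin//; exact: int1_abs.
Qed.

Lemma C1_v_unif n t e : I t -> 0 < e -> exists2 d, 0 < d & forall s, I s -> `|s - t| < d ->
  forall x, `|derive1n n (v s) x - derive1n n (v t) x| <= e.
Proof.
move=> It e0; have [d d0 H] := C1_v_L1 n It e0; exists d => // s Is sd x.
apply: le_trans (H s Is sd).
have [_ dq] := smooth_diff (lie_smooth (lv Is)) (lie_smooth (lv It)).
by have := lie_sup n x (lieB (lv Is) (lv It)); rewrite !dq.
Qed.

Lemma C1_c_unif n t e : I t -> 0 < e -> exists2 d, 0 < d & forall s, I s -> `|s - t| < d ->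
  forall x, `|derive1n n (c s) x - derive1n n (c t) x| <= e.
Proof.
move=> It e0; have [d d0 H] := C1_unif n It ltr01.
have [M M0 hM] := lie_bounded n (lv It).
exists (Num.min d (e / (M + 1))); first by rewrite lt_min d0 divr_gt0//; lra.
move=> s Is; rewrite lt_min => /andP[sd se] x.
have := H s Is sd x; rewrite mul1r => h.
rewrite -[_ - _](subrK ((s - t) * derive1n n (v t) x)).
apply: (le_trans (ler_normD _ _)).
move: se; rewrite ltr_pdivlMr; last lra.
move=> se; apply: (@le_trans _ _ (`|s - t| + `|s - t| * M)); last lra.
by apply: lerD => //; rewrite normrM ler_wpM2l.
Qed.

End C1.

Lemma lie_path_C1 I (u ut : R -> R -> R) : lie_algebra_path I u ut ->
  [/\ forall s, I s -> smooth (u s), forall s t, I s -> I t -> lie_algebra (u s \- u t) &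
   C1_curve I u ut].
Proof.
by case=> lu C; split=> // [s /lu/lie_smooth//|s t Is It]; apply: lieB; exact: lu.
Qed.

Lemma smooth_id : smooth (@id R).
Proof.
have dq : dseq (fun n (x : R) => if n is n'.+1 then (n' == 0%N)%:R else x).
  by case=> [|n] x; [exact: is_derive_id|exact: is_derive_cst].
exact: (dseq_smooth dq).
Qed.

Lemma diff_group_smooth (p : R -> R) : diff_group p -> smooth p.
Proof.
move=> [l _]; have [s _] := @smooth_lin 1 1 _ _ (lie_smooth l) smooth_id.
suff <- : (fun x => 1 * (p x - x) + 1 * id x) = p by [].
by apply/funext => x /=; ring.
Qed.

Lemma diff_path_C1 I c v : diff_path I c v ->
  [/\ forall s, I s -> smooth (c s), forall s t, I s -> I t -> lie_algebra (c s \- c t) &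
   C1_curve I c v].
Proof.
case=> dc C; split=> // [s /dc/diff_group_smooth//|s t Is It].
have [ls _] := dc s Is; have [lt _] := dc t It.
have := lieB ls lt.
suff -> : (fun x => c s x - x) \- (fun x => c t x - x) = c s \- c t by [].
by apply/funext => x /=; ring.
Qed.

Lemma C1_curve_eq (I : set R) (c v c' v' : R -> R -> R) :
  (forall t, I t -> c t = c' t) ->
  (forall t, I t -> v t = v' t) -> C1_curve I c v -> C1_curve I c' v'.
Proof.
move=> Ec Ev [l cq cv]; split.
- by move=> t It; rewrite -Ev//; exact: l.
- move=> t It k; have H := cq t It k; apply: cvg_trans H.
  apply: near_eq_cvg; exists 1; first exact: ltr01.
  by move=> s _ _ Is; rewrite (Ec s Is) (Ec t It) (Ev t It).
- move=> t It k; have H := cv t It k; apply: cvg_trans H.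
  apply: near_eq_cvg; exists 1; first exact: ltr01.
  by move=> s _ Is; rewrite (Ev s Is) (Ev t It).
Qed.

(* Second-order Taylor expansion in time, dominated by an integrable function
   of space, gives convergence of difference quotients in every W^{k,1}. *)
Lemma C1_criterion I c v t (eta : R) (F G H : nat -> R -> R -> R) (K : nat -> R -> R) :
  0 < eta ->
  (forall s x, `|s - t| < eta -> is_derive x (1 : R) (c s) (F 0%N s x)) ->
  (forall s x, `|s - t| < eta -> is_derive x (1 : R) (v s) (G 0%N s x)) ->
  (forall n s x, `|s - t| < eta -> is_derive x (1 : R) (F n s) (F n.+1 s x)) ->
  (forall n s x, `|s - t| < eta -> is_derive x (1 : R) (G n s) (G n.+1 s x)) ->
  (forall n s x, `|s - t| < eta -> is_derive s (1 : R) (F n ^~ x) (G n s x)) ->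
  (forall n s x, `|s - t| < eta -> is_derive s (1 : R) (G n ^~ x) (H n s x)) ->
  (forall n, int1 (K n)) ->
  (forall n s x, `|s - t| < eta -> `|H n s x| <= K n x) ->
  frechet_cvg (within I t^') (fun s x => (c s x - c t x) / (s - t)) (v t) /\
  frechet_cvg (within I (nbhs t)) v (v t).
Proof.
move=> eta0 dc dv dF dG dtF dtG iK HK.
have tt : `|t - t| < eta by rewrite subrr normr0.
(* Index shift: the seminorms start at the first x-derivative, so entry [n] of each family stands
   for the derivative of order [n + 1]. *)
have sl (L : R -> R -> R) (F' : nat -> R -> R -> R) s : `|s - t| < eta ->
    (forall s x, `|s - t| < eta -> is_derive x (1 : R) (L s) (F' 0%N s x)) ->
    (forall n s x, `|s - t| < eta -> is_derive x (1 : R) (F' n s) (F' n.+1 s x)) ->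
    smooth (L s) /\ forall n, derive1n n.+1 (L s) = F' n s.
  move=> st d1 d2; have dq : dseq (fun n => if n is m.+1 then F' m s else L s).
    by case=> [|n] x; [exact: d1|exact: d2].
  split; first exact: (dseq_smooth dq).
  by move=> n; exact: (dseq_derive1n dq n.+1).
have Gle n s x : `|s - t| < eta -> `|G n s x - G n t x| <= K n x * `|s - t|.
  move=> st; apply: (@hdw_bound R [set s | `|s - t| < eta] (G n ^~ x) (H n ^~ x)
    _ (@interval_ball R t eta)) => //= z zt; last exact: HK.
  by apply: is_derive_hdw; exact: dtG.
have Fle n s x : `|s - t| < eta -> s != t ->
    `|(F n s x - F n t x) / (s - t) - G n t x| <= K n x * `|s - t|.
  move=> st nst; have st0 : s - t != 0 by rewrite subr_eq0.
  have := @deriv_affine_bound R _ (F n ^~ x) (G n ^~ x) (G n t x) (K n x * `|s - t|)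
    (@interval_cball R t `|s - t|) _ _ s t (lexx _) _.
  rewrite /= subrr normr0 => /(_ _ _ (normr_ge0 _)) h.
  have {}h : `|F n s x - F n t x - G n t x * (s - t)| <= K n x * `|s - t| * `|s - t|.
    apply: h => z zs; first by apply: dtF; exact: le_lt_trans st.
    apply: (le_trans (Gle n z x (le_lt_trans zs st))); apply: ler_wpM2l => //.
    exact: le_trans (HK n t x tt).
  have -> : (F n s x - F n t x) / (s - t) - G n t x =
    (F n s x - F n t x - G n t x * (s - t)) / (s - t) by field.
  by rewrite normrM normfV ler_pdivrMr// normr_gt0.
have K0 n : 0 <= \int[mu]_x K n x.
  by apply: Rint_ge0 => x; apply: le_trans (HK n t x tt).
have le_int n (D : R -> R) s : continuous D -> (forall x, `|D x| <= K n x * `|s - t|) ->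
    (\int[mu]_x `|D x|%:E <= (`|s - t| * \int[mu]_x K n x)%:E)%E.
  move=> cD h.
  have iKs : int1 (fun x => `|s - t| * K n x) by exact: int1Z.
  have iD : int1 D by apply: int1_le iKs _; [exact: cont_meas|move=> x; rewrite mulrC].
  rewrite integral_EFin; last exact: int1_abs.
  rewrite lee_fin -RintZ//; apply: Rint_le => //; first exact: int1_abs.
  by move=> x; rewrite mulrC.
split=> k; apply/ereal_cvg0P; try by move=> s; apply: integral_ge0 => x _; rewrite lee_fin.
  move=> e e0; exists (Num.min eta (e / (\int[mu]_x K k x + 1))).
    by rewrite /= lt_min eta0 divr_gt0//; have := K0 k; lra.
  move=> s; rewrite /ball_/= distrC lt_min => /andP[st se] nst _.
  have [sc dc'] := sl c F s st dc dF; have [sct dct] := sl c F t tt dc dF.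
  have [sv dv'] := sl v G t tt dv dG.
  have E : (fun x => (c s x - c t x) / (s - t)) \- v t =
      (fun x => (s - t)^-1 * (c s \- c t) x + -1 * v t x).
    by apply/funext => x /=; ring.
  have [s1 e1] := smooth_diff sc sct.
  have [s2 e2] := @smooth_lin (s - t)^-1 (-1) _ _ s1 sv.
  have E2 : derive1n k.+1 ((fun x => (c s x - c t x) / (s - t)) \- v t) =
      (fun x => (F k s x - F k t x) / (s - t) - G k t x).
    by rewrite E e2 e1 dc' dct dv'; apply/funext => x /=; ring.
  apply: (@le_trans _ _ (`|s - t| * \int[mu]_x K k x)%:E).
    rewrite -derive1nS E2; apply: le_int; first by rewrite -E2 E; exact: smooth_cont.
    by move=> x; exact: Fle.
  move: se; rewrite lee_fin ltr_pdivlMr; last by have := K0 k; lra.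
  by have := normr_ge0 (s - t); nra.
move=> e e0; exists (Num.min eta (e / (\int[mu]_x K k x + 1))).
  by rewrite /= lt_min eta0 divr_gt0//; have := K0 k; lra.
move=> s; rewrite /ball_/= distrC lt_min => /andP[st se] _.
have [ss ds] := sl v G s st dv dG.
have [sv dv'] := sl v G t tt dv dG.
have [s1 e1] := smooth_diff ss sv.
apply: (@le_trans _ _ (`|s - t| * \int[mu]_x K k x)%:E).
  have E2 : derive1n k.+1 (v s \- v t) = (fun x => G k s x - G k t x).
    by rewrite e1 ds dv'.
  rewrite -derive1nS E2; apply: le_int; first by rewrite -E2; exact: smooth_cont.
  by move=> x; exact: Gle.
move: se; rewrite lee_fin ltr_pdivlMr; last by have := K0 k; lra.
by have := normr_ge0 (s - t); nra.
Qed.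

End Frechet.

(** * The differential algebra of the explicit path *)

Section TimeCalculus.
Context {R : realType}.
Implicit Types (I : set R) (t x y : R).

Local Notation mu := (@lebesgue_measure R).

Lemma integral_time_derive (D : set R) (f f' : R -> R -> R) (K : R -> R) (t0 eta : R) :
  measurable D -> 0 < eta ->
  (forall s, `|s - t0| < eta -> int1 (f s)) ->
  (forall s y, `|s - t0| < eta -> is_derive s (1 : R) (f ^~ y) (f' s y)) ->
  int1 K -> (forall s y, `|s - t0| < eta -> `|f' s y| <= K y) ->
  is_derive t0 (1 : R) (fun s => \int[mu]_(y in D) f s y) (\int[mu]_(y in D) f' t0 y).
Proof.
move=> mD eta0 fi df iK hK.
have itvE s : `]t0 - eta, t0 + eta[%classic s -> `|s - t0| < eta.
  by rewrite /= in_itv/= ltr_distl.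
have K0 y : 0 <= K y.
  by apply: le_trans (hK t0 y _) => //; rewrite subrr normr0.
have hI : `]t0 - eta, t0 + eta[%classic t0 by rewrite /= in_itv/=; apply/andP; split; lra.
have intf s : `]t0 - eta, t0 + eta[%classic s -> mu.-integrable D (EFin \o f s).
  by move=> /itvE sI; apply: int1_set => //; exact: fi.
have df1 s y : `]t0 - eta, t0 + eta[%classic s -> D y -> derivable (f ^~ y) s 1.
  by move=> /itvE sI _; apply: ex_derive; exact: df.
have Gub s y : `]t0 - eta, t0 + eta[%classic s -> D y -> `|partial1of2 f s y| <= K y.
  by move=> /itvE sI _; rewrite /partial1of2 derive1E (@derive_val _ _ _ _ _ _ _ (df s y sI)); exact: hK.
have d := @derivable_under_integral R _ _ mu f D mD t0 _ _ hI intf df1 K K0 (int1_set mD iK) Gub.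
have e := @differentiation_under_integral R _ _ mu f D mD t0 _ _ hI intf df1 K K0 (int1_set mD iK) Gub.
have -> : \int[mu]_(y in D) f' t0 y = \int[mu]_(y in D) (partial1of2 f)^~ y t0.
  apply: eq_Rintegral => y _; rewrite /partial1of2 derive1E.
  by rewrite (@derive_val _ _ _ _ _ _ _ (df t0 y _))// subrr normr0.
by rewrite -e; exact: derivable_is_derive.
Qed.

Lemma hdw_chain I (f fx : R -> R -> R) (Y : R -> R) t ft Y' :
  (forall s y, I s -> is_derive y (1 : R) (f s) (fx s y)) -> I t ->
  (forall e, 0 < e -> exists2 d, 0 < d & forall s y, I s -> `|s - t| < d ->
     `|y - Y t| < d -> `|fx s y - fx t (Y t)| <= e) ->
  has_deriv_within I (f ^~ (Y t)) t ft -> has_deriv_within I Y t Y' ->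
  has_deriv_within I (fun s => f s (Y s)) t (ft + fx t (Y t) * Y').
Proof.
move=> dfx It cfx hf hY.
have -> : (fun s => f s (Y s)) = (fun s => f s (Y t) + (fx t (Y t) * Y s +
    (f s (Y s) - f s (Y t) - fx t (Y t) * Y s))) by apply/funext => s; ring.
apply: hdwD => //; rewrite -[_ * Y']addr0; apply: hdwD; first exact: hdwZ.
apply/hdwP => e e0.
have c0 : 0 < `|Y'| + 1 by rewrite ltr_wpDl.
have [d d0 H] := cfx (e / (`|Y'| + 1)) ltac:(by rewrite divr_gt0).
have /hdwP/(_ 1 ltr01)[k k0 hk] := hY.
pose m := Num.min (d / (`|Y'| + 1)) (Num.min d k).
exists m; first by rewrite /m !lt_min d0 k0 divr_gt0.
move=> s Is; rewrite /m !lt_min => /and3P[s1 s2 s3].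
have Yb : `|Y s - Y t| <= (`|Y'| + 1) * `|s - t|.
  have := hk s Is s3; rewrite mul1r => h.
  rewrite -[Y s - Y t](subrK (Y' * (s - t))).
  by apply: (le_trans (ler_normD _ _)); rewrite normrM addrC mulrDl mul1r lerD2l.
have Yd : `|Y s - Y t| < d.
  by apply: (le_lt_trans Yb); rewrite mulrC -ltr_pdivlMr.
have := @deriv_affine_bound R _ (f s) (fx s) (fx t (Y t)) (e / (`|Y'| + 1))
  (@interval_cball R (Y t) `|Y s - Y t|) _ _ (Y s) (Y t) (lexx _) _.
rewrite /= subrr normr0 => /(_ _ _ (normr_ge0 _)) h.
have {}h : `|f s (Y s) - f s (Y t) - fx t (Y t) * (Y s - Y t)| <=
    e / (`|Y'| + 1) * `|Y s - Y t|.
  by apply: h => y yd; [exact: dfx|apply: H => //; exact: le_lt_trans Yd].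
rewrite mul0r subr0.
have -> : f s (Y s) - f s (Y t) - fx t (Y t) * Y s - (f t (Y t) - f t (Y t) - fx t (Y t) * Y t)
  = f s (Y s) - f s (Y t) - fx t (Y t) * (Y s - Y t) by ring.
apply: (le_trans h).
apply: (@le_trans _ _ (e / (`|Y'| + 1) * ((`|Y'| + 1) * `|s - t|))).
  by rewrite ler_wpM2l// divr_ge0// ltW.
by rewrite mulrA divfK// gt_eqF.
Qed.

End TimeCalculus.

(* Differential algebra generated by t, the derivatives of b and p, the powers
   of the base 1 + t b, and antiderivatives in x: it contains all iterated
   derivatives of the explicit path. *)
Inductive expr {R : realType} : Type :=
| ECst of R
| ETime
| EA of nat
| EP of nat
| EB of R
| EInt of expr
| EAdd of expr & expr
| EMul of expr & expr.

Section Expr.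
Context {R : realType}.
Implicit Types (t x y : R) (e : @expr R).

Fixpoint dx e : expr := match e with
| ECst _ | ETime => ECst 0
| EA j => EA j.+1
| EP j => EP j.+1
| EB al => EMul (ECst al) (EMul ETime (EMul (EA 1) (EB (al - 1))))
| EInt e => e
| EAdd e f => EAdd (dx e) (dx f)
| EMul e f => EAdd (EMul (dx e) f) (EMul e (dx f))
end.

Fixpoint dt e : expr := match e with
| ECst _ | EA _ | EP _ => ECst 0
| ETime => ECst 1
| EB al => EMul (ECst al) (EMul (EA 0) (EB (al - 1)))
| EInt e => EInt (dt e)
| EAdd e f => EAdd (dt e) (dt f)
| EMul e f => EAdd (EMul (dt e) f) (EMul e (dt f))
end.

(* A small expression is integrable in x: p tends to 1 at infinity, but b and all
   derivatives of b and p are integrable. *)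
Fixpoint small e : bool := match e with
| ECst c => c == 0
| ETime | EB _ | EInt _ => false
| EA _ => true
| EP j => (0 < j)%N
| EAdd e f => small e && small f
| EMul e f => small e || small f
end.

(** Antiderivatives from -oo are formed only of integrable expressions, where [prim] has its
    intended meaning. *)
Fixpoint wf e : bool := match e with
| EInt e => small e && wf e
| EAdd e f | EMul e f => wf e && wf f
| _ => true
end.

Lemma small_dx e : small e -> small (dx e).
Proof.
elim: e => //= [e IHe f IHf /andP[/IHe -> /IHf ->]//|e IHe f IHf].
by case/orP => [se|sf]; rewrite ?(IHe se) ?(IHf sf) ?se ?sf ?orbT.
Qed.

Lemma small_dt e : small e -> small (dt e).
Proof.
elim: e => //= [e IHe f IHf /andP[/IHe -> /IHf ->]//|e IHe f IHf].
by case/orP => [se|sf]; rewrite ?(IHe se) ?(IHf sf) ?se ?sf ?orbT.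
Qed.

Lemma wf_dx e : wf e -> wf (dx e).
Proof.
elim: e => //= [e IHe /andP[]//|e IHe f IHf /andP[/IHe -> /IHf ->]//|e IHe f IHf].
by case/andP => we wf_f; rewrite we wf_f IHe// IHf.
Qed.

Lemma wf_dt e : wf e -> wf (dt e).
Proof.
elim: e => //= [e IHe /andP[/small_dt -> /IHe ->]//|e IHe f IHf /andP[/IHe -> /IHf ->]//|e IHe f IHf].
by case/andP => we wf_f; rewrite we wf_f IHe// IHf.
Qed.

Variables (p b : R -> R).

Fixpoint eval e t x : R := match e with
| ECst c => c
| ETime => t
| EA j => derive1n j b x
| EP j => derive1n j p x
| EB al => (1 + t * b x) `^ al
| EInt e => prim (eval e t) x
| EAdd e f => eval e t x + eval f t x
| EMul e f => eval e t x * eval f t x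
end.

Hypothesis wb : wfun b.
Hypothesis wp : wfun (fun x => p x - 1).
Variables (t0 eta delta : R).
Hypothesis eta0 : 0 < eta.
Hypothesis delta0 : 0 < delta.
Hypothesis base_ge : forall t x, `|t - t0| < eta -> delta <= 1 + t * b x.

Let J t := `|t - t0| < eta.

Let b_bd n : exists2 M, 0 <= M & forall x, `|derive1n n b x| <= M.
Proof.
exists (\int[lebesgue_measure]_y `|derive1n n.+1 b y|) => [|x]; first exact: Rint_ge0.
exact: wfun_sup.
Qed.

Lemma wp_smooth : smooth p /\ forall n, derive1n n.+1 p = derive1n n.+1 (fun x => p x - 1).
Proof.
have dq : dseq (fun n x => if n is n'.+1 then derive1n n (fun x => p x - 1) x else p x).
  case=> [|n] x; last exact: (wfun_derive n.+1 x wp).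
  have h := wfun_derive 0 x wp.
  have {h} := is_deriveD h (@is_derive_cst _ _ _ (1 : R) x 1).
  rewrite addr0; congr is_derive.
  by apply/funext => y; rewrite fctE /= subrK.
split; first exact: (dseq_smooth dq).
by move=> n; rewrite (dseq_derive1n dq).
Qed.

Lemma p_bd n : exists2 M, 0 <= M & forall x, `|derive1n n p x| <= M.
Proof.
have [_ h] := wp_smooth.
case: n => [|n].
  exists (\int[lebesgue_measure]_y `|derive1n 1 (fun x => p x - 1) y| + 1).
    by rewrite addr_ge0//; exact: Rint_ge0.
  move=> x; rewrite derive1n0 -[p x](subrK 1).
  by apply: (le_trans (ler_normD _ _)); rewrite normr1 lerD2r; exact: (wfun_sup 0 x wp).
exists (\int[lebesgue_measure]_y `|derive1n n.+2 (fun x => p x - 1) y|); first exact: Rint_ge0.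
by move=> x; rewrite h; exact: wfun_sup.
Qed.

Lemma t_bd t : J t -> `|t| <= `|t0| + eta.
Proof.
move=> /ltW h; rewrite -[t](subrK t0) addrC.
by apply: (le_trans (ler_normD _ _)); rewrite lerD2l.
Qed.

Lemma base_le : exists2 M, 0 <= M & forall t x, J t -> 1 + t * b x <= M.
Proof.
have [M M0 hM] := b_bd 0.
exists (1 + (`|t0| + eta) * M); first by rewrite addr_ge0// mulr_ge0// addr_ge0// ltW.
move=> t x Jt; rewrite lerD2l; apply: (le_trans (ler_norm _)).
by rewrite normrM ler_pM//; exact: t_bd.
Qed.

Lemma pow_bd al : exists2 M, 0 <= M & forall t x, J t -> `|(1 + t * b x) `^ al| <= M.
Proof.
have [M M0 hM] := base_le.
exists (M `^ al + delta `^ al); first by rewrite addr_ge0// powR_ge0.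
move=> t x Jt; rewrite ger0_norm ?powR_ge0//.
have B0 := lt_le_trans delta0 (base_ge x Jt).
have [al0|al0] := leP 0 al.
  apply: (@le_trans _ _ (M `^ al)); last by rewrite lerDl powR_ge0.
  by apply: ge0_ler_powR => //; rewrite ?nnegrE ?(ltW B0)//; exact: hM.
apply: (@le_trans _ _ (delta `^ al)); last by rewrite lerDr powR_ge0.
rewrite -[al]opprK powRN [leRHS]powRN lef_pV2 ?posrE ?powR_gt0//.
apply: ge0_ler_powR; rewrite ?nnegrE ?(ltW B0) ?(ltW delta0)//.
  by rewrite oppr_ge0 ltW.
exact: base_ge.
Qed.

(** The three claims depend on each other at [EInt], where an integrable majorant of the integrand
    yields both the derivative and the bound. In a product one factor is dominated and the other
    bounded. The shift [M] is for later composition with the label map. *)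
Lemma eval_props e : wf e ->
  [/\ forall t x, J t -> is_derive x (1 : R) (eval e t) (eval (dx e) t x),
   exists2 M, 0 <= M & forall t x, J t -> `|eval e t x| <= M &
   small e -> forall M, exists2 K, int1 K &
     forall t x y, J t -> `|y - x| <= M -> `|eval e t y| <= K x].
Proof.
have [ps pE] := wp_smooth.
elim: e => [c||j|j|al|e IH|e IHe f IHf|e IHe f IHf] /=.
- move=> _; split=> [t x _||/eqP -> M]; first exact: is_derive_cst.
    by exists `|c|.
  by exists (fun=> 0) => [|t x y _ _]; [exact: int1_0|rewrite normr0].
- move=> _; split=> // [t x _|]; first exact: is_derive_cst.
  exists (`|t0| + eta); first by rewrite addr_ge0// ltW.
  by move=> t _; exact: t_bd.
- move=> _; split=> [t x _||_ M]; first exact: wfun_derive.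
    by have [M M0 hM] := b_bd j; exists M => // t x _.
  have [K iK hK] := @wfun_dom R b j M wb.
  by exists K => // t x y _; exact: hK.
- move=> _; split=> [t x _||j0 M]; first exact: smooth_dseq.
    by have [M M0 hM] := p_bd j; exists M => // t x _.
  have [K iK hK] := @wfun_dom R _ j M wp.
  exists K => // t x y _; case: j j0 hK => // j _ hK.
  by rewrite pE; exact: hK.
- move=> _; split=> // [t x Jt|]; last exact: pow_bd.
  have B0 := lt_le_trans delta0 (base_ge x Jt).
  have h1 : is_derive x (1 : R) (fun x => 1 + t * b x) (t * derive1n 1 b x).
    rewrite -[X in is_derive _ _ _ X]add0r; apply: is_deriveD.
    by apply: is_deriveZ; exact: (wfun_derive 0 x wb).
  have := @is_derive1_comp R (fun z => z `^ al) _ x _ _ (is_derive1_powR al B0) h1.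
  by move/is_derive_eq; apply; rewrite ?derive1n1; ring.
- move=> /andP[se we]; have [d1 [M M0 hM] /(_ se) dom] := IH we.
  have [K iK hK] := dom 0.
  have ce t : J t -> continuous (eval e t).
    by move=> Jt; apply: (@is_derive_continuous _ _ (eval (dx e) t)) => x; exact: d1.
  have ie t : J t -> int1 (eval e t).
    move=> Jt; apply: (int1_le _ iK); first by apply: cont_meas; exact: ce.
    by move=> x; apply: hK => //; rewrite subrr normr0.
  split=> // [t x Jt|].
    by apply: prim_derive; [exact: ce|exact: ie].
  exists (\int[lebesgue_measure]_x K x).
    apply: Rint_ge0 => x; apply: le_trans (hK t0 x x _ _) => //; rewrite ?subrr ?normr0//.
    by rewrite /J subrr normr0.
  move=> t x Jt; apply: (le_trans (prim_le x (ie t Jt))).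
  apply: Rint_le => //; first exact/int1_abs/ie.
  by move=> y; apply: hK => //; rewrite subrr normr0.
- move=> /andP[/IHe[d1 [M1 M10 h1] s1] /IHf[d2 [M2 M20 h2] s2]]; split.
  + by move=> t x Jt; apply: is_deriveD; [exact: d1|exact: d2].
  + exists (M1 + M2); first by rewrite addr_ge0.
    by move=> t x Jt; apply: (le_trans (ler_normD _ _)); rewrite lerD ?h1 ?h2.
  + move=> /andP[/s1 {}s1 /s2 {}s2] M; have [K1 i1 k1] := s1 M; have [K2 i2 k2] := s2 M.
    exists (fun x => K1 x + K2 x); first exact: int1D.
    move=> t x y Jt yx; apply: (le_trans (ler_normD _ _)).
    by apply: lerD; [exact: k1|exact: k2].
- move=> /andP[/IHe[d1 [M1 M10 h1] s1] /IHf[d2 [M2 M20 h2] s2]]; split.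
  + move=> t x Jt; have := is_deriveM (d1 t x Jt) (d2 t x Jt).
    by move/is_derive_eq; apply; rewrite /GRing.scale/=; ring.
  + exists (M1 * M2); first by rewrite mulr_ge0.
    by move=> t x Jt; rewrite normrM ler_pM ?h1 ?h2.
  + move=> + M; case/orP => [/s1/(_ M)[K iK hK]|/s2/(_ M)[K iK hK]].
      exists (fun x => M2 * K x); first exact: int1Z.
      by move=> t x y Jt yx; rewrite normrM mulrC ler_pM ?h2//; exact: hK.
    exists (fun x => M1 * K x); first exact: int1Z.
    by move=> t x y Jt yx; rewrite normrM ler_pM ?h1//; exact: hK.
Qed.

Lemma eval_dx e t x : wf e -> J t -> is_derive x (1 : R) (eval e t) (eval (dx e) t x).
Proof. by move=> /eval_props[h _ _]; exact: h. Qed.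

Lemma eval_cont e t : wf e -> J t -> continuous (eval e t).
Proof.
by move=> we Jt; apply: (@is_derive_continuous _ _ (eval (dx e) t)) => x; exact: eval_dx.
Qed.

Lemma eval_bd e : wf e -> exists2 M, 0 <= M & forall t x, J t -> `|eval e t x| <= M.
Proof. by case/eval_props. Qed.

Lemma eval_dom e M : wf e -> small e -> exists2 K, int1 K &
  forall t x y, J t -> `|y - x| <= M -> `|eval e t y| <= K x.
Proof. by move=> /eval_props[_ _ h] /h; exact. Qed.

Lemma eval_int1 e t : wf e -> small e -> J t -> int1 (eval e t).
Proof.
move=> we se Jt; have [K iK hK] := eval_dom 0 we se.
apply: (int1_le _ iK); first by apply: cont_meas; exact: eval_cont.
by move=> x; apply: hK => //; rewrite subrr normr0.
Qed.

Lemma J_nbhs t : J t -> exists2 d, 0 < d & forall s, `|s - t| < d -> J s.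
Proof.
move=> Jt; exists (eta - `|t - t0|); first by rewrite subr_gt0.
move=> s st; rewrite /J -[s - t0](subrKA t).
by apply: (le_lt_trans (ler_normD _ _)); rewrite addrC -ltrBrDl.
Qed.

Lemma eval_dt e t x : wf e -> J t ->
  is_derive t (1 : R) (eval e ^~ x) (eval (dt e) t x).
Proof.
elim: e t x => [c||j|j|al|e IH|e IHe f IHf|e IHe f IHf] t x /=.
- by move=> _ _; exact: is_derive_cst.
- by move=> _ _; exact: is_derive_id.
- by move=> _ _; exact: is_derive_cst.
- by move=> _ _; exact: is_derive_cst.
- move=> _ Jt.
  have B0 := lt_le_trans delta0 (base_ge x Jt).
  have h1 : is_derive t (1 : R) (fun t => 1 + t * b x) (b x).
    rewrite -[X in is_derive _ _ _ X]add0r; apply: is_deriveD.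
    have := is_deriveM (@is_derive_id _ _ t (1 : R)) (@is_derive_cst _ _ _ (b x) t 1).
    by move/is_derive_eq; apply; rewrite /GRing.scale/=; ring.
  have := @is_derive1_comp R (fun z => z `^ al) _ t _ _ (is_derive1_powR al B0) h1.
  by move/is_derive_eq; apply; ring.
- move=> /andP[se we] Jt.
  have [d d0 hd] := J_nbhs Jt.
  have [K iK hK] := eval_dom 0 (wf_dt we) (small_dt se).
  apply: (@integral_time_derive _ `]-oo, x]%classic (eval e) (eval (dt e)) K t d).
  - exact: measurable_itv.
  - by [].
  - by move=> s /hd Js; exact: eval_int1.
  - by move=> s y /hd Js; exact: IH.
  - by [].
  - by move=> s y /hd Js; apply: hK => //; rewrite subrr normr0.
- by move=> /andP[we wf_] Jt; apply: is_deriveD; [exact: IHe|exact: IHf].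
- move=> /andP[we wf_] Jt; have := is_deriveM (IHe t x we Jt) (IHf t x wf_ Jt).
  by move/is_derive_eq; apply; rewrite /GRing.scale/=; ring.
Qed.

(** Mixed derivatives commute by structural induction; beyond sums and products, only the power of
    the base calls for a computation. *)
Lemma eval_dtdx e t x : wf e -> J t -> eval (dt (dx e)) t x = eval (dx (dt e)) t x.
Proof.
elim: e => [c||j|j|al|e IH|e IHe f IHf|e IHe f IHf] //=.
- by move=> _ _; ring.
- by move=> /andP[we wf_] Jt; rewrite IHe// IHf.
- by move=> /andP[we wf_] Jt; rewrite IHe// IHf//; ring.
Qed.

(** [dx] acts on syntax, but its value is the derivative of the value, so it respects equality of
    functions between syntactically different expressions. *)
Lemma eval_dx_congr e f t : wf e -> wf f -> J t -> eval e t = eval f t ->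
  eval (dx e) t = eval (dx f) t.
Proof.
move=> we wf_ Jt E; apply/funext => x.
have [_ <-] := eval_dx x we Jt; have [_ <-] := eval_dx x wf_ Jt.
by rewrite E.
Qed.

Lemma wf_iter n e : wf e -> wf (iter n dx e).
Proof. by move=> we; elim: n => //= n; exact: wf_dx. Qed.

Lemma small_iter n e : small e -> small (iter n dx e).
Proof. by move=> we; elim: n => //= n; exact: small_dx. Qed.

Lemma eval_iter_congr n e f t : wf e -> wf f -> J t -> eval e t = eval f t ->
  eval (iter n dx e) t = eval (iter n dx f) t.
Proof.
move=> we wf_ Jt E; elim: n => //= n IH.
by apply: eval_dx_congr => //; exact: wf_iter.
Qed.

Lemma eval_dt_iter n e t : wf e -> J t ->
  eval (dt (iter n dx e)) t = eval (iter n dx (dt e)) t.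
Proof.
move=> we Jt; elim: n e we => // n IH e we.
rewrite iterSr IH; last exact: wf_dx.
rewrite [in RHS]iterSr; apply: eval_iter_congr => //.
- by apply: wf_dt; exact: wf_dx.
- by apply: wf_dx; exact: wf_dt.
- by apply/funext => x; exact: eval_dtdx.
Qed.

Lemma eval_wfun_of e t : wf e -> small (dx e) -> J t -> int1 (eval e t) -> wfun (eval e t).
Proof.
move=> we se Jt ie.
have dq : dseq (fun n => eval (iter n dx e) t).
  by move=> m x; apply: eval_dx => //; exact: wf_iter.
apply: (wfun_dseq dq) => -[|n]; first exact: ie.
apply: eval_int1 => //; first exact: wf_iter.
by rewrite iterSr; exact: small_iter.
Qed.

Lemma eval_wfun e t : wf e -> small e -> J t -> wfun (eval e t).
Proof.
by move=> we se Jt; apply: eval_wfun_of => //; [exact: small_dx|exact: eval_int1].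
Qed.

Lemma eval_C1 I c v e : wf e -> small (dt e) ->
  (forall s x, J s -> is_derive x (1 : R) (c s) (eval e s x)) ->
  (forall s x, J s -> is_derive x (1 : R) (v s) (eval (dt e) s x)) ->
  frechet_cvg (within I t0^') (fun s x => (c s x - c t0 x) / (s - t0)) (v t0) /\
  frechet_cvg (within I (nbhs t0)) v (v t0).
Proof.
move=> we sde dc dv.
have wde := wf_dt we.
have Kex n : exists K : R -> R, int1 K /\
    forall s x, J s -> `|eval (dt (iter n dx (dt e))) s x| <= K x.
  have [K iK hK] := eval_dom 0 (wf_dt (wf_iter n wde)) (small_dt (small_iter n sde)).
  by exists K; split=> // s x Js; apply: hK => //; rewrite subrr normr0.
pose K n := projT1 (cid (Kex n)).
have KP n : int1 (K n) /\ forall s x, J s -> `|eval (dt (iter n dx (dt e))) s x| <= K n x.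
  by rewrite /K; case: cid.
apply: (@C1_criterion _ _ _ _ _ eta (fun n => eval (iter n dx e))
   (fun n => eval (iter n dx (dt e))) (fun n => eval (dt (iter n dx (dt e)))) K) => //.
- by move=> n s x Js; apply: eval_dx => //; exact: wf_iter.
- by move=> n s x Js; apply: eval_dx => //; exact: wf_iter.
- move=> n s x Js; rewrite -eval_dt_iter//; apply: eval_dt => //; exact: wf_iter.
- by move=> n s x Js; apply: eval_dt => //; exact: wf_iter.
- by move=> n; have [] := KP n.
- by move=> n s x Js; have [_] := KP n; exact.
Qed.

End Expr.

(** * Geodesics *)

Section SignedPower.
Context {R : realType}.
Variable r : R.
Hypothesis hr : 1 < r.
Implicit Types z t x : R.

Local Notation sp := (signed_power r).

Let r0 : 0 < r. Proof. by apply: lt_trans hr. Qed.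
Let r1 : 0 < r - 1. Proof. by rewrite subr_gt0. Qed.

Lemma sp_norm z : `|sp z| = `|z| `^ (r - 1).
Proof.
rewrite /signed_power normrM [`|_ `^ _|]ger0_norm ?powR_ge0//.
have -> : r - 2 = (r - 1) - 1 by ring.
by rewrite mulr_powRB1// subr_gt0.
Qed.

Lemma sp_mulr z : sp z * z = `|z| `^ r.
Proof.
rewrite /signed_power mulrAC -expr2 -real_normK ?num_real// expr2 -mulrA.
have -> : r - 2 = (r - 1) - 1 by ring.
by rewrite !mulr_powRB1.
Qed.

Lemma sp_homog z c : 0 < c -> sp (z * c) = sp z * c `^ (r - 1).
Proof.
move=> c0; rewrite /signed_power normrM (gtr0_norm c0) powRM// ?(ltW c0)//.
have -> : c `^ (r - 1) = c * c `^ (r - 2).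
  have -> : r - 2 = (r - 1) - 1 by ring.
  by rewrite mulr_powRB1 ?(ltW c0)// subr_gt0.
by ring.
Qed.

Lemma sp0 : sp 0 = 0.
Proof. by rewrite /signed_power mul0r. Qed.

Lemma sp_inj : injective sp.
Proof.
move=> z w E.
have nE : `|z| = `|w|.
  have := sp_norm z; rewrite E sp_norm => h.
  apply: (@powR_injective R (r - 1)); rewrite ?subr_gt0 ?nnegrE//.
have [z0|z0] := eqVneq z 0.
  by move: nE; rewrite z0 normr0 => /esym/eqP; rewrite normr_eq0 => /eqP ->.
move: E; rewrite /signed_power nE => /mulIf; apply.
by rewrite powR_eq0 negb_and -nE normr_eq0 z0.
Qed.

Lemma powR_divr z t : 0 < z -> t != 0 -> (z `^ t) `^ t^-1 = z.
Proof. by move=> z0 t0; rewrite -powRrM mulfV// powRr1// ltW. Qed.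

Lemma powR_lip (M z : R) : 1 <= M -> 0 <= z <= M -> `|z `^ r - 1| <= r * M `^ (r - 1) * `|z - 1|.
Proof.
(* The power is differentiable on ]0, M] only; the endpoint z = 0 is checked by hand. *)
move=> M1 /andP[]; rewrite le_eqVlt => /predU1P[<- _|z0 zM].
  rewrite powR0 ?gt_eqF// !sub0r !normrN normr1 mulr1.
  have := @ler_powR R M M1 0 (r - 1) (ltW r1); rewrite powRr0.
  by move=> P1; rewrite (le_trans P1)// ler_peMl ?powR_ge0// ltW.
have := @hdw_bound R `]0, M]%classic (fun z => z `^ r) (fun z => r * z `^ (r - 1)) (r * M `^ (r - 1)).
move=> /(_ (@interval_is_interval _ _)) h.
have := h _ _ z 1; rewrite powR1; apply.
- by move=> t; rewrite /= in_itv/= => /andP[t0 _]; apply: is_derive_hdw; exact: is_derive1_powR.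
- move=> t; rewrite /= in_itv/= => /andP[t0 tM].
  rewrite normrM (gtr0_norm r0) ler_wpM2l ?(ltW r0)//.
  by rewrite ger0_norm ?powR_ge0// ge0_ler_powR ?nnegrE ?(ltW t0) ?(ltW r1)// (le_trans _ M1).
- by rewrite /= in_itv/= z0.
- by rewrite /= in_itv/= ltr01.
Qed.

(* With P = phi_x and Q = phi_tx / phi_x along a trajectory, Q P^(1/r) is
   conserved, so P^(1/r) is affine in time. *)
Lemma conserved_power I (P Q : R -> R) : is_interval I -> I 0 ->
  (forall t, I t -> 0 < P t) ->
  (forall t, I t -> has_deriv_within I P t (Q t * P t)) ->
  (forall t, I t -> Q t * P t `^ r^-1 = Q 0 * P 0 `^ r^-1) ->
  forall t, I t -> 0 < 1 + t * (Q 0 / r) /\ P t = P 0 * (1 + t * (Q 0 / r)) `^ r.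
Proof.
move=> Ii I0 P0 dP QP t It.
have rn0 : r != 0 by rewrite gt_eqF.
have dg s : I s -> has_deriv_within I (fun s => P s `^ r^-1) s (Q 0 / r * P 0 `^ r^-1).
  move=> Is; have := hdw_comp (is_derive1_powR r^-1 (P0 s Is)) (dP s Is).
  suff -> : r^-1 * P s `^ (r^-1 - 1) * (Q s * P s) = Q 0 / r * P 0 `^ r^-1 by [].
  rewrite [RHS]mulrAC -(QP s Is) -(@mulr_powRB1 _ (P s) r^-1) ?invr_gt0//; last exact/ltW/P0.
  by ring.
have E : P t `^ r^-1 = P 0 `^ r^-1 * (1 + t * (Q 0 / r)).
  rewrite -[LHS](subrK ((Q 0 / r * P 0 `^ r^-1) * t)).
  rewrite (@hdw_const R I (fun s => P s `^ r^-1 - (Q 0 / r * P 0 `^ r^-1) * s) Ii _ t 0 It I0).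
    by ring.
  move=> s Is; have := hdwB (dg s Is) (hdwZ (c := Q 0 / r * P 0 `^ r^-1) (@hdw_id R I s)).
  by rewrite mulr1 subrr.
have p0 : 0 < P 0 `^ r^-1 by rewrite powR_gt0// P0.
have B0 : 0 < 1 + t * (Q 0 / r).
  by rewrite -(pmulr_rgt0 _ p0) -E powR_gt0// P0.
split=> //; rewrite -[P t](@powR_divr _ r^-1)//; [|exact: P0|by rewrite invr_neq0].
rewrite E invrK powRM ?(ltW p0) ?(ltW B0)//.
by rewrite -powRrM mulVf// powRr1// ltW// P0.
Qed.

(** [Q] need not be differentiable where it vanishes, so the conserved quantity Q P^(1/r) is
    replaced by its image under the injective map [signed_power], namely sp(Q) P^((r-1)/r), whose
    time derivative is available. *)
Lemma conserved_sp I (P Q d : R -> R) : is_interval I -> I 0 ->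
  (forall t, I t -> 0 < P t) ->
  (forall t, I t -> has_deriv_within I P t (Q t * P t)) ->
  (forall t, I t -> has_deriv_within I (fun s => sp (Q s)) t (d t)) ->
  (forall t, I t -> r * d t + (r - 1) * `|Q t| `^ r = 0) ->
  forall t, I t -> 0 < 1 + t * (Q 0 / r) /\ P t = P 0 * (1 + t * (Q 0 / r)) `^ r.
Proof.
move=> Ii I0 P0 dP dQ eq; apply: conserved_power => // t It.
have rn0 : r != 0 by rewrite gt_eqF.
apply: sp_inj.
rewrite (sp_homog _ (powR_gt0 _ (P0 t It))) (sp_homog _ (powR_gt0 _ (P0 0 I0))) -!powRrM.
pose k := r^-1 * (r - 1).
apply: (@hdw_const R I (fun s => sp (Q s) * P s `^ k) Ii) => // s Is.
have := hdwM (dQ s Is) (hdw_comp (is_derive1_powR k (P0 s Is)) (dP s Is)).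
suff -> : d s * P s `^ k + sp (Q s) * (k * P s `^ (k - 1) * (Q s * P s)) = 0 by [].
have k0 : 0 < k by rewrite /k mulr_gt0 ?invr_gt0.
have -> : sp (Q s) * (k * P s `^ (k - 1) * (Q s * P s)) =
   k * (sp (Q s) * Q s) * (P s * P s `^ (k - 1)) by ring.
rewrite mulr_powRB1//; last exact/ltW/P0.
rewrite sp_mulr -mulrDl.
have -> : d s + k * `|Q s| `^ r = r^-1 * (r * d s + (r - 1) * `|Q s| `^ r).
  by rewrite /k; field.
by rewrite eq// mulr0 mul0r.
Qed.

End SignedPower.

(** * Explicit geodesics from arbitrary initial data and their uniqueness *)

Section ExplicitPath.
Context {R : realType}.
Variable r : R.
Hypothesis hr : 1 < r.
Implicit Types (t x y : R) (I : set R).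

Local Notation mu := (@lebesgue_measure R).

Let r_gt0 : 0 < r. Proof. by apply: lt_trans hr. Qed.
Let rm1_gt0 : 0 < r - 1. Proof. by rewrite subr_gt0. Qed.
Let r_neq0 : r != 0. Proof. by rewrite gt_eqF. Qed.

Lemma min_attained (f : R -> R) y : continuous f ->
  f x @[x --> -oo] --> (0 : R) -> f x @[x --> +oo] --> (0 : R) -> f y < 0 ->
  exists y0, f y0 < 0 /\ forall x, f y0 <= f x.
Proof.
move=> cf fN fy y0; have h0 : 0 < - f y by rewrite oppr_gt0.
have /cvgrPdist_lt/(_ _ h0) := fN => -[A [Ar hA]].
have /cvgrPdist_lt/(_ _ h0) := fy => -[B [Br hB]].
pose a := Num.min (A - 1) y; pose c := Num.max (B + 1) y.
have ay : a <= y by rewrite /a ge_min lexx orbT.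
have yc : y <= c by rewrite /c le_max lexx orbT.
have aA : a < A by rewrite /a gt_min; apply/orP; left; lra.
have cB : B < c by rewrite /c lt_max; apply/orP; left; lra.
have [z zac hz] := EVT_min (le_trans ay yc) (continuous_subspaceT cf).
have zy : f z <= f y by apply: hz; rewrite in_itv/= ay.
exists z; split; first exact: le_lt_trans zy y0.
move=> x; have [xa|ax] := ltP x a.
  apply: (le_trans zy); have /= := hA x ltac:(lra).
  by rewrite sub0r normrN => /ltr_normlP[]; lra.
have [cx|xc] := ltP c x.
  apply: (le_trans zy); have /= := hB x ltac:(lra).
  by rewrite sub0r normrN => /ltr_normlP[]; lra.
by apply: hz; rewrite in_itv/= ax.
Qed.

(** As [b] tends to 0 at both ends, either the base at [t0] is at least 1 everywhere, or it attains
    a positive minimum. Boundedness of [b] then lets the time vary at the cost of half of that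
    minimum. *)
Lemma base_nbhs (b : R -> R) t0 : wfun b -> (forall x, 0 < 1 + t0 * b x) ->
  exists delta eta : R, [/\ 0 < delta, 0 < eta &
    forall t x, `|t - t0| < eta -> delta <= 1 + t * b x].
Proof.
move=> wb B0.
have [M hM] : exists M, forall x, `|b x| <= M.
  by exists (\int[mu]_y `|derive1n 1 b y|) => x; exact: (wfun_sup 0 x wb).
have M0 : 0 <= M := le_trans (normr_ge0 _) (hM 0).
have [d [d0 hd]] : exists d : R, 0 < d /\ forall x, d <= 1 + t0 * b x.
  have [[y by0]|nex] := pselect (exists y, t0 * b y < 0); last first.
    exists 1; split=> // x; rewrite lerDl leNgt; apply/negP => h; apply: nex.
    by exists x.
  have cb : continuous (fun x => t0 * b x).
    by move=> x; apply: cvgM; [exact: cvg_cst|exact: (@wfun_cont _ _ 0 wb)].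
  have lb (F : set_system R) : Filter F -> b x @[x --> F] --> (0 : R) ->
      t0 * b x @[x --> F] --> (0 : R).
    by move=> FF h; rewrite -(mulr0 t0); apply: cvgM => //; exact: cvg_cst.
  have [y0 [_ hy0]] := min_attained cb (lb _ _ (wfun_cvgNy wb)) (lb _ _ (wfun_cvgy wb)) by0.
  by exists (1 + t0 * b y0); split=> // x; rewrite lerD2l.
exists (d / 2), (d / (2 * (M + 1))); split; [lra|by rewrite divr_gt0//; lra|].
move=> t x tt.
have -> : 1 + t * b x = (1 + t0 * b x) + (t - t0) * b x by ring.
have : `|(t - t0) * b x| <= d / 2.
  rewrite normrM; apply: (@le_trans _ _ (d / (2 * (M + 1)) * M)).
    by rewrite ler_pM// ltW.
  have -> : d / (2 * (M + 1)) * M = d / 2 * (M / (M + 1)) by field; rewrite gt_eqF//; lra.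
  rewrite ler_piMr//; first lra.
  by rewrite ler_pdivrMr; lra.
by move=> /ler_normlP[? _]; have := hd x; lra.
Qed.

Section General.
Variables (phi0 p b : R -> R).
Hypothesis dphi0 : forall x, is_derive x (1 : R) phi0 (p x).
Hypothesis gphi0 : diff_group phi0.
Hypothesis wb : wfun b.

(** The explicit path starting from an arbitrary [phi0] with derivative [p]: its x-derivative is p
    (1 + t b)^r. Subtracting 1 makes the integrand integrable. *)
Definition gpath t x := phi0 x + prim (fun y => p y * ((1 + t * b y) `^ r - 1)) x.
Definition gvel t x := prim (fun y => p y * (r * (b y * (1 + t * b y) `^ (r - 1)))) x.

Lemma initial_p : wfun (fun x => p x - 1) /\ forall x, 0 < p x.
Proof.
have [/lie_algebraP[_ w _] h] := gphi0.
have d x : is_derive x (1 : R) (fun x => phi0 x - x) (p x - 1) by apply: is_deriveB.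
rewrite (is_derive_der d) in w h; split=> // x.
by have := h x; lra.
Qed.

Let wp := initial_p.1.
Let p0 := initial_p.2.

Let e := @EMul R (EP 0) (EB r).
Let e1 := @EMul R (EP 0) (EAdd (EB r) (ECst (-1))).

Section AtTime.
Variables (t0 eta delta : R).
Hypothesis eta0 : 0 < eta.
Hypothesis delta0 : 0 < delta.
Hypothesis base_ge : forall t x, `|t - t0| < eta -> delta <= 1 + t * b x.

Let eval := eval p b.

(** [e1] is not [small] as an expression, since the cancellation in (1 + t b)^r - 1 is invisible to
    the syntax; the Lipschitz bound of the power compares it with |t b|. *)
Let int_e1 t : `|t - t0| < eta -> int1 (eval e1 t).
Proof.
move=> Jt.
have [M M0 hM] := base_le wb t0 eta0.
have [Mp Mp0 hMp] := p_bd wp 0.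
pose C := Mp * (r * (M + 1) `^ (r - 1)).
have ib : int1 b by exact: (wfun_int 0 wb).
apply: (int1_le _ (int1Z C (int1_abs (int1Z t ib)))).
  by apply: cont_meas; exact: (eval_cont wb wp eta0 delta0 base_ge).
move=> x; rewrite /= normrM -mulrA ler_pM//.
have := @powR_lip R r hr (M + 1) (1 + t * b x) ltac:(lra).
have -> : 1 + t * b x - 1 = t * b x by ring.
apply; apply/andP; split.
  exact: le_trans (ltW delta0) (base_ge x Jt).
by apply: (le_trans (hM t x Jt)); lra.
Qed.

Lemma gpath_e1 t : gpath t = (fun x => phi0 x + prim (eval e1 t) x).
Proof. by []. Qed.

Lemma gvel_e t : gvel t = prim (eval (dt e) t).
Proof.
by rewrite /gvel; congr prim; apply/funext => y /=; ring.
Qed.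

Lemma dt_e_e1 t : eval (dt e1) t = eval (dt e) t.
Proof. by apply/funext => y /=; ring. Qed.

Lemma small_e : [/\ small (dt e), small (dx e1) & small (dt e1)].
Proof. by split; rewrite /= ?eqxx ?orbT. Qed.

Let wint_e1 t : `|t - t0| < eta -> wfun (eval e1 t).
Proof.
have [_ s _] := small_e.
by move=> Jt; apply: (eval_wfun_of wb wp eta0 delta0 base_ge) => //; exact: int_e1.
Qed.

Lemma gpath_derive t x : `|t - t0| < eta -> is_derive x (1 : R) (gpath t) (p x * (1 + t * b x) `^ r).
Proof.
move=> Jt.
have -> : p x * (1 + t * b x) `^ r = p x + eval e1 t x by rewrite /=; ring.
apply: is_deriveD; apply: prim_derive; last exact: int_e1.
exact: (@eval_cont R p b wb wp t0 eta delta eta0 delta0 base_ge e1 t isT Jt).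
Qed.

Lemma gvel_derive t x : `|t - t0| < eta -> is_derive x (1 : R) (gvel t) (eval (dt e) t x).
Proof.
move=> Jt; rewrite gvel_e; have [s _ _] := small_e.
apply: prim_derive.
  by apply: (eval_cont wb wp eta0 delta0 base_ge).
exact: (eval_int1 wb wp eta0 delta0 base_ge).
Qed.

Lemma gvel_lie t : `|t - t0| < eta -> lie_algebra (gvel t).
Proof.
move=> Jt; rewrite gvel_e; have [s _ _] := small_e; apply: lie_prim.
exact: (eval_wfun wb wp eta0 delta0 base_ge).
Qed.

Lemma gpath_diff t : `|t - t0| < eta -> diff_group (gpath t).
Proof.
move=> Jt; split.
  have := @lie_lin R 1 1 _ _ gphi0.1 (lie_prim (wint_e1 Jt)).
  suff -> : (fun x => 1 * (phi0 x - x) + 1 * prim (eval e1 t) x) = (fun x => gpath t x - x) by [].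
  by apply/funext => x; rewrite gpath_e1; ring.
have d x : is_derive x (1 : R) (fun x => gpath t x - x) (p x * (1 + t * b x) `^ r - 1).
  by apply: is_deriveB; exact: gpath_derive.
move=> x; rewrite (is_derive_der d) ltrBDr addrC subrr.
by rewrite mulr_gt0// powR_gt0// (lt_le_trans delta0)// base_ge.
Qed.

Lemma gpath_time_derive t x : `|t - t0| < eta ->
  is_derive t (1 : R) (gpath ^~ x) (gvel t x).
Proof.
move=> Jt; have [d d0 hd] := J_nbhs Jt.
have [_ _ s] := small_e.
have [K iK hK] := eval_dom wb wp eta0 delta0 base_ge 0 (isT : wf (dt e1)) s.
rewrite gvel_e -dt_e_e1 -[prim _ x]add0r; apply: is_deriveD.
apply: (@integral_time_derive _ `]-oo, x]%classic (eval e1) (eval (dt e1)) K t d) => //.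
- by move=> s0 /hd; exact: int_e1.
- by move=> s0 y /hd Js; exact: (eval_dt wb wp eta0 delta0 base_ge).
- by move=> s0 y /hd Js; apply: hK => //; rewrite subrr normr0.
Qed.

Lemma gpath_C1 I :
  frechet_cvg (within I t0^') (fun s x => (gpath s x - gpath t0 x) / (s - t0)) (gvel t0) /\
  frechet_cvg (within I (nbhs t0)) gvel (gvel t0).
Proof.
have [s _ _] := small_e.
apply: (@eval_C1 _ p b wb wp t0 eta delta eta0 delta0 base_ge I gpath gvel e) => //.
- by move=> u x Ju; exact: gpath_derive.
- by move=> u x Ju; exact: gvel_derive.
Qed.

End AtTime.

Definition base_pos I := forall t x, I t -> 0 < 1 + t * b x.

Lemma gpath_path I : base_pos I -> diff_path I gpath gvel.
Proof.
move=> B0; have at_t t : I t -> exists delta eta : R, [/\ 0 < delta, 0 < eta &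
    forall s x, `|s - t| < eta -> delta <= 1 + s * b x].
  by move=> It; apply: base_nbhs => // x; exact: B0.
have tt t eta : 0 < eta -> `|t - t| < eta by rewrite subrr normr0.
split; first by move=> t /at_t[d [eta [d0 e0 h]]]; exact: (gpath_diff e0 d0 h (tt _ _ e0)).
split=> t /at_t[d [eta [d0 e0 h]]].
- exact: (gvel_lie e0 d0 h (tt _ _ e0)).
- by have [] := gpath_C1 e0 d0 h I.
- by have [] := gpath_C1 e0 d0 h I.
Qed.

Lemma gpath_dx t x : (forall x, 0 < 1 + t * b x) ->
  is_derive x (1 : R) (gpath t) (p x * (1 + t * b x) `^ r).
Proof.
move=> B0; have [d [eta [d0 e0 h]]] := base_nbhs wb B0.
by apply: (gpath_derive e0 d0 h); rewrite subrr normr0.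
Qed.

Lemma gvel_dx t x : (forall x, 0 < 1 + t * b x) ->
  is_derive x (1 : R) (gvel t) (p x * (r * (b x * (1 + t * b x) `^ (r - 1)))).
Proof.
move=> B0; have [d [eta [d0 e0 h]]] := base_nbhs wb B0.
have := @gvel_derive t eta d e0 d0 h t x.
rewrite subrr normr0 => /(_ e0) /is_derive_eq; apply.
by rewrite /=; ring.
Qed.

Lemma gpath_dt t x : (forall x, 0 < 1 + t * b x) ->
  is_derive t (1 : R) (gpath ^~ x) (gvel t x).
Proof.
move=> B0; have [d [eta [d0 e0 h]]] := base_nbhs wb B0.
by apply: (gpath_time_derive e0 d0 h); rewrite subrr normr0.
Qed.

Lemma gpath_q t x : (forall x, 0 < 1 + t * b x) ->
  (gvel t)^`()%classic x / (gpath t)^`()%classic x = r * b x * (1 + t * b x)^-1.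
Proof.
move=> B0; rewrite (is_derive_der (fun x => gvel_dx x B0)) (is_derive_der (fun x => gpath_dx x B0)).
rewrite -(@mulr_powRB1 _ (1 + t * b x) r); [|exact/ltW/B0|exact: r_gt0].
have P0 : (1 + t * b x) `^ (r - 1) != 0 by rewrite gt_eqF// powR_gt0.
have B1 : 1 + t * b x != 0 by rewrite gt_eqF.
have px : p x != 0 by rewrite gt_eqF.
by field; rewrite P0 B1 px.
Qed.

(** By homogeneity sp(Q) = sp(r b) (1 + t b)^(1-r). Time enters only through a power of a positive
    number, so the derivative exists also where [b] vanishes. *)
Lemma gpath_geodesic_eq I : base_pos I -> geodesic_equation r I gpath gvel.
Proof.
move=> B0 q t x It.
have qE s : I s -> q s x = r * b x * (1 + s * b x)^-1.
  by move=> Is; apply: gpath_q => y; exact: B0.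
exists (signed_power r (r * b x) * (- (r - 1) * (1 + t * b x) `^ (- (r - 1) - 1) * b x)).
  apply: (@hdw_eq R I (fun s => signed_power r (r * b x) * (1 + s * b x) `^ (- (r - 1)))) => //.
    move=> s Is; rewrite qE//.
    have Bi : 0 < (1 + s * b x)^-1 by rewrite invr_gt0; exact: B0.
    rewrite (sp_homog hr (r * b x) Bi).
    by rewrite -powR_inv1 ?(ltW (B0 _ _ Is))// -powRrM mulN1r.
  apply: hdwZ; apply: (hdw_comp (F := fun z => z `^ (- (r - 1)))).
    by apply: is_derive1_powR; exact: B0.
  rewrite -[X in has_deriv_within _ _ _ X]add0r; apply: hdwD; first exact: hdw_cst.
  have := hdwM (@hdw_id R I t) (@hdw_cst R I (b x) t).
  by rewrite mul1r mulr0 addr0.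
rewrite qE// normrM powRM// normfV (gtr0_norm (B0 _ _ It)).
rewrite -powR_inv1 ?(ltW (B0 _ _ It))// -powRrM mulN1r.
have -> : - (r - 1) - 1 = - r by ring.
rewrite -(sp_mulr hr); ring.
Qed.

Lemma geodesic_gpath I psi (X : R -> R) : is_interval I -> I 0 -> lie_algebra X ->
  b = (fun x => X^`()%classic (phi0 x) / r) ->
  geodesic r I phi0 (X \o phi0) psi -> base_pos I /\ forall t, I t -> psi t = gpath t.
Proof.
move=> Ii I0 lX bE [phit [dp geq psi0 phit0]].
have [sc lc C1] := diff_path_C1 dp.
have dgr := dp.1.
have r0 := r_neq0.
have psid t x : I t -> is_derive x (1 : R) (psi t) ((psi t)^`()%classic x).
  by move=> It; exact: (smooth_dseq (sc t It) 0 x).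
have psi_pos t x : I t -> 0 < (psi t)^`()%classic x.
  move=> It; have [_ /(_ x)] := dgr t It.
  have d y : is_derive y (1 : R) (fun y => psi t y - y) ((psi t)^`()%classic y - 1).
    by apply: is_deriveB; exact: psid.
  by rewrite (is_derive_der d); lra.
have p00 x : (psi 0)^`()%classic x = p x by rewrite psi0 (is_derive_der dphi0).
have q0 x : (phit 0)^`()%classic x / (psi 0)^`()%classic x / r = b x.
  rewrite p00 phit0 bE.
  have d : is_derive x (1 : R) (X \o phi0) (X^`()%classic (phi0 x) * p x).
    by apply: is_derive1_comp; exact: (lie_derive 0 _ lX).
  by rewrite derive1E derive_val mulfK// gt_eqF.
have key x t : I t -> 0 < 1 + t * b x /\ (psi t)^`()%classic x = p x * (1 + t * b x) `^ r.
  move=> It.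
  (* The derivatives whose existence the geodesic equation asserts are collected into one function
     of time; the value 0 outside [I] is a default. *)
  pose d := fun s => if pselect (I s) is left Is then projT1 (cid2 (geq s x Is)) else 0.
  have := @conserved_sp R r hr I (fun s => (psi s)^`()%classic x)
    (fun s => (phit s)^`()%classic x / (psi s)^`()%classic x) d Ii I0.
  rewrite q0 p00; apply => // [s|s Is|s Is|s Is].
  - exact: psi_pos.
  - by rewrite divfK ?gt_eqF ?psi_pos//; exact: (@C1_hdw R I psi phit sc lc C1 1 s x Is).
  - by rewrite /d; case: pselect => // Is'; case: cid2.
  - by rewrite /d; case: pselect => // Is'; case: cid2.
have B0 : base_pos I by move=> t x It; have [] := key x t It.
split=> // t It.
have dd x : is_derive x (1 : R) (fun x => psi t x - gpath t x) 0.
  rewrite -[X in is_derive _ _ _ X](subrr ((psi t)^`()%classic x)).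
  apply: is_deriveB; first exact: psid.
  by have [_ ->] := key x t It; apply: gpath_dx => y; exact: B0.
have c0 := is_derive_const dd.
(* Equal x-derivatives leave a constant in x, which the common normalisation at -oo forces to be
   0. *)
have lim : psi t x - gpath t x @[x --> -oo] --> (0 : R).
  have [l1 _] := dgr t It; have [l2 _] := (gpath_path B0).1 t It.
  have -> : (fun x => psi t x - gpath t x) =
      (fun x => (psi t x - x) - (gpath t x - x)) by apply/funext => x; ring.
  by rewrite -(subr0 0); apply: cvgB; [exact: (lie_cvgNy 0 l1)|exact: (lie_cvgNy 0 l2)].
apply/funext => x; apply/eqP; rewrite -subr_eq0; apply/eqP.
have h : psi t z - gpath t z @[z --> -oo] --> psi t x - gpath t x.
  by under eq_fun do rewrite (c0 _ x); exact: cvg_cst.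
exact: (cvg_unique _ h lim).
Qed.

Lemma gpath0 : gpath 0 = phi0.
Proof.
apply/funext => x; rewrite /gpath -[RHS]addr0; congr (_ + _).
rewrite /prim; under eq_Rintegral do rewrite mul0r addr0 powR1 subrr mulr0.
by rewrite Rintegral_cst ?mul0r//; exact: measurable_itv.
Qed.

Lemma gvel0 (X : R -> R) : lie_algebra X ->
  b = (fun x => X^`()%classic (phi0 x) / r) -> gvel 0 = X \o phi0.
Proof.
move=> lX bE.
have r0 := r_neq0.
have g : gvel 0 = prim (fun y => X^`()%classic (phi0 y) * p y).
  rewrite /gvel; congr prim; apply/funext => y.
  by rewrite mul0r addr0 powR1 mulr1 bE; field.
have d x : is_derive x (1 : R) (X \o phi0) (X^`()%classic (phi0 x) * p x).
  by apply: is_derive1_comp; exact: (lie_derive 0 _ lX).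
have B1 x : 0 < 1 + 0 * b x by rewrite mul0r addr0.
have [dl [eta [d0 e0 h]]] := base_nbhs wb B1.
have lg : lie_algebra (gvel 0) by apply: (gvel_lie e0 d0 h); rewrite subrr normr0.
have dg x : is_derive x (1 : R) (gvel 0) (X^`()%classic (phi0 x) * p x).
  have := gvel_dx x B1; rewrite mul0r addr0 powR1 mulr1.
  by move/is_derive_eq; apply; rewrite bE; field.
have ci : continuous (fun y => X^`()%classic (phi0 y) * p y).
  by rewrite -(is_derive_der dg); exact: (@lie_cont _ _ 1 lg).
have ii : int1 (fun y => X^`()%classic (phi0 y) * p y).
  by rewrite -(is_derive_der dg); exact: (lie_int1 0 lg).
rewrite g; apply/esym; apply: (prim_uniq ci ii d).
have [l1 _] := gphi0; have := lie_cvgNy 0 l1; rewrite derive1n0 => h0.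
have hN : phi0 x @[x --> -oo] --> -oo.
  apply/cvgrNyPle => A.
  have /cvgrPdist_le/(_ _ ltr01)[B [Br hB]] := h0.
  exists (Num.min B (A - 1)); split; first exact: num_real.
  move=> x; rewrite lt_min => /andP[xB xA]; have /= := hB x xB.
  by rewrite sub0r normrN => /ler_normlP[]; lra.
have := lie_cvgNy 0 lX; rewrite derive1n0 => hX.
exact: (cvg_comp _ _ hN hX).
Qed.

End General.

Lemma diff_group_id : diff_group (@id R).
Proof.
split; rewrite /=.
  have -> : (fun x : R => x - x) = (fun=> 0) by apply/funext => x; rewrite subrr.
  exact: lie0.
move=> x; have -> : (fun x : R => x - x) = (fun=> 0) by apply/funext => z; rewrite subrr.
by rewrite derive1_cst; lra.
Qed.

Section Main.
Variable u0 : R -> R.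
Hypothesis hu0 : lie_algebra u0.

Definition slope x := u0^`()%classic x / r.

Lemma slope_wfun : wfun slope.
Proof.
have [_ [s i] _] := iffLR (lie_algebraP u0) hu0.
have [s' d'] := @smooth_lin R r^-1 0 _ _ s s.
have E : slope = (fun x => r^-1 * u0^`()%classic x + 0 * u0^`()%classic x).
  by apply/funext => x; rewrite /slope; ring.
rewrite E; split=> // n; rewrite d'.
by apply: int1D; apply: int1Z; exact: i.
Qed.

Lemma explicit_pathE : explicit_path r u0 = gpath id (fun=> 1) slope.
Proof.
apply/funext => t; apply/funext => x; rewrite /explicit_path /gpath /prim.
congr (_ + _); apply: eq_Rintegral => y _.
by rewrite mul1r /slope; congr (_ `^ _ - _); ring.
Qed.

(* If the base were not positive at time t, its minimum over x would vanish at some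
   time s between 0 and t, and with it the x-derivative of the path at s. *)
Lemma diff_group_base I : is_interval I -> I 0 ->
  (forall t, I t -> diff_group (explicit_path r u0 t)) -> base_pos slope I.
Proof.
move=> Ii I0 dg t y It; rewrite ltNge; apply/negP => By.
have wb := slope_wfun.
have cb : continuous (fun x => t * slope x).
  by move=> x; apply: cvgM; [exact: cvg_cst|exact: (@wfun_cont _ _ 0 wb)].
have lb (F : set_system R) : Filter F -> slope x @[x --> F] --> (0 : R) ->
    t * slope x @[x --> F] --> (0 : R).
  by move=> FF h; rewrite -(mulr0 t); apply: cvgM => //; exact: cvg_cst.
have [y0 [fy0 miny]] := min_attained cb (lb _ _ (wfun_cvgNy wb)) (lb _ _ (wfun_cvgy wb))
  (ltac:(lra) : t * slope y < 0).
have y0m : t * slope y0 <= -1 by have := miny y; lra.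
(* Rescaling the time [t] by this factor in ]0, 1] brings the minimal value of the base to exactly
   0, at a time that is still in [I]. *)
pose th := - (t * slope y0)^-1.
have th0 : 0 < th by rewrite /th oppr_gt0 invr_lt0.
have th1 : th <= 1.
  by rewrite /th -invrN invf_le1; [lra|rewrite oppr_gt0].
have thE : th * (t * slope y0) = -1 by rewrite /th mulNr mulVf// lt_eqF.
pose s := th * t.
have Is : I s.
  rewrite /s; have [t0|t0] := leP 0 t.
    by apply: (Ii 0 t) => //; apply/andP; split; nra.
  by apply: (Ii t 0) => //; apply/andP; split; nra.
have B0 x : 0 <= 1 + s * slope x.
  rewrite /s -mulrA; have : th * (t * slope y0) <= th * (t * slope x) by rewrite ler_wpM2l// ltW.
  by rewrite thE; lra.
have By0 : 1 + s * slope y0 = 0 by rewrite /s -mulrA thE subrr.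
pose g x := (1 + s * slope x) `^ r - 1.
have [M M0 hM] : exists2 M, 0 <= M & forall x, `|s * slope x| <= M.
  exists (`|s| * \int[mu]_y `|derive1n 1 slope y|).
    by rewrite mulr_ge0//; exact: Rint_ge0.
  by move=> x; rewrite normrM ler_wpM2l//; exact: (wfun_sup 0 x wb).
have BM x : 0 <= 1 + s * slope x <= M + 1.
  by rewrite B0/=; have := hM x => /ler_normlP[_]; lra.
have ib : int1 slope by exact: (wfun_int 0 wb).
have cB : continuous (fun x => 1 + s * slope x).
  move=> x; apply: cvgD; first exact: cvg_cst.
  by apply: cvgM; [exact: cvg_cst|exact: (@wfun_cont _ _ 0 wb)].
have gi : int1 g.
  apply: (int1_le _ (int1Z (r * (M + 1) `^ (r - 1)) (int1_abs (int1Z s ib)))).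
    apply: measurable_funB; last exact: measurable_cst.
    by apply: (measurableT_comp (measurable_powR _)); exact: cont_meas.
  move=> x; have := @powR_lip R r hr (M + 1) _ ltac:(lra) (BM x).
  by have -> : 1 + s * slope x - 1 = s * slope x by ring.
have cg : {for y0, continuous g}.
  apply: cvgB; last exact: cvg_cst.
  rewrite By0 powR0//.
  apply/cvgrPdist_le => e e0.
  pose C := (M + 1) `^ (r - 1).
  have C0 : 0 <= C by exact: powR_ge0.
  have := cB y0; rewrite /continuous_at By0 => /cvgrPdist_le/(_ (e / (C + 1))).
  rewrite divr_gt0//; last lra.
  move=> /(_ isT); apply: filterS => x; rewrite !sub0r !normrN => h.
  have /andP[b0 bM] := BM x.
  rewrite ger0_norm ?powR_ge0// -mulr_powRB1//.
  apply: (@le_trans _ _ ((e / (C + 1)) * C)).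
    apply: ler_pM => //; rewrite ?powR_ge0//.
      exact: le_trans (ler_norm _) h.
    by apply: ge0_ler_powR; rewrite ?nnegrE ?(ltW rm1_gt0)//; lra.
  rewrite -mulrA ler_piMr ?(ltW e0)// mulrC ler_pdivrMr; lra.
(* Membership in the group demands a derivative above -1 at [y0], while the fundamental theorem of
   calculus gives [g y0], which is -1. *)
have [_ /(_ y0)] := dg s Is.
have -> : (fun x => explicit_path r u0 s x - x) = prim g.
  apply/funext => x; rewrite explicit_pathE /gpath /= addrC addKr /g.
  by congr prim; apply/funext => z; rewrite mul1r.
have [d ->] := @continuous_FTC1 R g -oo%O y0 (y0 + 1) ltac:(lra)
  (int1_set (measurable_itv _) gi) (ltNyr y0) cg.
by rewrite /g By0 powR0// sub0r ltxx.
Qed.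

Lemma explicit_geodesic I psi : is_interval I -> I 0 ->
  geodesic r I id u0 psi <->
  (forall t, I t -> diff_group (explicit_path r u0 t) /\ psi t = explicit_path r u0 t).
Proof.
move=> Ii I0.
have d1 x : is_derive x (1 : R) (@id R) ((fun=> 1) x) by exact: is_derive_id.
have wb := slope_wfun.
split=> [g t It|h].
  have [B0 E] := @geodesic_gpath _ _ _ d1 diff_group_id wb I psi u0 Ii I0 hu0 erefl g.
  by rewrite explicit_pathE E//; split=> //; exact: (gpath_path d1 diff_group_id wb B0).1.
have dg t : I t -> diff_group (explicit_path r u0 t) by move=> /h[].
have B0 := diff_group_base Ii I0 dg.
have [pd pC] := gpath_path d1 diff_group_id wb B0.
have E t : I t -> psi t = gpath id (fun=> 1) slope t.
  by move=> /h[_ ->]; rewrite explicit_pathE.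
exists (gvel (fun=> 1) slope); split.
- split; first by move=> t It; rewrite E//; exact: pd.
  by apply: (C1_curve_eq _ _ pC) => // t It; rewrite E.
- move=> t x It.
  have [d dd eq] := gpath_geodesic_eq d1 diff_group_id wb B0 x It.
  exists d; last by rewrite E.
  by apply: (hdw_eq It _ dd) => s Is; rewrite (E s Is).
- by rewrite E// gpath0.
- by rewrite (gvel0 d1 diff_group_id wb hu0).
Qed.

End Main.

End ExplicitPath.

(** * Length *)

Section Clamp.
Context {R : realType}.
Implicit Types A B s t : R.

(** Freezing time outside [A, B] extends functions of time continuously to the line, where two-sided
    calculus applies. *)
Definition clamp A B t := Num.min B (Num.max A t).

Lemma clamp_itv A B t : A <= B -> A <= clamp A B t <= B.
Proof. by move=> AB; rewrite /clamp le_min ge_min lexx le_max lexx AB. Qed.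

Lemma clamp_id A B t : A <= t <= B -> clamp A B t = t.
Proof. by move=> /andP[At tB]; rewrite /clamp max_r// min_r. Qed.

Lemma clamp_lip A B s t : `|clamp A B s - clamp A B t| <= `|s - t|.
Proof.
have h : `|Num.max A s - Num.max A t| <= `|s - t|.
  by rewrite /Num.max; case: ifP => ?; case: ifP => ?; rewrite ?subrr ?normr0// ler_norml;
    apply/andP; split; have := ler_norm (s - t); have := ler_norm (- (s - t)); rewrite normrN; lra.
apply: le_trans h; rewrite /clamp; move: (Num.max A s) (Num.max A t) => {s t}s t.
by rewrite /Num.min; case: ifP => ?; case: ifP => ?; rewrite ?subrr ?normr0// ler_norml;
    apply/andP; split; have := ler_norm (s - t); have := ler_norm (- (s - t)); rewrite normrN; lra.
Qed.

End Clamp.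

Section Length.
Context {R : realType}.
Variable r : R.
Hypothesis hr : 1 < r.
Implicit Types (t s x y : R).

Local Notation mu := (@lebesgue_measure R).

Let r_gt0 : 0 < r. Proof. by apply: lt_trans hr. Qed.
Let rm1_gt0 : 0 < r - 1. Proof. by rewrite subr_gt0. Qed.
Let r_neq0 : r != 0. Proof. by rewrite gt_eqF. Qed.

Lemma diff_group_deriv (f : R -> R) : diff_group f ->
  [/\ forall x, is_derive x (1 : R) f (f^`()%classic x), wfun (fun x => f^`()%classic x - 1),
     exists2 d, 0 < d & forall x, d <= f^`()%classic x & exists2 M, 0 <= M & forall x, `|f^`()%classic x| <= M].
Proof.
move=> gf; have sf := diff_group_smooth gf.
have df x : is_derive x (1 : R) f (f^`()%classic x) by exact: (smooth_dseq sf 0).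
have [w p0] := initial_p df gf.
(* At time 1 the base attached to b = f' - 1 is f' itself, so its uniform lower bound is the one
   sought. *)
have [d [eta [d0 e0 h]]] := base_nbhs (t0 := 1) w (fun x => ltac:(by have := p0 x; lra)).
split=> //.
  by exists d => // x; have := h 1 x; rewrite subrr normr0 => /(_ e0); lra.
by have [M M0 hM] := p_bd w 0; exists M.
Qed.

Lemma diff_group_diffeo (f : R -> R) : diff_group f -> diffeo f f^`()%classic.
Proof.
move=> gf; have [df w [d d0 hd] _] := diff_group_deriv gf; split=> //.
- exact: (@smooth_cont _ _ 1 (diff_group_smooth gf)).
- by move=> x; exact: lt_le_trans (hd x).
- have E : f^`()%classic = (fun x => (f^`()%classic x - 1) + 1) by apply/funext => x; ring.
  have l (F : set_system R) : Filter F -> (fun x => f^`()%classic x - 1) x @[x --> F] --> (0 : R) ->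
     f^`()%classic x @[x --> F] --> (1 : R).
    by move=> FF h; rewrite E -[X in _ --> X]add0r; apply: cvgD => //; exact: cvg_cst.
  by split; apply: l; [exact: wfun_cvgNy|exact: wfun_cvgy].
- have [M _ hM] := lie_bounded 0 gf.1; exists M => x; exact: hM.
Qed.

Lemma int1_powr (f : R -> R) M : continuous f -> (forall x, `|f x| <= M) -> int1 f ->
  int1 (fun x => `|f x| `^ r).
Proof.
move=> cf fM fi; apply: (int1_le _ (int1Z (M `^ (r - 1)) (int1_abs fi))).
  apply: (measurableT_comp (measurable_powR _)).
  by apply: measurableT_comp => //; exact: cont_meas.
move=> x; rewrite ger0_norm ?powR_ge0// -mulr_powRB1// mulrC ler_wpM2r//.
by apply: ge0_ler_powR; rewrite ?nnegrE// ?(ltW rm1_gt0)// (le_trans _ (fM x)).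
Qed.

Lemma Lnorm_Rint (f : R -> R) (q : R) : int1 (fun x => `|f x| `^ q) ->
  Lnorm mu q%:E (EFin \o f) = ((\int[mu]_x (`|f x| `^ q)) `^ q^-1)%:E.
Proof.
by move=> fi; rewrite unlock /= -poweR_EFin -integral_EFin.
Qed.

Lemma Rint_hoelder (f g : R -> R) (p q Sf Sg : R) : 0 < p -> 0 < q -> p^-1 + q^-1 = 1 ->
  measurable_fun [set: R] f -> measurable_fun [set: R] g ->
  int1 (fun x => `|f x| `^ p) -> int1 (fun x => `|g x| `^ q) -> int1 (fun x => f x * g x) ->
  \int[mu]_x (`|f x| `^ p) = Sf -> \int[mu]_x (`|g x| `^ q) = Sg ->
  `|\int[mu]_x (f x * g x)| <= Sf `^ p^-1 * Sg `^ q^-1.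
Proof.
move=> p0 q0 pq mf mg ip iq ifg <- <-.
have := @hoelder _ _ R mu f g p q mf mg p0 q0 pq.
have e1 : Lnorm mu 1 (EFin \o (f \* g)) = (\int[mu]_x `|f x * g x|)%:E.
  rewrite Lnorm1 -integral_EFin; last exact: int1_abs.
  by apply: eq_integral.
rewrite e1 (Lnorm_Rint ip) (Lnorm_Rint iq) -EFinM lee_fin; apply: le_trans.
by apply: Rint_abs_le => //; exact: int1_abs.
Qed.

(** For [k <= 1] the slope of the power does not grow in absolute value, so on [d, +oo[ it is
    controlled at [d]. *)
Lemma pow_lip (d k : R) : 0 < d -> k <= 1 -> forall z w, d <= z -> d <= w ->
  `|z `^ k - w `^ k| <= `|k| * d `^ (k - 1) * `|z - w|.
Proof.
move=> d0 k1 z w dz dw.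
have := @hdw_bound R `[d, +oo[%classic (fun z => z `^ k) (fun z => k * z `^ (k - 1))
  (`|k| * d `^ (k - 1)).
move=> /(_ (@interval_is_interval _ _)); apply.
- move=> t; rewrite /= in_itv/= andbT => dt; apply: is_derive_hdw; apply: is_derive1_powR.
  exact: lt_le_trans dt.
- move=> t; rewrite /= in_itv/= andbT => dt.
  have t0 := lt_le_trans d0 dt.
  rewrite normrM ler_wpM2l// ger0_norm ?powR_ge0//.
  have -> : k - 1 = - (1 - k) by ring.
  rewrite powRN [leRHS]powRN lef_pV2 ?posrE ?powR_gt0//.
  by apply: ge0_ler_powR; rewrite ?nnegrE ?(ltW t0) ?(ltW d0) ?subr_ge0.
- by rewrite /= in_itv/= andbT.
- by rewrite /= in_itv/= andbT.
Qed.

Lemma powR_lip_itv (W z w : R) : 0 <= z <= W -> 0 <= w <= W ->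
  `|z `^ r - w `^ r| <= r * W `^ (r - 1) * `|z - w|.
Proof.
have lip0 (u : R) : 0 <= u <= W -> `|u `^ r - 0 `^ r| <= r * W `^ (r - 1) * `|u - 0|.
  move=> /andP[u0 uW]; rewrite powR0// !subr0 ger0_norm ?powR_ge0// (ger0_norm u0).
  rewrite -mulr_powRB1// mulrC ler_wpM2r//.
  apply: (@le_trans _ _ (W `^ (r - 1))).
    by apply: ge0_ler_powR; rewrite ?nnegrE ?(ltW rm1_gt0)//; exact: le_trans uW.
  by rewrite ler_peMl ?powR_ge0// ltW.
move=> hz hw; have [z0|z0] := eqVneq z 0.
  by rewrite z0 distrC (distrC 0 w); exact: lip0.
have [w0|w0] := eqVneq w 0; first by rewrite w0; exact: lip0.
have := @hdw_bound R `]0, W]%classic (fun z => z `^ r) (fun z => r * z `^ (r - 1)) (r * W `^ (r - 1)).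
move=> /(_ (@interval_is_interval _ _)); apply.
- by move=> u; rewrite /= in_itv/= => /andP[u0 _]; apply: is_derive_hdw; exact: is_derive1_powR.
- move=> u; rewrite /= in_itv/= => /andP[u0 uW].
  rewrite normrM (gtr0_norm r_gt0) ger0_norm ?powR_ge0//.
  rewrite ler_wpM2l ?(ltW r_gt0)// ge0_ler_powR ?nnegrE ?(ltW u0) ?(ltW rm1_gt0)//.
  exact: le_trans (ltW u0) uW.
- by rewrite /= in_itv/= lt_def z0.
- by rewrite /= in_itv/= lt_def w0.
Qed.

(** The exponent 1/r - 1 absorbs the Jacobian: |P_t / P|^r P = |P_t P^(1/r-1)|^r, which makes the
    Finsler norm a plain L^r norm. *)
Lemma powR_quot (z : R) : 0 < z -> (z `^ (r^-1 - 1)) `^ r = z^-1 `^ r * z.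
Proof.
move=> z0; rewrite -powRrM -(powR_inv1 (ltW z0)) -powRrM -[X in _ = _ * X](powRr1 (ltW z0)).
rewrite -powRD; last by rewrite (gt_eqF z0) implybT.
by congr (_ `^ _); field.
Qed.

Lemma cont_abs_powR (a : R) (f : R -> R) x : 0 < a -> {for x, continuous f} ->
  {for x, continuous (fun y => `|f y| `^ a)}.
Proof.
move=> a0 cf; have an0 : a != 0 by rewrite gt_eqF.
have [f0|f0] := eqVneq (f x) 0.
  rewrite /prop_for /continuous_at f0 normr0 powR0//.
  apply/cvgrPdist_le => e e0.
  have e1 : 0 < e `^ a^-1 by rewrite powR_gt0.
  move: cf; rewrite /prop_for /continuous_at f0 => /cvgrPdist_le/(_ _ e1).
  apply: filterS => u; rewrite !sub0r !normrN => ue; rewrite ger0_norm ?powR_ge0//.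
  rewrite -[leRHS](@powR_divr _ _ a^-1)// ?invr_neq0// invrK.
  by apply: ge0_ler_powR; rewrite ?nnegrE ?powR_ge0 ?(ltW a0).
have h : {for `|f x|, continuous (fun z => z `^ a)}.
  by apply: is_derive_cont; apply: is_derive1_powR; rewrite normr_gt0.
exact: (cvg_comp _ _ (cvg_norm cf) h).
Qed.

Lemma cancel_length (a b x y s : R) : 0 < b -> s = a * b ->
  0 <= b * x - r * s - (b * y - 0) -> r * a <= x - y.
Proof. by move=> b0 -> h; rewrite -(ler_pM2l b0); lra. Qed.

Section Path.
Variables (A B : R) (c v : R -> R -> R).
Hypothesis AB : A < B.
Hypothesis dp : diff_path `[A, B]%classic c v.

Let I : set R := `[A, B]%classic.
Let P t := (c t)^`()%classic.
Let Pt t := (v t)^`()%classic.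
Let k := r^-1 - 1.
(** The time derivative of r P^(1/r), that is, the velocity of the image of the path in L^r. *)
Let w t x := Pt t x * P t x `^ k.

Let k_lt0 : k < 0. Proof. by rewrite /k subr_lt0 invf_lt1. Qed.
Let k_le1 : k <= 1. Proof. by rewrite (le_trans (ltW k_lt0)). Qed.

Let dg t : I t -> diff_group (c t). Proof. exact: dp.1. Qed.
Let sc := let: And3 h _ _ := diff_path_C1 dp in h.
Let lc := let: And3 _ h _ := diff_path_C1 dp in h.
Let C1 := let: And3 _ _ h := diff_path_C1 dp in h.
Let lv t : I t -> lie_algebra (v t). Proof. by case: C1 => h _ _; exact: h. Qed.

Let IE t : I t <-> A <= t <= B. Proof. by rewrite /I /= in_itv. Qed.

Let P_cont t : I t -> continuous (P t).
Proof. by move=> It; exact: (@smooth_cont _ _ 1 (sc It)). Qed.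

Let Pt_cont t : I t -> continuous (Pt t).
Proof. by move=> It; exact: (@lie_cont _ _ 1 (lv It)). Qed.

Let powk_cont t a : I t -> continuous (fun x => P t x `^ a).
Proof.
move=> It x; have [d d0 hd] := let: And4 _ _ h _ := diff_group_deriv (dg It) in h.
have h : {for P t x, continuous (fun z => z `^ a)}.
  by apply: is_derive_cont; apply: is_derive1_powR; exact: lt_le_trans (hd x).
by have := cvg_comp _ _ (@P_cont t It x) h.
Qed.

Let w_cont t : I t -> continuous (w t).
Proof. by move=> It x; apply: cvgM; [exact: Pt_cont|exact: powk_cont]. Qed.

Let powk_le t d : 0 < d -> (forall x, d <= P t x) -> forall x, `|P t x `^ k| <= d `^ k.
Proof.
move=> d0 hd x; rewrite ger0_norm ?powR_ge0//.
have P0 := lt_le_trans d0 (hd x).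
rewrite -[k]opprK powRN [leRHS]powRN lef_pV2 ?posrE ?powR_gt0//.
by apply: ge0_ler_powR; rewrite ?nnegrE ?(ltW P0) ?(ltW d0) ?oppr_ge0 ?(ltW k_lt0)//.
Qed.

Let P_near t : I t -> exists d e, [/\ 0 < d, 0 < e &
  forall s x, I s -> `|s - t| < e -> d <= P s x].
Proof.
move=> It; have [_ _ [d d0 hd] _] := diff_group_deriv (dg It).
have d20 : 0 < d / 2 by lra.
have [e e0 he] := C1_c_unif sc lc C1 1 It d20.
exists (d / 2), e; split=> // s x Is se.
by have := he s Is se x => /ler_normlP[a _]; have := hd x; rewrite /P /= in a *; lra.
Qed.

Let w_bd t : I t -> exists2 M, 0 <= M & forall x, `|w t x| <= M.
Proof.
move=> It; have [_ _ [d d0 hd] _] := diff_group_deriv (dg It).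
have [M M0 hM] := lie_bounded 1 (lv It).
exists (M * d `^ k); first by rewrite mulr_ge0 ?powR_ge0.
by move=> x; rewrite normrM ler_pM//; [exact: hM|exact: powk_le].
Qed.

Let Pt_int t : I t -> int1 (Pt t).
Proof. by move=> It; exact: (lie_int1 0 (lv It)). Qed.

Let w_int t : I t -> int1 (w t).
Proof.
move=> It; have [_ _ [d d0 hd] _] := diff_group_deriv (dg It).
apply: (@int1_bdM _ _ _ (d `^ k)); first exact: Pt_int.
  by apply: cont_meas; exact: powk_cont.
exact: powk_le.
Qed.

Let P_int s t : I s -> I t -> int1 (fun x => P s x - P t x).
Proof.
move=> Is It; have := lie_int1 0 (lc Is It).
by have [_ ->] := smooth_diff (sc Is) (sc It).
Qed.

Let w_L1 t e : I t -> 0 < e -> exists2 d, 0 < d & forall s, I s -> `|s - t| < d ->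
  \int[mu]_x `|w s x - w t x| <= e.
Proof.
move=> It e0; have [d [e1 [d0 e10 hd]]] := P_near It.
have hdt x : d <= P t x by apply: hd => //; rewrite subrr normr0.
pose L := `|k| * d `^ (k - 1).
have L0 : 0 <= L by rewrite mulr_ge0 ?powR_ge0.
pose N := \int[mu]_x `|Pt t x|.
have N0 : 0 <= N by exact: Rint_ge0.
pose C := d `^ k + L * N + 1.
have C0 : 0 < C by have := powR_ge0 d k; have := mulr_ge0 L0 N0; rewrite /C; lra.
have eC : 0 < e / C by rewrite divr_gt0.
have [d1 d10 h1] := C1_v_L1 C1 0 It eC.
have [d2 d20 h2] := C1_c_unif sc lc C1 1 It eC.
exists (Num.min e1 (Num.min d1 d2)); first by rewrite !lt_min e10 d10 d20.
move=> s Is; rewrite !lt_min => /and3P[s1 s2 s3].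
have hds x : d <= P s x by exact: hd.
have i1 : int1 (fun x => `|Pt s x - Pt t x|) by apply: int1_abs; apply: int1B; exact: Pt_int.
have i2 : int1 (fun x => `|Pt t x|) by apply: int1_abs; exact: Pt_int.
apply: (@le_trans _ _ (\int[mu]_x (d `^ k * `|Pt s x - Pt t x| + (L * (e / C)) * `|Pt t x|))).
  apply: Rint_le; [by apply: int1_abs; apply: int1B; exact: w_int|by apply: int1D; exact: int1Z|].
  move=> x.
  have -> : w s x - w t x = (Pt s x - Pt t x) * P s x `^ k + (P s x `^ k - P t x `^ k) * Pt t x.
    rewrite /w; move: (Pt s x) (Pt t x) (P s x `^ k) (P t x `^ k) => a1 a2 a3 a4.
    by clear; ring.
  apply: (le_trans (ler_normD _ _)); rewrite !normrM; apply: lerD.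
    by rewrite mulrC ler_wpM2r//; exact: powk_le.
  rewrite ler_wpM2r//; apply: (le_trans (pow_lip d0 k_le1 (hds x) (hdt x))).
  by rewrite ler_wpM2l//; exact: h2.
rewrite RintD ?RintZ//; [|exact: int1Z|exact: int1Z].
apply: (@le_trans _ _ (d `^ k * (e / C) + L * (e / C) * N)).
  by apply: lerD => //; rewrite ler_wpM2l ?powR_ge0//; exact: h1.
have -> : d `^ k * (e / C) + L * (e / C) * N = e / C * (C - 1) by rewrite /C; ring.
rewrite mulrAC ler_pdivrMr// ler_wpM2l//; first exact: ltW.
by rewrite gerBl.
Qed.

Let Phi t x := r * P t x `^ r^-1.

Let Phi_cont t : I t -> continuous (Phi t).
Proof. by move=> It x; apply: cvgM; [exact: cvg_cst|exact: powk_cont]. Qed.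

(** [Phi] tends to [r] at infinity; only its differences are integrable, being Lipschitz images of
    differences of [P] bounded below. *)
Let Phi_int s t : I s -> I t -> int1 (fun x => Phi s x - Phi t x).
Proof.
move=> Is It.
have [_ _ [ds ds0 hds] _] := diff_group_deriv (dg Is).
have [_ _ [dt dt0 hdt] _] := diff_group_deriv (dg It).
pose d := Num.min ds dt.
have d0 : 0 < d by rewrite lt_min ds0.
have r1 : r^-1 <= 1 by rewrite invf_le1// ltW.
apply: (int1_le _ (int1Z (r * (`|r^-1| * d `^ (r^-1 - 1))) (int1_abs (P_int Is It)))).
  by apply: measurable_funB; apply: cont_meas; exact: Phi_cont.
move=> x; rewrite -mulrBr normrM (gtr0_norm r_gt0) -mulrA ler_wpM2l ?(ltW r_gt0)//.
by apply: pow_lip => //; rewrite /d ge_min ?hds ?hdt ?orbT.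
Qed.

(** Differentiability is stated in L^1, the norm of the Frechet seminorms, rather than in L^r; it
    will be paired with a bounded function. *)
Let Phi_L1 t e : I t -> 0 < e -> exists2 d, 0 < d & forall s, I s -> `|s - t| < d ->
  \int[mu]_x `|Phi s x - Phi t x - (s - t) * w t x| <= e * `|s - t|.
Proof.
move=> It e0; have [d [e1 [d0 e10 hd]]] := P_near It.
have hdt x : d <= P t x by apply: hd => //; rewrite subrr normr0.
pose L := `|k| * d `^ (k - 1).
have L0 : 0 <= L by rewrite mulr_ge0 ?powR_ge0.
pose N := \int[mu]_x `|Pt t x|.
have N0 : 0 <= N by exact: Rint_ge0.
pose C := d `^ k + L * (N + 1) + 1.
have C0 : 0 < C.
  by rewrite /C ltr_wpDl// addr_ge0 ?powR_ge0// mulr_ge0// addr_ge0.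
have eC : 0 < e / C by rewrite divr_gt0.
have [d1 d10 h1] := C1_L1 sc lc C1 0 It eC.
have [d3 d30 h3] := C1_L1 sc lc C1 0 It ltr01.
have [d2 d20 h2] := C1_c_unif sc lc C1 1 It eC.
exists (Num.min e1 (Num.min d1 (Num.min d2 d3))); first by rewrite !lt_min e10 d10 d20.
move=> s Is; rewrite !lt_min => /and4P[s1 s2 s3 s4].
have hds x : d <= P s x by exact: hd.
have iP := P_int Is It.
have i0 : int1 (fun x => P s x - P t x - (s - t) * Pt t x).
  by apply: int1B => //; apply: int1Z; exact: Pt_int.
have LP : \int[mu]_x `|P s x - P t x| <= (N + 1) * `|s - t|.
  apply: (@le_trans _ _ (\int[mu]_x (`|P s x - P t x - (s - t) * Pt t x| + `|s - t| * `|Pt t x|))).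
    apply: Rint_le; [exact: int1_abs| |].
      by apply: int1D; [exact: int1_abs|apply: int1Z; apply: int1_abs; exact: Pt_int].
    move=> x; rewrite -normrM -[X in `|X| <= _](subrK ((s - t) * Pt t x)).
    exact: ler_normD.
  rewrite RintD ?RintZ//; [|by apply: int1_abs; exact: Pt_int|exact: int1_abs|by apply: int1Z; apply: int1_abs; exact: Pt_int].
  have := h3 s Is s4; rewrite mul1r => h; rewrite mulrDl mul1r addrC mulrC.
  by apply: lerD => //; rewrite mulrC.
apply: (@le_trans _ _ (\int[mu]_x (L * (e / C) * `|P s x - P t x| +
   d `^ k * `|P s x - P t x - (s - t) * Pt t x|))).
  apply: Rint_le.
  - by apply: int1_abs; apply: int1B; [exact: Phi_int|apply: int1Z; exact: w_int].
  - by apply: int1D; apply: int1Z; exact: int1_abs.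
  move=> x.
  have -> : Phi s x - Phi t x - (s - t) * w t x =
    (Phi s x - Phi t x - P t x `^ k * (P s x - P t x)) +
     P t x `^ k * (P s x - P t x - (s - t) * Pt t x).
    rewrite /w; move: (Phi s x) (Phi t x) (Pt t x) (P s x) (P t x) (P t x `^ k).
    by clear => a1 a2 a3 a4 a5 a6; ring.
  apply: (le_trans (ler_normD _ _)); rewrite normrM; apply: lerD; last first.
    by rewrite ler_wpM2r//; exact: powk_le.
  (* The slope of u |-> r u^(1/r) is u^k. It is compared with its value at [z] on the points above
     [d] that are no farther from [z] than [y] is. *)
  set z := P t x; set y := P s x.
  apply: (@deriv_affine_bound R [set u | d <= u /\ `|u - z| <= `|y - z|]
    (fun u => r * u `^ r^-1) (fun u => u `^ k) (z `^ k) (L * (e / C))).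
  - move=> a b [da az] [db bz] u ub; split; last exact: interval_cball az bz u ub.
    by have /andP[au _] := ub; exact: le_trans au.
  - move=> u [du _]; have u0 := lt_le_trans d0 du.
    have := @is_deriveZ _ _ _ _ r _ _ _ (is_derive1_powR r^-1 u0).
    by rewrite /GRing.scale/= mulrA mulfV// mul1r.
  - move=> u [du uz]; apply: (le_trans (pow_lip d0 k_le1 du (hdt x))).
    by rewrite ler_wpM2l//; apply: (le_trans uz); exact: h2.
  - by split=> //; exact: hds.
  - by split; [exact: hdt|rewrite subrr normr0].
rewrite RintD ?RintZ//; [|exact: int1_abs|exact: int1_abs|by apply: int1Z; exact: int1_abs|by apply: int1Z; exact: int1_abs].
apply: (@le_trans _ _ (L * (e / C) * ((N + 1) * `|s - t|) + d `^ k * (e / C * `|s - t|))).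
  apply: lerD; first by rewrite ler_wpM2l// mulr_ge0// ltW.
  by rewrite ler_wpM2l ?powR_ge0//; exact: h1.
have -> : L * (e / C) * ((N + 1) * `|s - t|) + d `^ k * (e / C * `|s - t|) =
   e * `|s - t| * ((C - 1) / C) by rewrite /C; field; rewrite gt_eqF.
rewrite ler_piMr ?mulr_ge0 ?(ltW e0)// ler_pdivrMr// mul1r gerBl.
exact: ler01.
Qed.

Let F t := \int[mu]_x (`|w t x| `^ r).

Let F_int t : I t -> int1 (fun x => `|w t x| `^ r).
Proof.
by move=> It; have [M M0 hM] := w_bd It; apply: (int1_powr (w_cont It) hM); exact: w_int.
Qed.

(** Near [t] the values of [w] lie in [-W, W], where the r-th power of the absolute value is
    Lipschitz, so continuity in L^1 passes to the integral of |w|^r. *)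
Let F_cont t e : I t -> 0 < e -> exists2 d, 0 < d &
  forall s, I s -> `|s - t| < d -> `|F s - F t| <= e.
Proof.
move=> It e0; have [d [e1 [d0 e10 hd]]] := P_near It.
have [M M0 hM] := lie_bounded 1 (lv It).
have [d2 d20 h2] := C1_v_unif C1 1 It ltr01.
pose W := (M + 1) * d `^ k.
have W0 : 0 <= W by rewrite mulr_ge0 ?powR_ge0// addr_ge0.
pose L := r * W `^ (r - 1) + 1.
have L0 : 0 < L by rewrite /L ltr_wpDl// mulr_ge0 ?powR_ge0// ltW.
have [d3 d30 h3] := w_L1 It (divr_gt0 e0 L0).
exists (Num.min e1 (Num.min d2 d3)); first by rewrite !lt_min e10 d20 d30.
move=> s Is; rewrite !lt_min => /and3P[s1 s2 s3].
have wW u : I u -> `|u - t| < e1 -> `|u - t| < d2 -> forall x, `|w u x| <= W.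
  move=> Iu u1 u2 x; rewrite normrM ler_pM//; last by apply: powk_le => // y; exact: hd.
  rewrite -[Pt u x](subrK (Pt t x)) addrC; apply: (le_trans (ler_normD _ _)).
  by apply: lerD; [exact: hM|exact: h2].
have tt a : 0 < a -> `|t - t| < a by rewrite subrr normr0.
rewrite /F -RintB; [|exact: F_int|exact: F_int].
apply: (@le_trans _ _ (\int[mu]_x ((L - 1) * `|w s x - w t x|))).
  apply: Rint_abs_le.
  - by apply: int1B; exact: F_int.
  - by apply: int1Z; apply: int1_abs; apply: int1B; exact: w_int.
  move=> x; apply: (@le_trans _ _ ((L - 1) * `| `|w s x| - `|w t x| |)); last first.
    by rewrite ler_wpM2l ?ler_dist_dist// /L addrK mulr_ge0 ?powR_ge0// ltW.
  rewrite /L addrK; apply: powR_lip_itv; rewrite normr_ge0/=; first exact: (wW s Is s1 s2).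
  exact: (wW t It (tt _ e10) (tt _ d20)).
rewrite RintZ; last by apply: int1_abs; apply: int1B; exact: w_int.
apply: (@le_trans _ _ ((L - 1) * (e / L))).
  by rewrite ler_wpM2l ?h3// /L addrK mulr_ge0 ?powR_ge0// ltW.
rewrite mulrA ler_pdivrMr// mulrC ler_wpM2l ?(ltW e0)// gerBl.
exact: ler01.
Qed.

(** Substitution of x = c(t, y): the Eulerian derivative is P_t / P at the label, and the Jacobian
    [P] is absorbed by [powR_quot]. *)
Let finsler_w t : I t -> finsler r (c t) (v t) = (F t `^ r^-1)%:E.
Proof.
move=> It; have df := diff_group_diffeo (dg It).
have [dd _ p0 _ _] := df.
have q_der y : is_derive y (1 : R) (v t \o inverse (c t))
    (Pt t (inverse (c t) y) / P t (inverse (c t) y)).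
  by apply: is_derive1_comp; [exact: (lie_derive 0 _ (lv It))|exact: inverse_derive].
have ci : continuous (inverse (c t)).
  by apply: (is_derive_continuous (inverse_derive df)).
pose g y := `|Pt t (inverse (c t) y) / P t (inverse (c t) y)| `^ r.
have gE y : g (c t y) * P t y = `|w t y| `^ r.
  rewrite /g (inverseKV df) normrM normfV (gtr0_norm (p0 y)) /w normrM powRM ?invr_ge0 ?(ltW (p0 y))//.
  by rewrite (ger0_norm (powR_ge0 _ _)) powRM ?powR_ge0// -mulrA (powR_quot (p0 y)).
have cg : continuous g.
  move=> y; suff h : {for y, continuous (fun y => Pt t (inverse (c t) y) / P t (inverse (c t) y))}.
    by have := cont_abs_powR r_gt0 h.
  have h1 := cvg_comp _ _ (ci y) (@Pt_cont t It (inverse (c t) y)).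
  have h2 := cvg_comp _ _ (ci y) (@P_cont t It (inverse (c t) y)).
  have h3 : P t (inverse (c t) y) != 0 by rewrite gt_eqF// /P p0.
  exact: (cvgM h1 (cvgV h3 h2)).
have gi : int1 g.
  apply: (@abse_integral_le _ g (F t) cg) => [x|]; first exact: powR_ge0.
  rewrite (ge0_integral_diffeo df cg) => [|x]; last exact: powR_ge0.
  by under eq_integral do rewrite gE; rewrite integral_EFin//; exact: F_int.
have gF : \int[mu]_x g x = F t.
  rewrite (Rint_diffeo df cg gi) /F; apply: eq_Rintegral => y _; exact: gE.
rewrite -gF /finsler (is_derive_der q_der).
exact: (@Lnorm_Rint (fun y => Pt t (inverse (c t) y) / P t (inverse (c t) y)) r gi).
Qed.

Let AI : I A. Proof. by apply/IE; rewrite lexx ltW. Qed.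
Let BI : I B. Proof. by apply/IE; rewrite lexx ltW. Qed.

Let length_F : path_length r A B c = (\int[mu]_(t in `]A, B[) (F t `^ r^-1)%:E)%E.
Proof.
apply: eq_integral => t; rewrite inE/= in_itv/= => /andP[At tB].
have It : I t by apply/IE; rewrite !ltW.
rewrite -(finsler_w It); congr finsler; apply/funext => x.
suff h : is_derive t (1 : R) (c ^~ x) (v t x) by rewrite /time_derivative derive1E derive_val.
apply: (@hdw_is_derive _ A B); first by rewrite At.
apply: (hdw_sub _ (@C1_hdw R I c v sc lc C1 0 t x It)).
by move=> s; rewrite /I /= !in_itv/= => /andP[? ?]; rewrite !ltW.
Qed.

Let clampI t : I (clamp A B t).
Proof. by apply/IE; exact/clamp_itv/ltW. Qed.

Let speed t := F (clamp A B t) `^ r^-1.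

Let speed_cont : continuous speed.
Proof.
have cF : continuous (fun t => F (clamp A B t)).
  move=> t; apply/cvgrPdist_le => e e0.
  have [d d0 hd] := F_cont (clampI t) e0.
  exists d => // s /= st; rewrite distrC; apply: hd => //.
  by apply: le_lt_trans st; rewrite [leRHS]distrC; exact: clamp_lip.
move=> t; have := @cont_abs_powR r^-1 _ t ltac:(by rewrite invr_gt0) (cF t).
suff -> : (fun y => `|F (clamp A B y)| `^ r^-1) = speed by [].
by apply/funext => s; rewrite ger0_norm// /F; apply: Rint_ge0 => y; exact: powR_ge0.
Qed.

Let D x := P B x `^ r^-1 - P A x `^ r^-1.
Let G x := signed_power r (D x).

Let D_E x : r * D x = Phi B x - Phi A x. Proof. by rewrite /D mulrBr. Qed.

Let D_bd : exists2 M, 0 <= M & forall x, `|D x| <= M.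
Proof.
have [_ _ _ [MA MA0 hA]] := diff_group_deriv (dg AI).
have [_ _ _ [MB MB0 hB]] := diff_group_deriv (dg BI).
have pos t x : I t -> 0 < P t x by move=> It; have [_ _ p0 _ _] := diff_group_diffeo (dg It); exact: p0.
have h t x M : I t -> `|P t x| <= M -> `|P t x `^ r^-1| <= M `^ r^-1.
  move=> It hM; rewrite ger0_norm ?powR_ge0//; apply: ge0_ler_powR.
  - by rewrite invr_ge0 ltW.
  - by rewrite nnegrE ltW// pos.
  - by rewrite nnegrE (le_trans _ hM).
  - exact: le_trans (ler_norm _) hM.
exists (MB `^ r^-1 + MA `^ r^-1); first by rewrite addr_ge0 ?powR_ge0.
move=> x; apply: (le_trans (ler_normB _ _)); apply: lerD; first exact: (h _ _ _ BI (hB x)).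
exact: (h _ _ _ AI (hA x)).
Qed.

Let D_cont : continuous D.
Proof. by move=> x; apply: cvgB; [exact: (@powk_cont B _ BI x)|exact: (@powk_cont A _ AI x)]. Qed.

Let G_meas : measurable_fun [set: R] G.
Proof.
rewrite /G /signed_power; apply: measurable_funM; first exact: cont_meas.
apply: (measurableT_comp (measurable_powR _)).
by apply: measurableT_comp => //; exact: cont_meas.
Qed.

Let G_bd : exists2 M, 0 <= M & forall x, `|G x| <= M.
Proof.
have [M M0 hM] := D_bd; exists (M `^ (r - 1)); first exact: powR_ge0.
move=> x; rewrite /G (sp_norm hr).
by apply: ge0_ler_powR; rewrite ?nnegrE ?(ltW rm1_gt0).
Qed.

Let DG x : D x * G x = `|D x| `^ r. Proof. by rewrite mulrC (sp_mulr hr). Qed.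

Let D_int : int1 D.
Proof.
have -> : D = (fun x => r^-1 * (Phi B x - Phi A x)).
  by apply/funext => x; rewrite -D_E mulrA mulVf// mul1r.
by apply: int1Z; exact: (Phi_int BI AI).
Qed.

Let D_powint : int1 (fun x => `|D x| `^ r).
Proof. by have [M M0 hM] := D_bd; exact: (int1_powr D_cont hM D_int). Qed.

Let S := \int[mu]_x (`|D x| `^ r).
Let q := r / (r - 1).

Let G_pow x : `|G x| `^ q = `|D x| `^ r.
Proof.
rewrite /G (sp_norm hr) -powRrM; congr (_ `^ _); rewrite /q.
by field; rewrite gt_eqF.
Qed.

(* G is the dual element of D in L^r, so h A = 0, h B = r ||D||^r, and h' is at most
   the speed of the path times ||G||. *)
Let h t := \int[mu]_x ((Phi t x - Phi A x) * G x).

Let h_deriv t : I t -> has_deriv_within I h t (\int[mu]_x (w t x * G x)).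
Proof.
move=> It; have [M M0 hM] := G_bd.
apply/hdwP => e e0.
have eM : 0 < e / (M + 1) by rewrite divr_gt0// ltr_wpDl.
have [d d0 hd] := Phi_L1 It eM; exists d => // s Is st.
have i1 u : I u -> int1 (fun x => (Phi u x - Phi A x) * G x).
  by move=> Iu; apply: (int1_bdM (Phi_int Iu AI) G_meas hM).
have i2 : int1 (fun x => w t x * G x) by apply: (int1_bdM (w_int It) G_meas hM).
rewrite mulrC -RintZ// /h -RintB; [|exact: i1|exact: i1].
have i3 := int1B (Phi_int Is It) (int1Z (s - t) (w_int It)).
rewrite -RintB; [|by apply: int1B; exact: i1|exact: int1Z].
apply: (@le_trans _ _ (\int[mu]_x (M * `|Phi s x - Phi t x - (s - t) * w t x|))).
  apply: Rint_abs_le.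
  - by apply: int1B; [apply: int1B; exact: i1|exact: int1Z].
  - by apply: int1Z; exact: int1_abs.
  move=> x; have -> : (Phi s x - Phi A x) * G x - (Phi t x - Phi A x) * G x - (s - t) * (w t x * G x)
     = G x * (Phi s x - Phi t x - (s - t) * w t x).
    move: (Phi s x) (Phi t x) (Phi A x) (w t x) (G x) => a1 a2 a3 a4 a5; clear; ring.
  by rewrite normrM ler_wpM2r.
rewrite RintZ; last exact: int1_abs.
apply: (@le_trans _ _ (M * (e / (M + 1) * `|s - t|))); first by rewrite ler_wpM2l// hd.
rewrite mulrA ler_wpM2r// mulrA ler_pdivrMr ?ltr_wpDl// mulrC ler_wpM2l ?(ltW e0)//.
by rewrite lerDl.
Qed.

Let w_G_le t : I t -> \int[mu]_x (w t x * G x) <= F t `^ r^-1 * S `^ q^-1.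
Proof.
move=> It; have [M M0 hM] := G_bd.
apply: (le_trans (ler_norm _)).
have Gi : int1 (fun x => `|G x| `^ q).
  by rewrite (_ : (fun x => _) = (fun x => `|D x| `^ r))//; apply/funext => x; exact: G_pow.
have q0 : 0 < q by rewrite divr_gt0.
have rq : r^-1 + q^-1 = 1 by rewrite /q invf_div; field.
have GS : \int[mu]_x (`|G x| `^ q) = S by apply: eq_Rintegral => x _; exact: G_pow.
exact: (Rint_hoelder r_gt0 q0 rq (cont_meas (@w_cont t It)) G_meas (F_int It) Gi
  (int1_bdM (w_int It) G_meas hM) erefl GS).
Qed.

(** With [H] a primitive of the speed, S^(1/q) H - h has nonnegative derivative by Hoelder's
    inequality; its increment, together with h(B) - h(A) = r S, gives the bound after division by
    S^(1/q). *)
Lemma path_length_ge : ((r * S `^ r^-1)%:E <= path_length r A B c)%E.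
Proof.
have [H [H0 dH]] := cont_antideriv speed_cont.
have sT (t : R) : A <= t <= B -> speed t = F t `^ r^-1 by move=> tAB; rewrite /speed clamp_id.
have -> : path_length r A B c = (H B - H A)%:E.
  rewrite length_F -(FTC_itv (ltW AB) speed_cont dH).
  have m : measurable_fun `]A, B[ (EFin \o speed).
    by apply/measurable_EFinP; apply: measurable_funTS; exact: cont_meas.
  have := @integral_itv_bndoo R A B (EFin \o speed) true false m; rewrite /comp => ->.
  apply: eq_integral => t; rewrite inE/= in_itv/= => /andP[At tB].
  by rewrite sT// !ltW.
rewrite lee_fin.
have S0 : 0 <= S by apply: Rint_ge0 => x; exact: powR_ge0.
(* For S = 0 the claim is that lengths are nonnegative; otherwise S^(1/q) may be cancelled. *)
have [Sz|Sn] := eqVneq S 0.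
  rewrite Sz powR0 ?invr_eq0// mulr0 subr_ge0.
  have [t _ E] := hdw_mvt AB (fun t _ => is_derive_hdw `[A, B]%classic (dH t)).
  by rewrite -subr_ge0 E mulr_ge0 ?powR_ge0// subr_ge0 ltW.
have Sp : 0 < S by rewrite lt_def Sn.
have hB : h B = r * S.
  rewrite /S -RintZ//; apply: eq_Rintegral => x _.
  by rewrite -D_E -DG mulrA.
have hA : h A = 0.
  by rewrite /h; under eq_Rintegral do rewrite subrr mul0r; rewrite Rintegral_cst ?mul0r//; exact: measurableT.
have [t /andP[At tB] E] := hdw_mvt AB (fun t tAB =>
  hdwB (hdwZ (c := S `^ q^-1) (is_derive_hdw `[A, B]%classic (dH t))) (h_deriv (iffRL (IE t) tAB))).
have tAB : A <= t <= B by rewrite !ltW.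
have It : I t by apply/IE.
have : 0 <= S `^ q^-1 * H B - h B - (S `^ q^-1 * H A - h A).
  rewrite E; apply: mulr_ge0; rewrite subr_ge0; last exact: ltW.
  by rewrite (sT t tAB) mulrC; exact: w_G_le.
rewrite hA hB => key.
have q1 : S = S `^ r^-1 * S `^ q^-1.
  rewrite -powRD ?(gt_eqF Sp) ?implybT//.
  have -> : r^-1 + q^-1 = 1 by rewrite /q invf_div; field.
  by rewrite powRr1// ltW.
have Sq : 0 < S `^ q^-1 by rewrite powR_gt0.
exact: (cancel_length Sq q1 key).
Qed.

Lemma path_length_const K : (forall t, I t -> F t = K) ->
  path_length r A B c = ((B - A) * K `^ r^-1)%:E.
Proof.
move=> FK; rewrite length_F (eq_integral (fun=> (K `^ r^-1)%:E)); last first.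
  by move=> t; rewrite inE/= in_itv/= => /andP[At tB]; rewrite FK//; apply/IE; rewrite !ltW.
rewrite integral_cst//= lebesgue_measure_itv/= lte_fin AB -EFinD -EFinM.
by rewrite mulrC.
Qed.


End Path.
(** Along the explicit path P^(1/r) = 1 + t u0'/r, so the image is a segment run at the constant
    speed K^(1/r), with [K] the integral of |u0'|^r. Its length equals the lower bound that
    [path_length_ge] gives for every competitor. *)
Lemma explicit_minimizing (u0 : R -> R) (I : set R) : lie_algebra u0 -> is_interval I -> I 0 ->
  (forall t, I t -> diff_group (explicit_path r u0 t)) -> forall a b, I a -> I b -> a < b ->
  path_length r a b (explicit_path r u0) =
  finsler_dist r (explicit_path r u0 a) (explicit_path r u0 b).
Proof.
move=> lu Ii I0 dg a b Ia Ib ab.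
have B0 := diff_group_base hr lu Ii I0 dg.
have d1 x : is_derive x (1 : R) (@id R) ((fun=> 1) x) by exact: is_derive_id.
have wb := slope_wfun r lu.
have JI : `[a, b]%classic `<=` I.
  by move=> t /=; rewrite in_itv/= => tab; exact: (Ii a b Ia Ib).
have B1 : base_pos (slope r u0) `[a, b]%classic by move=> t x /JI; exact: B0.
have dp := gpath_path hr d1 diff_group_id wb B1.
rewrite explicit_pathE; set phi := gpath _ _ _ _; set v := gvel _ _ _ in dp.
pose K := \int[mu]_x (`|r * slope r u0 x| `^ r).
have dP t x : `[a, b]%classic t -> (phi t)^`()%classic x = (1 + t * slope r u0 x) `^ r.
  move=> It; have h := fun x => gpath_dx hr d1 diff_group_id wb x (fun x => B1 t x It).
  by rewrite (is_derive_der h) mul1r.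
have dv t x : `[a, b]%classic t -> (v t)^`()%classic x =
    r * (slope r u0 x * (1 + t * slope r u0 x) `^ (r - 1)).
  move=> It; have h := fun x => gvel_dx r d1 diff_group_id wb x (fun x => B1 t x It).
  by rewrite (is_derive_der h) mul1r.
have root t x : `[a, b]%classic t -> ((1 + t * slope r u0 x) `^ r) `^ r^-1 = 1 + t * slope r u0 x.
  by move=> It; rewrite powR_divr// B1.
have rootP t x : `[a, b]%classic t -> (phi t)^`()%classic x `^ r^-1 = 1 + t * slope r u0 x.
  by move=> It; rewrite (dP t x It) (root t x It).
have FK t : `[a, b]%classic t ->
    \int[mu]_x (`|(v t)^`()%classic x * (phi t)^`()%classic x `^ (r^-1 - 1)| `^ r) = K.
  move=> It; apply: eq_Rintegral => x _; congr (`|_| `^ _).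
  rewrite dv// dP// -powRrM.
  have -> : r * (r^-1 - 1) = - (r - 1) by field.
  by rewrite powRN -!mulrA mulfV ?mulr1// gt_eqF// powR_gt0// B1.
have lenE := path_length_const ab dp FK.
have Ja : `[a, b]%classic a by rewrite /= in_itv/= lexx ltW.
have Jb : `[a, b]%classic b by rewrite /= in_itv/= lexx ltW.
apply/eqP; rewrite eq_le; apply/andP; split; last first.
  by apply: ereal_inf_lbound; exists a, b, phi, v; split.
rewrite lenE; apply: le_ereal_inf_tmp => _ [a' [b' [c [v' [ab' dp' ca cb ->]]]]].
apply: le_trans (path_length_ge ab' dp').
rewrite lee_fin ca cb.
have e0 : 0 < (b - a) / r by rewrite divr_gt0// subr_gt0.
have ki : int1 (fun x => `|r * slope r u0 x| `^ r).
  have [M M0 hM] := lie_bounded 1 lu.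
  have E : (fun x => r * slope r u0 x) = u0^`()%classic.
    by apply/funext => x; rewrite /slope; field.
  have := int1_powr (@lie_cont _ _ 1 lu) hM (lie_int1 0 lu).
  by rewrite derive1n1 -E.
have -> : \int[mu]_x (`|(phi b)^`()%classic x `^ r^-1 - (phi a)^`()%classic x `^ r^-1| `^ r) =
    ((b - a) / r) `^ r * K.
  rewrite -RintZ//; apply: eq_Rintegral => x _.
  apply: (etrans (congr2 (fun y z => `|y - z| `^ r) (rootP b x Jb) (rootP a x Ja))).
  have -> : 1 + b * slope r u0 x - (1 + a * slope r u0 x) = (b - a) / r * (r * slope r u0 x).
    by field.
  by rewrite normrM (gtr0_norm e0); apply: powRM; [exact: ltW|exact: normr_ge0].
have K0 : 0 <= K by apply: Rint_ge0 => x; exact: powR_ge0.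
by rewrite powRM ?powR_ge0// powR_divr// mulrA mulrCA mulfV// mulr1.
Qed.

End Length.

(** * The Eulerian variable *)

Section Implicit.
Context {R : realType}.
Implicit Types (t s x y : R).

(** No continuity of [Y] is assumed. The lower bound [c] on the slope first makes [Y] Lipschitz at
    [t]; this puts [Y s] in the range where [fx] is nearly constant, and the linearised equation can
    be solved. *)
Lemma implicit_derive (f fx : R -> R -> R) (Y : R -> R) t (eta c ft x : R) :
  0 < eta -> 0 < c ->
  (forall s y, `|s - t| < eta -> is_derive y (1 : R) (f s) (fx s y)) ->
  (forall s y, `|s - t| < eta -> c <= fx s y) ->
  (forall e, 0 < e -> exists2 d, 0 < d & forall s y, `|s - t| < d ->
     `|y - Y t| < d -> `|fx s y - fx t (Y t)| <= e) ->
  is_derive t (1 : R) (f ^~ (Y t)) ft ->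
  (forall s, `|s - t| < eta -> f s (Y s) = x) ->
  is_derive t (1 : R) Y (- (ft / fx t (Y t))).
Proof.
move=> eta0 c0 df fc cfx dft fY.
have tt a : 0 < a -> `|t - t| < a by rewrite subrr normr0.
set y := Y t; set a := fx t y.
have a0 : 0 < a by apply: (lt_le_trans c0); apply: fc; exact: tt.
have fty : f t y = x by apply: fY; exact: tt.
have lower s z w : `|s - t| < eta -> c * `|z - w| <= `|f s z - f s w|.
  move=> st; wlog zw : z w / z <= w => [h|].
    by have [/h|/ltW/h] := leP z w; rewrite // ![`|w - _|]distrC ![`|_ - f s z|]distrC.
  move: zw; rewrite le_eqVlt => /predU1P[->|zw]; first by rewrite !subrr !normr0 mulr0.
  have [u _ E] := hdw_mvt zw (fun u _ => is_derive_hdw `[z, w]%classic (df s u st)).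
  rewrite distrC [leRHS]distrC E normrM ler_wpM2r//.
  exact: (le_trans (fc s u st) (ler_norm _)).
have := iffLR (is_derive_hdwT _ _ _) dft; move/hdwP => hft.
pose C := (`|ft| + 1) / c.
have C0 : 0 < C by rewrite divr_gt0// ltr_wpDl.
have [d1 d10 h1] := hft _ ltr01.
have YC s : `|s - t| < Num.min eta d1 -> `|Y s - y| <= C * `|s - t|.
  rewrite lt_min => /andP[s1 s2].
  have := lower s (Y s) y s1; rewrite (fY s s1) => l.
  rewrite /C mulrAC ler_pdivlMr// mulrC (le_trans l)//.
  have := h1 s Logic.I s2; rewrite fty mul1r => l1.
  rewrite distrC -[f s y - x](subrK (ft * (s - t))) (le_trans (ler_normD _ _))//.
  by rewrite mulrDl mul1r addrC normrM lerD.
apply/is_derive_hdwT/hdwP => e e0.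
(* The two remainders cost [e' * C] and [e']; the factor [a] is the slope by which the estimate is
   divided at the end. *)
pose e' := e * a / (C + 1).
have e'0 : 0 < e' by rewrite divr_gt0 ?mulr_gt0// ltr_wpDl// ltW.
have [d2 d20 h2] := cfx _ e'0.
have [d3 d30 h3] := hft _ e'0.
exists (Num.min (Num.min eta d1) (Num.min (Num.min d2 d3) (d2 / C))).
  by rewrite !lt_min eta0 d10 d20 d30 divr_gt0.
move=> s _; rewrite lt_min => /andP[s1]; rewrite !lt_min => /andP[/andP[s2 s3] s4].
have Ys := YC s s1; move: s1; rewrite lt_min => /andP[s1 _].
have Yd : `|Y s - y| < d2 by apply: (le_lt_trans Ys); rewrite mulrC -ltr_pdivlMr.
have E1 : `|f s (Y s) - f s y - a * (Y s - y)| <= e' * `|Y s - y|.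
  apply: (deriv_affine_bound (@interval_ball R y d2) (fun u _ => df s u s1)) => //=.
    by move=> u uy; exact: h2.
  by rewrite subrr normr0.
have := h3 s Logic.I s3; rewrite fty => E2.
rewrite (fY s s1) in E1.
rewrite -(ler_pM2l a0) -{1}(ger0_norm (ltW a0)) -normrM.
have -> : a * (Y s - y - - (ft / a) * (s - t)) =
   - (x - f s y - a * (Y s - y)) - (f s y - x - ft * (s - t)).
  by field; rewrite gt_eqF.
apply: (le_trans (ler_normB _ _)); rewrite normrN.
apply: (@le_trans _ _ (e' * (C * `|s - t|) + e' * `|s - t|)).
  by apply: lerD => //; apply: (le_trans E1); rewrite ler_wpM2l// ltW.
rewrite -mulrDr -{2}[`|s - t|]mul1r -mulrDl mulrA /e' mulfVK; last first.
  by rewrite gt_eqF// ltr_wpDl// ltW.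
by rewrite mulrA (mulrC a).
Qed.

End Implicit.

Section Eulerian.
Context {R : realType}.
Variable r : R.
Hypothesis hr : 1 < r.
Variable b : R -> R.
Hypothesis wb : wfun b.
Implicit Types (s t x y : R) (e f : @expr R).

Local Notation mu := (@lebesgue_measure R).
Local Notation p := (fun=> 1 : R).
Local Notation phi := (gpath r id p b).
Local Notation eval := (eval p b).

Let r_gt0 : 0 < r. Proof. by apply: lt_trans hr. Qed.
Let r_neq0 : r != 0. Proof. by rewrite gt_eqF. Qed.

Lemma id_derive x : is_derive x (1 : R) (@id R) ((fun=> 1) x).
Proof. exact: is_derive_id. Qed.

Let wp := (initial_p id_derive diff_group_id).1.

Definition velocity : @expr R := EInt (dt (EMul (EP 0) (EB r))).
(* The x- and t-derivatives of (t, x) |-> e t (labels t x): in Eulerian coordinates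
   the labels are transported with velocity [velocity]. *)
Definition Dx e := EMul (dx e) (EB (- r)).
Definition Dt e := EAdd (dt e) (EMul (ECst (-1)) (EMul (EMul (dx e) (EB (- r))) velocity)).

(** The back-to-labels map: the initial position of the particle that is at x at time t. *)
Definition labels t := inverse (phi t).
Definition ev e t x := eval e t (labels t x).

Lemma wf_velocity : wf velocity. Proof. by rewrite /= eqxx orbT. Qed.

Lemma wf_Dx e : wf e -> wf (Dx e). Proof. by move=> h; rewrite /= wf_dx. Qed.

Lemma wf_Dt e : wf e -> wf (Dt e).
Proof. by move=> h; rewrite /= wf_dx// wf_dt//= eqxx orbT. Qed.

Lemma small_Dx e : small e -> small (Dx e).
Proof. by move=> h; rewrite /= small_dx. Qed.

Lemma small_Dt e : small e -> small (Dt e).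
Proof. by move=> h; rewrite /= small_dt// small_dx//= orbT. Qed.

Section AtTime.
Variables (t0 eta delta : R).
Hypothesis eta0 : 0 < eta.
Hypothesis delta0 : 0 < delta.
Hypothesis base_ge : forall t x, `|t - t0| < eta -> delta <= 1 + t * b x.
Let J t := `|t - t0| < eta.

Let B_gt0 t x : J t -> 0 < 1 + t * b x.
Proof. by move=> Jt; apply: lt_le_trans delta0 _; exact: base_ge. Qed.

Let phi_dx t x : J t -> is_derive x (1 : R) (phi t) (eval (EB r) t x).
Proof.
move=> Jt; have := gpath_derive hr id_derive diff_group_id wb eta0 delta0 base_ge x Jt.
by rewrite mul1r.
Qed.

Lemma eulerian_group t : J t -> diff_group (phi t).
Proof. exact: (gpath_diff hr id_derive diff_group_id wb eta0 delta0 base_ge). Qed.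

Let phi_diffeo t : J t -> diffeo (phi t) (phi t)^`()%classic.
Proof. by move=> Jt; apply: diff_group_diffeo; exact: eulerian_group. Qed.

Let phi_labels t x : J t -> phi t (labels t x) = x.
Proof. by move=> Jt; exact: (inverseK (phi_diffeo Jt)). Qed.

Let labels_dx t x : J t -> is_derive x (1 : R) (labels t) (eval (EB (- r)) t (labels t x)).
Proof.
move=> Jt; have := inverse_derive (phi_diffeo Jt) x.
rewrite (is_derive_der (fun x => phi_dx x Jt)) /= => h.
by rewrite powRN.
Qed.

Lemma eval_joint e : wf e -> exists2 M, 0 <= M & forall s t x y, J s -> J t ->
  `|eval e s x - eval e t y| <= M * (`|s - t| + `|x - y|).
Proof.
move=> we.
have [M1 M10 h1] := eval_bd wb wp eta0 delta0 base_ge (wf_dt we).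
have [M2 M20 h2] := eval_bd wb wp eta0 delta0 base_ge (wf_dx we).
exists (M1 + M2) => [|s t x y Js Jt]; first exact: addr_ge0.
have -> : eval e s x - eval e t y = (eval e s x - eval e t x) + (eval e t x - eval e t y) by ring.
apply: (le_trans (ler_normD _ _)).
have l1 : `|eval e s x - eval e t x| <= M1 * `|s - t|.
  apply: (@hdw_bound R [set u | J u] (eval e ^~ x) (fun u => eval (dt e) u x) M1) => //.
  - exact: interval_ball.
  - by move=> u Ju; apply: is_derive_hdw; exact: (eval_dt wb wp eta0 delta0 base_ge).
  - by move=> u Ju; exact: h1.
have l2 : `|eval e t x - eval e t y| <= M2 * `|x - y|.
  apply: (@is_derive_bound R (eval e t) (eval (dx e) t)) => z; last exact: h2.
  exact: (eval_dx wb wp eta0 delta0 base_ge).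
have a1 := normr_ge0 (s - t); have a2 := normr_ge0 (x - y).
nra.
Qed.

Lemma eval_joint_cvg e t z d0 : wf e -> J t -> 0 < d0 -> exists2 d, 0 < d &
  forall s y, J s -> `|s - t| < d -> `|y - z| < d -> `|eval e s y - eval e t z| <= d0.
Proof.
move=> we Jt d00; have [M M0 hM] := eval_joint we.
have M1 : 0 < 2 * (M + 1) by rewrite mulr_gt0// ltr_wpDl.
exists (d0 / (2 * (M + 1))); first by rewrite divr_gt0.
move=> s y Js st yz; apply: (le_trans (hM _ _ _ _ Js Jt)).
apply: (@le_trans _ _ (M * (d0 / (2 * (M + 1)) + d0 / (2 * (M + 1))))).
  by rewrite ler_wpM2l// lerD// ltW.
have -> : M * (d0 / (2 * (M + 1)) + d0 / (2 * (M + 1))) = d0 * (M / (M + 1)).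
  by field; rewrite gt_eqF// ltr_wpDl.
by rewrite ler_piMr// ?(ltW d00)// ler_pdivrMr ?mul1r ?lerDl// ltr_wpDl.
Qed.

Let velocityE t : gvel r p b t = eval velocity t.
Proof. by rewrite gvel_e. Qed.

Let phi_dt t x : J t -> is_derive t (1 : R) (phi ^~ x) (eval velocity t x).
Proof.
move=> Jt; rewrite -velocityE.
exact: (gpath_time_derive hr id_derive diff_group_id wb eta0 delta0 base_ge).
Qed.

Lemma labels_dt t x : J t ->
  is_derive t (1 : R) (labels ^~ x) (- (eval (EB (- r)) t (labels t x) * eval velocity t (labels t x))).
Proof.
move=> Jt; have [d d0 hd] := J_nbhs Jt.
(* The slope bound for [implicit_derive], since phi_x is the r-th power of the base. *)
have c0 : 0 < delta `^ r by rewrite powR_gt0.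
have -> : - (eval (EB (- r)) t (labels t x) * eval velocity t (labels t x)) =
    - (eval velocity t (labels t x) / eval (EB r) t (labels t x)).
  by rewrite /= powRN mulrC.
apply: (@implicit_derive R phi (eval (EB r)) (labels ^~ x) t d (delta `^ r) _ x d0 c0).
- by move=> s y /hd; exact: phi_dx.
- move=> s y /hd Js; apply: ge0_ler_powR; rewrite ?nnegrE ?(ltW r_gt0) ?(ltW delta0)//.
    exact/ltW/B_gt0.
  exact: base_ge.
- move=> e e0; have [d' d'0 h] := @eval_joint_cvg (EB r) t (labels t x) e isT Jt e0.
  exists (Num.min d d'); first by rewrite lt_min d0.
  by move=> s y; rewrite !lt_min => /andP[/hd Js s1] /andP[_ y1]; exact: h.
- exact: phi_dt.
- by move=> s /hd; exact: phi_labels.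
Qed.

Lemma ev_dx e t x : wf e -> J t -> is_derive x (1 : R) (ev e t) (ev (Dx e) t x).
Proof.
move=> we Jt; apply: is_derive1_comp; last exact: labels_dx.
exact: (eval_dx wb wp eta0 delta0 base_ge).
Qed.

Lemma ev_dt e t x : wf e -> J t -> is_derive t (1 : R) (ev e ^~ x) (ev (Dt e) t x).
Proof.
move=> we Jt; have [d d0 hd] := J_nbhs Jt.
apply: (hdw_ball d0).
have It : [set s | `|s - t| < d] t by rewrite /= subrr normr0.
have := @hdw_chain R [set s | `|s - t| < d] (eval e) (eval (dx e)) (labels ^~ x) t
  (eval (dt e) t (labels t x)) _ _ It _ _ (is_derive_hdw _ (labels_dt x Jt)).
have -> : ev (Dt e) t x = eval (dt e) t (labels t x) + eval (dx e) t (labels t x) *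
    - (eval (EB (- r)) t (labels t x) * eval velocity t (labels t x)).
  by rewrite /ev /Dt /=; ring.
apply.
- by move=> s y /hd Js; exact: (eval_dx wb wp eta0 delta0 base_ge).
- move=> e' e'0; have [d' d'0 h] := eval_joint_cvg (labels t x) (wf_dx we) Jt e'0.
  by exists d' => // s y /hd Js; exact: h.
- by apply: is_derive_hdw; exact: (eval_dt wb wp eta0 delta0 base_ge).
Qed.

Lemma labels_dist : exists2 M, 0 <= M & forall t x, J t -> `|labels t x - x| <= M.
Proof.
have Jt0 : J t0 by rewrite /J subrr normr0.
have [_ _ _ _ [M hM]] := phi_diffeo Jt0.
have [N N0 hN] := eval_bd wb wp eta0 delta0 base_ge wf_velocity.
have M0 : 0 <= M by apply: le_trans (hM 0); exact: normr_ge0.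
exists (M + N * eta) => [|t x Jt]; first by rewrite addr_ge0 ?mulr_ge0// ltW.
have -> : labels t x - x = - ((phi t0 (labels t x) - labels t x) + (phi t (labels t x) - phi t0 (labels t x))).
  by rewrite (phi_labels x Jt); ring.
rewrite normrN; apply: (le_trans (ler_normD _ _)); apply: lerD; first exact: hM.
apply: (@le_trans _ _ (N * `|t - t0|)); last by rewrite ler_wpM2l// ltW.
apply: (@hdw_bound R [set u | J u] (phi ^~ (labels t x)) (fun u => eval velocity u (labels t x)) N) => //.
- exact: interval_ball.
- by move=> u Ju; apply: is_derive_hdw; exact: phi_dt.
- by move=> u Ju; exact: hN.
Qed.

(** The shift allowed in [eval_dom] is used here: the label map moves points by a distance bounded
    uniformly near [t0]. *)
Lemma ev_dom e : wf e -> small e -> exists2 K, int1 K &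
  forall t x, J t -> `|ev e t x| <= K x.
Proof.
move=> we se; have [M M0 hM] := labels_dist.
have [K iK hK] := eval_dom wb wp eta0 delta0 base_ge M we se.
by exists K => // t x Jt; apply: hK => //; exact: hM.
Qed.

Lemma ev_int1 e t : wf e -> small e -> J t -> int1 (ev e t).
Proof.
move=> we se Jt; have [K iK hK] := ev_dom we se.
apply: (int1_le _ iK); last by move=> x; exact: hK.
by apply: cont_meas; apply: (is_derive_continuous (fun x => ev_dx x we Jt)).
Qed.

Lemma ev_wfun e t : wf e -> small e -> J t -> wfun (ev e t).
Proof.
move=> we se Jt.
have wi n : wf (iter n Dx e) by elim: n => // n ih; rewrite iterS; exact: wf_Dx.
have si n : small (iter n Dx e) by elim: n => // n ih; rewrite iterS; exact: small_Dx.
apply: (@wfun_dseq _ (fun n => ev (iter n Dx e) t)) => [n x|n].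
  exact: (ev_dx x (wi n) Jt).
exact: ev_int1.
Qed.

Lemma ev_Dx_congr e f t : wf e -> wf f -> J t -> ev e t = ev f t -> ev (Dx e) t = ev (Dx f) t.
Proof.
move=> we wf' Jt E.
rewrite -(is_derive_der (fun x => ev_dx x we Jt)) E.
exact: (is_derive_der (fun x => ev_dx x wf' Jt)).
Qed.

(** Both orders represent the same mixed derivative in the coordinates (t, x). The check reduces
    every power of the base to B^r and B and is then an algebraic identity. *)
Lemma ev_DtDx e t : wf e -> J t -> ev (Dt (Dx e)) t = ev (Dx (Dt e)) t.
Proof.
move=> we Jt; apply/funext => x; rewrite /ev; move: (labels t x) => y.
have E : eval (dt (dx e)) t y = eval (dx (dt e)) t y.
  exact: eval_dtdx Jt.
rewrite /= E.
have B0 := B_gt0 y Jt; set B := 1 + t * b y in B0 *.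
have Bn : B != 0 by rewrite gt_eqF.
have Br : B `^ r != 0 by rewrite gt_eqF// powR_gt0.
rewrite (powRN B r).
have -> : B `^ (r - 1) = B `^ r / B.
  rewrite powRD ?Bn ?implybT// powRN powRr1// ltW//.
have -> : B `^ (- r - 1) = (B `^ r)^-1 / B.
  rewrite powRD ?Bn ?implybT// !powRN powRr1// ltW//.
by field; rewrite Bn Br.
Qed.

Let wf_iter_Dx n e : wf e -> wf (iter n Dx e).
Proof. by move=> we; elim: n => // n ih; rewrite iterS; exact: wf_Dx. Qed.

Let small_iter_Dx n e : small e -> small (iter n Dx e).
Proof. by move=> se; elim: n => // n ih; rewrite iterS; exact: small_Dx. Qed.

Lemma ev_Dt_iter n e t : wf e -> J t -> ev (Dt (iter n Dx e)) t = ev (iter n Dx (Dt e)) t.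
Proof.
move=> we Jt; elim: n => // n ih; rewrite !iterS ev_DtDx//; last exact: wf_iter_Dx.
by apply: ev_Dx_congr => //; [apply: wf_Dt; exact: wf_iter_Dx|apply: wf_iter_Dx; exact: wf_Dt].
Qed.

Lemma ev_derive1n n e t : wf e -> J t -> derive1n n (ev e t) = ev (iter n Dx e) t.
Proof.
move=> we Jt; apply: (@dseq_derive1n R (fun n => ev (iter n Dx e) t)) => k x.
by apply: (ev_dx _ _ Jt); exact: wf_iter_Dx.
Qed.

Let wfDx : wf (Dx velocity). Proof. exact: (wf_Dx wf_velocity). Qed.
Let smallDx : small (Dx velocity). Proof. by rewrite /= ?eqxx ?orbT. Qed.

Lemma eulerian_lie t : J t -> lie_algebra (ev velocity t).
Proof.
move=> Jt; apply/lie_algebraP.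
have d x := ev_dx x wf_velocity Jt.
split=> [x||]; first by apply: ex_derive; exact: d.
  by rewrite (is_derive_der d); exact: ev_wfun.
have [M M0 hM] := labels_dist.
have YN : labels t x @[x --> -oo] --> -oo.
  apply/cvgrNyPle => A; exists (A - M); split; first exact: num_real.
  by move=> x xA; have /ler_normlP[] := hM t x Jt; lra.
have vN : eval velocity t x @[x --> -oo] --> (0 : R).
  rewrite -velocityE; apply: (lie_cvgNy 0).
  exact: (gvel_lie r id_derive diff_group_id wb eta0 delta0 base_ge Jt).
exact: (cvg_comp _ _ YN vN).
Qed.

Lemma eulerian_dx t x : J t -> ev (Dx velocity) t x = r * b (labels t x) / (1 + t * b (labels t x)).
Proof.
move=> Jt; rewrite /ev; move: (labels t x) => y /=.
have B0 := B_gt0 y Jt; set B := 1 + t * b y in B0 *.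
have Bn : B != 0 by rewrite gt_eqF.
have Br : B `^ r != 0 by rewrite gt_eqF// powR_gt0.
rewrite (powRN B r).
have -> : B `^ (r - 1) = B `^ r / B.
  by rewrite powRD ?Bn ?implybT// powRN powRr1// ltW.
by field; rewrite Bn Br.
Qed.

(** This is the Proudman--Johnson equation integrated once in x. At a fixed label, Q = r b / (1 + t
    b) satisfies Q' = - Q^2 / r; the term - u u_xx comes from the motion of the labels. *)
Lemma eulerian_dtdx t x : J t -> ev (Dt (Dx velocity)) t x =
  - (r^-1 * ev (Dx velocity) t x ^+ 2) - ev velocity t x * ev (Dx (Dx velocity)) t x.
Proof.
move=> Jt; have Yx := phi_labels x Jt.
have y_dt : is_derive t (1 : R) (eval (Dx velocity) ^~ (labels t x))
    (- (r^-1 * ev (Dx velocity) t x ^+ 2)).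
  have [d d0 hd] := J_nbhs Jt; apply: (hdw_ball d0).
  have It : [set s | `|s - t| < d] t by rewrite /= subrr normr0.
  have B0 := B_gt0 (labels t x) Jt; rewrite eulerian_dx//.
  set y := labels t x in B0 *.
  have dB : is_derive t (1 : R) (fun s => r * b y * (1 + s * b y)^-1)
      (- (r^-1 * (r * b y / (1 + t * b y)) ^+ 2)).
    have d1 : is_derive t (1 : R) (fun s => 1 + s * b y) (b y).
      have := is_deriveD (is_derive_cst (1 : R) t (1 : R))
        (is_deriveM (is_derive_id t (1 : R)) (is_derive_cst (b y) t (1 : R))).
      by move/is_derive_eq; apply; rewrite /= /GRing.scale/=; ring.
    have := is_deriveZ (r * b y) (@is_deriveV R (fun s => 1 + s * b y) t (b y) 1 (lt0r_neq0 B0) d1).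
    move/is_derive_eq; apply; rewrite /GRing.scale/=; field.
    by rewrite r_neq0 gt_eqF.
  apply: (hdw_eq It _ (is_derive_hdw _ dB)) => s /hd Js.
  have := eulerian_dx (phi s y) Js; rewrite /ev /labels (inverseKV (phi_diffeo Js)).
  by move=> h; exact: esym h.
have y_dt' := eval_dt wb wp eta0 delta0 base_ge (labels t x) wfDx Jt.
have E : eval (dt (Dx velocity)) t (labels t x) = - (r^-1 * ev (Dx velocity) t x ^+ 2).
  by rewrite -[RHS](@derive_val _ _ _ _ _ _ _ y_dt) (@derive_val _ _ _ _ _ _ _ y_dt').
rewrite -E /ev; move: (Dx velocity) (labels t x) => D y.
have -> : eval (Dt D) t y = eval (dt D) t y +
  -1 * (eval (dx D) t y * eval (EB (- r)) t y * eval velocity t y) by [].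
have -> : eval (Dx D) t y = eval (dx D) t y * eval (EB (- r)) t y by [].
by ring.
Qed.

(** The candidate for u_t, formed as the primitive of u_tx from -oo, which places it in the algebra
    at once. *)
Definition eulerian_acc t := prim (ev (Dt (Dx velocity)) t).

Let small_acc : small (Dt (Dx velocity)). Proof. exact: small_Dt. Qed.
Let wf_acc : wf (Dt (Dx velocity)). Proof. exact: wf_Dt. Qed.

Let acc_dx t x : J t -> is_derive x (1 : R) (eulerian_acc t) (ev (Dt (Dx velocity)) t x).
Proof.
move=> Jt; apply: prim_derive; last exact: ev_int1.
exact: (is_derive_continuous (fun x => ev_dx x wf_acc Jt)).
Qed.

Lemma eulerian_acc_lie t : J t -> lie_algebra (eulerian_acc t).
Proof. by move=> Jt; apply: lie_prim; exact: ev_wfun. Qed.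

Lemma eulerian_C1 I :
  frechet_cvg (within I t0^') (fun s x => (ev velocity s x - ev velocity t0 x) / (s - t0))
    (eulerian_acc t0) /\
  frechet_cvg (within I (nbhs t0)) eulerian_acc (eulerian_acc t0).
Proof.
have domK n : {K | int1 K & forall t x, J t ->
    `|ev (Dt (iter n Dx (Dt (Dx velocity)))) t x| <= K x}.
  apply: cid2; apply: ev_dom; [apply: wf_Dt|apply: small_Dt].
    exact: wf_iter_Dx.
  exact: small_iter_Dx.
apply: (@C1_criterion R I (ev velocity) eulerian_acc t0 eta
  (fun n => ev (iter n Dx (Dx velocity))) (fun n => ev (iter n Dx (Dt (Dx velocity))))
  (fun n => ev (Dt (iter n Dx (Dt (Dx velocity))))) (fun n => s2val (domK n)) eta0).
- by move=> s x Js; exact: ev_dx.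
- by move=> s x Js; exact: acc_dx.
- by move=> n s x Js; apply: (ev_dx _ _ Js); exact: wf_iter_Dx.
- by move=> n s x Js; apply: (ev_dx _ _ Js); exact: wf_iter_Dx.
- move=> n s x Js; rewrite -(ev_Dt_iter n wfDx Js).
  by apply: (ev_dt _ _ Js); exact: wf_iter_Dx.
- by move=> n s x Js; apply: (ev_dt _ _ Js); exact: wf_iter_Dx.
- by move=> n; exact: (s2valP (domK n)).
- by move=> n s x Js; exact: (s2valP' (domK n)).
Qed.

Lemma eulerian_PJ t x : J t ->
  derive1n 2 (eulerian_acc t) x + (1 + 2 * r^-1) * (ev velocity t)^`()%classic x *
    derive1n 2 (ev velocity t) x + ev velocity t x * derive1n 3 (ev velocity t) x = 0.
Proof.
move=> Jt; have wv := wf_velocity.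
have d0 y := ev_dx y wv Jt; have d1 y := ev_dx y wfDx Jt.
have d2 y := ev_dx y (wf_Dx wfDx) Jt.
rewrite !ev_derive1n// derive1nS derive1n1 (is_derive_der (fun y => acc_dx y Jt)) (is_derive_der d0).
have E : ev (Dt (Dx velocity)) t = (fun x => - (r^-1 * ev (Dx velocity) t x ^+ 2) -
    ev velocity t x * ev (Dx (Dx velocity)) t x).
  by apply/funext => y; exact: eulerian_dtdx.
rewrite E.
have d y : is_derive y (1 : R) (fun x => - (r^-1 * ev (Dx velocity) t x ^+ 2) -
    ev velocity t x * ev (Dx (Dx velocity)) t x)
    (- (r^-1 * (ev (Dx velocity) t y * ev (Dx (Dx velocity)) t y *+ 2)) -
     (ev velocity t y * ev (Dx (Dx (Dx velocity))) t y + ev (Dx (Dx velocity)) t y * ev (Dx velocity) t y)).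
  apply: is_deriveB.
rewrite (is_derive_der d) /=.
set A := ev (Dx velocity) t x; set C := ev (Dx (Dx velocity)) t x.
by rewrite mulr2n; ring.
Qed.

End AtTime.
End Eulerian.

(** * The distributional Hunter--Saxton flux *)

Section Flux.
Context {R : realType}.
Variable r : R.
Hypothesis hr : 1 < r.
Implicit Types (t s x y z : R) (u chi f : R -> R).

Local Notation mu := (@lebesgue_measure R).
Local Notation sp := (signed_power r).

Let r_gt0 : 0 < r. Proof. by apply: lt_trans hr. Qed.
Let rm1_gt0 : 0 < r - 1. Proof. by rewrite subr_gt0. Qed.
Let r_neq0 : r != 0. Proof. by rewrite gt_eqF. Qed.

Lemma cont_sp f x : {for x, continuous f} -> {for x, continuous (fun y => sp (f y))}.
Proof.
move=> cf; have [f0|f0] := eqVneq (f x) 0.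
  have := cont_abs_powR rm1_gt0 cf.
  rewrite /prop_for /continuous_at f0 normr0 powR0 ?gt_eqF// sp0.
  move=> /cvgrPdist_le h; apply/cvgrPdist_le => e /h; apply: filterS => y.
  by rewrite !sub0r !normrN (sp_norm hr) ger0_norm ?powR_ge0.
have h : {for `|f x|, continuous (fun z => z `^ (r - 2))}.
  by apply: is_derive_cont; apply: is_derive1_powR; rewrite normr_gt0.
exact: (cvgM cf (cvg_comp _ _ (cvg_norm cf) h)).
Qed.

Lemma abs_powR_derive z : is_derive z (1 : R) (fun z => `|z| `^ r) (r * sp z).
Proof.
have rE : r - 1 = r - 2 + 1 by ring.
have [->|z0] := eqVneq z 0.
  rewrite sp0 mulr0; apply/is_derive_hdwT/hdwP => e e0.
  (* Within this radius |s|^(r-1) is at most [e], which is differentiability at 0 with slope 0. *)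
  have re0 : 0 < e `^ (r - 1)^-1 by rewrite powR_gt0.
  exists (e `^ (r - 1)^-1) => // s _; rewrite !subr0 normr0 powR0// subr0 mul0r subr0 => se.
  rewrite ger0_norm ?powR_ge0// -mulr_powRB1// mulrC ler_wpM2r//.
  rewrite -[leRHS](@powR_divr _ _ (r - 1)^-1)// ?invr_neq0 ?gt_eqF// invrK.
  by apply: ge0_ler_powR; rewrite ?nnegrE ?powR_ge0 ?(ltW rm1_gt0)// ltW.
have az : 0 < `|z| by rewrite normr_gt0.
have h : is_derive z (1 : R) (fun z => `|z|) (z / `|z|).
  apply/is_derive_hdwT/hdwP => e e0; exists `|z| => // s _ sz.
  have -> : `|s| - `|z| - z / `|z| * (s - z) = 0; last by rewrite normr0 mulr_ge0// ltW.
  move: z0 sz az; have [zp|zn|->] := ltrgt0P z; rewrite ?eqxx// => _ sz _.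
    have sp' : 0 < s by move: sz; rewrite ltr_norml => /andP[]; lra.
    by rewrite gtr0_norm// mulfV ?gt_eqF// mul1r subrr.
  have sn : s < 0 by move: sz; rewrite ltr_norml => /andP[]; lra.
  by rewrite ltr0_norm// invrN mulrN mulfV ?lt_eqF//; ring.
have := @is_derive1_comp R (fun w => w `^ r) (fun z => `|z|) z _ _ (is_derive1_powR r az) h.
move/is_derive_eq; apply; rewrite /signed_power rE powRD ?powRr1//; last by rewrite (gt_eqF az) implybT.
by field; rewrite gt_eqF.
Qed.

(* As (|u_x|^r)_x = r m u_xx, the second derivative of u can be integrated away
   without ever differentiating m. *)
Lemma HS_flux u chi (m := fun x => sp (u^`()%classic x)) :
  lie_algebra u -> test_function chi ->
  dx_pairing m (u^`()%classic \* chi) - dx_pairing m (u \* chi^`()%classic) =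
  \int[mu]_x (r^-1 * `|u^`()%classic x| `^ r * chi^`()%classic x +
     m x * u x * derive1n 2 chi x).
Proof.
have aux (a b c d : R) : a + b = 0 -> - (a + c) - - (c + d) = b + d.
  by move/eqP; rewrite addrC addr_eq0 => /eqP ->; ring.
move=> lu tc; have sc := tc.1.
have [A A0 hA] := test_functionE tc.
have du x : is_derive x (1 : R) u (u^`()%classic x) by exact: (lie_derive 0 x lu).
have du1 x : is_derive x (1 : R) u^`()%classic (derive1n 2 u x) by exact: (lie_derive 1 x lu).
have dc x : is_derive x (1 : R) chi (chi^`()%classic x) by exact: (smooth_dseq sc 0 x).
have dc1 x : is_derive x (1 : R) chi^`()%classic (derive1n 2 chi x) by exact: (smooth_dseq sc 1 x).
have cu : continuous u by exact: (@lie_cont _ _ 0 lu).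
have cu1 : continuous u^`()%classic by exact: (@lie_cont _ _ 1 lu).
have cu2 : continuous (derive1n 2 u) by exact: (@lie_cont _ _ 2 lu).
have cm : continuous m by move=> x; exact: cont_sp (cu1 x).
have cc n : continuous (derive1n n chi) by exact: smooth_cont.
have int_of f n : continuous f -> int1 (fun x => f x * derive1n n chi x).
  move=> cf; apply: (@int1_supported _ _ A).
    by move=> x; apply: cvgM; [exact: cf|exact: cc].
  by move=> x xA; rewrite hA// mulr0.
have iA : int1 (fun x => m x * derive1n 2 u x * chi x).
  by apply: (int_of _ 0) => x; apply: cvgM; [exact: cm|exact: cu2].
have iB : int1 (fun x => m x * u^`()%classic x * chi^`()%classic x).
  by have := int_of (fun x => m x * u^`()%classic x) 1 _; rewrite derive1n1; apply => x;
     apply: cvgM; [exact: cm|exact: cu1].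
have iC : int1 (fun x => m x * u x * derive1n 2 chi x).
  by apply: (int_of _ 2) => x; apply: cvgM; [exact: cm|exact: cu].
have cp : continuous (fun x => `|u^`()%classic x| `^ r).
  by move=> x; exact: (cont_abs_powR r_gt0 (cu1 x)).
have iD : int1 (fun x => r^-1 * `|u^`()%classic x| `^ r * chi^`()%classic x).
  have := int_of (fun x => r^-1 * `|u^`()%classic x| `^ r) 1 _; rewrite derive1n1; apply => x.
  by apply: cvgM; [exact: cvg_cst|exact: cp].
have iF : int1 (fun x => r^-1 * `|u^`()%classic x| `^ r * chi x).
  by apply: (int_of _ 0) => x; apply: cvgM; [exact: cvg_cst|exact: cp].
have E1 : dx_pairing m (u^`()%classic \* chi) =
    - \int[mu]_x (m x * derive1n 2 u x * chi x + m x * u^`()%classic x * chi^`()%classic x).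
  have d x : is_derive x (1 : R) (u^`()%classic \* chi)
      (derive1n 2 u x * chi x + u^`()%classic x * chi^`()%classic x).
    have := is_deriveM (du1 x) (dc x); move/is_derive_eq; apply.
    by rewrite /GRing.scale/=; ring.
  rewrite /dx_pairing (is_derive_der d); congr (- _); apply: eq_Rintegral => x _; ring.
have E2 : dx_pairing m (u \* chi^`()%classic) =
    - \int[mu]_x (m x * u^`()%classic x * chi^`()%classic x + m x * u x * derive1n 2 chi x).
  have d x : is_derive x (1 : R) (u \* chi^`()%classic)
      (u^`()%classic x * chi^`()%classic x + u x * derive1n 2 chi x).
    have := is_deriveM (du x) (dc1 x); move/is_derive_eq; apply.
    by rewrite /GRing.scale/=; ring.
  rewrite /dx_pairing (is_derive_der d); congr (- _); apply: eq_Rintegral => x _; ring.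
have E3 : \int[mu]_x (m x * derive1n 2 u x * chi x + r^-1 * `|u^`()%classic x| `^ r * chi^`()%classic x) = 0.
  apply: (@int1_deriv0 _ (fun x => r^-1 * `|u^`()%classic x| `^ r * chi x)) => //.
  - move=> x; apply: cvgD; apply: cvgM.
    + by apply: cvgM; [exact: cm|exact: cu2].
    + exact: (cc 0).
    + by apply: cvgM; [exact: cvg_cst|exact: cp].
    + by have := cc 1%N x; rewrite derive1n1.
  - exact: int1D.
  - move=> x; have h1 := is_derive1_comp (abs_powR_derive (u^`()%classic x)) (du1 x).
    have h2 : is_derive x (1 : R) (fun x => r^-1 * `|u^`()%classic x| `^ r)
        (sp (u^`()%classic x) * derive1n 2 u x).
      have := is_deriveZ r^-1 h1; move/is_derive_eq; apply.
      by rewrite /GRing.scale/=; field.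
    have := is_deriveM h2 (dc x); move/is_derive_eq; apply.
    by rewrite /GRing.scale/= /m; ring.
rewrite E1 E2 !RintD//; move: E3; rewrite RintD//; exact: aux.
Qed.

End Flux.

(** * The explicit solution satisfies the Hunter--Saxton equation *)

Section EulerianHS.
Context {R : realType}.
Variable r : R.
Hypothesis hr : 1 < r.
Variable b : R -> R.
Hypothesis wb : wfun b.
Variables (t0 eta delta : R).
Hypothesis eta0 : 0 < eta.
Hypothesis delta0 : 0 < delta.
Hypothesis base_ge : forall t x, `|t - t0| < eta -> delta <= 1 + t * b x.
Implicit Types (t s x y z : R) (chi : R -> R).

Local Notation mu := (@lebesgue_measure R).
Local Notation sp := (signed_power r).
Local Notation p := (fun=> 1 : R).
Local Notation phi := (gpath r id p b).
Local Notation V := (eval p b (velocity r)).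
Local Notation u := (ev r b (velocity r)).

Let J t := `|t - t0| < eta.
Let r_gt0 : 0 < r. Proof. by apply: lt_trans hr. Qed.
Let rm1_gt0 : 0 < r - 1. Proof. by rewrite subr_gt0. Qed.
Let r_neq0 : r != 0. Proof. by rewrite gt_eqF. Qed.

Let B_gt0 t x : J t -> 0 < 1 + t * b x.
Proof. by move=> Jt; apply: lt_le_trans delta0 _; exact: base_ge. Qed.

Let phi_dx t x : J t -> is_derive x (1 : R) (phi t) ((1 + t * b x) `^ r).
Proof.
move=> Jt; have := gpath_derive hr id_derive diff_group_id wb eta0 delta0 base_ge x Jt.
by rewrite mul1r.
Qed.

Let phi_diffeo t : J t -> diffeo (phi t) (fun x => (1 + t * b x) `^ r).
Proof.
move=> Jt; rewrite -(is_derive_der (fun x => phi_dx x Jt)); apply: diff_group_diffeo.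
exact: (eulerian_group hr wb eta0 delta0 base_ge Jt).
Qed.

Let phi_dt t x : J t -> is_derive t (1 : R) (phi ^~ x) (V t x).
Proof.
move=> Jt; have := gpath_time_derive hr id_derive diff_group_id wb eta0 delta0 base_ge x Jt.
by rewrite gvel_e.
Qed.

Let u_phi t y : J t -> u t (phi t y) = V t y.
Proof. by move=> Jt; rewrite /ev /labels (inverseKV (phi_diffeo Jt)). Qed.

Let lu t : J t -> lie_algebra (u t).
Proof. by move=> Jt; exact: (eulerian_lie hr wb eta0 delta0 base_ge Jt). Qed.

Let u_dx t y : J t -> (u t)^`()%classic (phi t y) = r * b y / (1 + t * b y).
Proof.
move=> Jt; rewrite (is_derive_der (fun x => ev_dx hr wb eta0 delta0 base_ge x (wf_velocity r) Jt)).
by rewrite (eulerian_dx r delta0 base_ge)// /labels (inverseKV (phi_diffeo Jt)).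
Qed.

Let c y := sp (r * b y).

(** In labels m dx becomes c (1 + t b) dy, because the exponents 1 - r and r add up to 1. The
    density is affine in time, so pairings can be differentiated even where u_x vanishes. *)
Let m_phi t y : J t -> sp ((u t)^`()%classic (phi t y)) * (1 + t * b y) `^ r = c y * (1 + t * b y).
Proof.
move=> Jt; have B0 := B_gt0 y Jt.
have Bi : 0 < (1 + t * b y)^-1 by rewrite invr_gt0.
rewrite u_dx// (sp_homog hr _ Bi) -mulrA -/(c y); congr (_ * _).
rewrite -powR_inv1 ?(ltW B0)// -powRrM -powRD; last by rewrite (gt_eqF B0) implybT.
have -> : -1 * (r - 1) + r = 1 by ring.
by rewrite powRr1// ltW.
Qed.

Let m_cont t : J t -> continuous (fun x => sp ((u t)^`()%classic x)).
Proof. by move=> Jt x; exact: (cont_sp hr (@lie_cont _ _ 1 (lu Jt) x)). Qed.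

Let pairing t chi : J t -> test_function chi ->
  dx_pairing (fun x => sp ((u t)^`()%classic x)) chi =
  - \int[mu]_y (c y * (1 + t * b y) * chi^`()%classic (phi t y)).
Proof.
move=> Jt tc; have [A A0 hA] := test_functionE tc.
rewrite /dx_pairing; apply: (congr1 -%R).
have cc : continuous chi^`()%classic by exact: (@smooth_cont _ _ 1 tc.1).
have cf : continuous (fun x => sp ((u t)^`()%classic x) * chi^`()%classic x).
  by move=> x; apply: cvgM; [exact: m_cont|exact: cc].
rewrite (Rint_diffeo (phi_diffeo Jt) cf).
  by apply: eq_Rintegral => y _; rewrite mulrAC m_phi.
apply: (int1_supported cf (A := A)) => x xA.
by have := hA 1%N x xA; rewrite derive1n1 => ->; rewrite mulr0.
Qed.

Let f chi t y := c y * (1 + t * b y) * chi^`()%classic (phi t y).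
Let f' chi t y := c y * b y * chi^`()%classic (phi t y) +
  c y * (1 + t * b y) * V t y * derive1n 2 chi (phi t y).

Let c_cont : continuous c.
Proof.
have cb : continuous (fun y => r * b y).
  by move=> y; apply: cvgM; [exact: cvg_cst|exact: (@wfun_cont _ _ 0 wb)].
by move=> y; exact: (cont_sp hr (cb y)).
Qed.

Let phi_near : exists2 M, 0 <= M & forall t y, J t -> `|phi t y - y| <= M.
Proof.
have [M M0 hM] := labels_dist hr wb eta0 delta0 base_ge.
exists M => // t y Jt; have := hM t (phi t y) Jt.
by rewrite /labels (inverseKV (phi_diffeo Jt)) distrC.
Qed.

Let f_cont chi t : test_function chi -> J t -> continuous (f chi t).
Proof.
move=> tc Jt y; apply: cvgM.
  apply: cvgM; first exact: c_cont.
  apply: cvgD; first exact: cvg_cst.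
  by apply: cvgM; [exact: cvg_cst|exact: (@wfun_cont _ _ 0 wb)].
have cp : continuous (phi t) by exact: (diffeo_cont (phi_diffeo Jt)).
exact: (cvg_comp _ _ (cp y) (@smooth_cont _ _ 1 tc.1 _)).
Qed.

(** Displacements are bounded uniformly in time near [t0], so one compact interval of labels
    contains the supports of all the pulled-back test functions. *)
Let supported_out chi : test_function chi ->
  exists2 A, 0 < A & forall t y n, J t -> y < - A \/ A < y -> derive1n n chi (phi t y) = 0.
Proof.
move=> tc; have [A A0 hA] := test_functionE tc; have [M M0 hM] := phi_near.
exists (A + M) => [|t y n Jt yA]; first by rewrite ltr_wpDr.
apply: hA; have := hM t y Jt => /ler_normlP[h1 h2].
by case: yA => ?; [left|right]; lra.
Qed.

Let f_int chi t : test_function chi -> J t -> int1 (f chi t).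
Proof.
move=> tc Jt; have [A A0 hA] := supported_out tc.
apply: (int1_supported (f_cont tc Jt) (A := A)) => y yA.
by have := hA t y 1%N Jt yA; rewrite derive1n1 /f => ->; rewrite mulr0.
Qed.

Let f_dt chi t y : test_function chi -> J t -> is_derive t (1 : R) (f chi ^~ y) (f' chi t y).
Proof.
move=> tc Jt.
have d1 : is_derive t (1 : R) (fun s => c y * (1 + s * b y)) (c y * b y).
  have d0 : is_derive t (1 : R) (fun s => 1 + s * b y) (b y).
    have := is_deriveD (is_derive_cst (1 : R) t (1 : R))
      (is_deriveM (is_derive_id t (1 : R)) (is_derive_cst (b y) t (1 : R))).
    by move/is_derive_eq; apply; rewrite /= /GRing.scale/=; ring.
  by have := is_deriveZ (c y) d0.
have dc : is_derive (phi t y) (1 : R) chi^`()%classic (derive1n 2 chi (phi t y)).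
  exact: (smooth_dseq tc.1 1).
have d2 := @is_derive1_comp R chi^`()%classic (phi ^~ y) t _ _ dc (phi_dt y Jt).
have := is_deriveM d1 d2; move/is_derive_eq; apply.
by rewrite /f' /GRing.scale/=; ring.
Qed.

Let f'_dom chi : test_function chi -> exists2 K, int1 K &
  forall t y, J t -> `|f' chi t y| <= K y.
Proof.
move=> tc; have [A A0 hA] := supported_out tc.
have [C1 C10 h1] := test_bounded 1 tc; have [C2 C20 h2] := test_bounded 2 tc.
have wp := (initial_p (@id_derive R) diff_group_id).1.
have [N N0 hN] := eval_bd wb wp eta0 delta0 base_ge (wf_velocity r).
have [P P0 hP] := base_le wb t0 eta0.
pose Kb : R := \int[mu]_y `|derive1n 1 b y|.
have hb y : `|b y| <= Kb by exact: (wfun_sup 0 y wb).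
have Kb0 : 0 <= Kb by apply: le_trans (hb 0).
pose Cc := (r * Kb) `^ (r - 1).
have hc y : `|c y| <= Cc.
  rewrite /c (sp_norm hr); apply: ge0_ler_powR; rewrite ?nnegrE ?(ltW rm1_gt0)//.
    by rewrite mulr_ge0// ltW.
  by rewrite normrM (gtr0_norm r_gt0) ler_wpM2l// ltW.
pose C := Cc * Kb * C1 + Cc * P * N * C2.
have C0 : 0 <= C by rewrite addr_ge0// !mulr_ge0// ?powR_ge0.
exists (fun y => C * \1_`[- A, A] y); first by apply: int1Z; exact: int1_indic.
move=> t y Jt; rewrite indicE; have [yI|yA] := boolP (y \in `[- A, A]%classic); last first.
  have yo : y < - A \/ A < y.
    move: yA; rewrite mem_setE in_itv/= negb_and -!ltNge => /orP[]; by [left|right].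
  have := hA t y 1%N Jt yo; rewrite derive1n1 => h.
  by rewrite /f' h (hA t y 2%N Jt yo) !mulr0 addr0 normr0.
rewrite mulr1 /f'; apply: (le_trans (ler_normD _ _)); apply: lerD.
  rewrite (normrM (c y * b y)) (normrM (c y)).
  have h1' : `|chi^`()%classic (phi t y)| <= C1 by have := h1 (phi t y); rewrite derive1n1.
  have h := ler_pM (normr_ge0 _) (normr_ge0 _) (hc y) (hb y).
  exact: (ler_pM (mulr_ge0 (normr_ge0 _) (normr_ge0 _)) (normr_ge0 _) h h1').
rewrite (normrM (c y * (1 + t * b y) * V t y)) (normrM (c y * (1 + t * b y))) (normrM (c y)).
have hB : `|1 + t * b y| <= P by rewrite gtr0_norm ?B_gt0// hP.
have e1 := ler_pM (normr_ge0 _) (normr_ge0 _) (hc y) hB.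
have e2 := ler_pM (mulr_ge0 (normr_ge0 _) (normr_ge0 _)) (normr_ge0 _) e1 (hN t y Jt).
apply: (ler_pM _ (normr_ge0 _) e2 (h2 _)).
by rewrite !mulr_ge0.
Qed.

Lemma eulerian_HS chi t (m := fun t x => sp ((u t)^`()%classic x)) :
  test_function chi -> J t ->
  is_derive t (1 : R) (fun s => dx_pairing (m s) chi)
    (- (dx_pairing (m t) ((u t)^`()%classic \* chi) - dx_pairing (m t) (u t \* chi^`()%classic))).
Proof.
move=> tc Jt; have [d d0 hd] := J_nbhs Jt.
rewrite (HS_flux hr (lu Jt) tc).
have [K iK hK] := f'_dom tc.
have := @integral_time_derive R setT (f chi) (f' chi) K t d measurableT d0.
move=> /(_ (fun s h => f_int tc (hd s h)) (fun s y h => f_dt y tc (hd s h)) iK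
  (fun s y h => hK s y (hd s h))) D.
have tI : [set s | `|s - t| < d] t by rewrite /= subrr normr0.
apply: (hdw_ball d0).
have -> : \int[mu]_x (r^-1 * `|(u t)^`()%classic x| `^ r * chi^`()%classic x +
     sp ((u t)^`()%classic x) * u t x * derive1n 2 chi x) = \int[mu]_y f' chi t y.
  have cu1 : continuous (u t)^`()%classic by exact: (@lie_cont _ _ 1 (lu Jt)).
  have cF : continuous (fun x => r^-1 * `|(u t)^`()%classic x| `^ r * chi^`()%classic x +
     sp ((u t)^`()%classic x) * u t x * derive1n 2 chi x).
    move=> x; apply: cvgD; apply: cvgM.
    - by apply: cvgM; [exact: cvg_cst|exact: (cont_abs_powR r_gt0 (cu1 x))].
    - exact: (@smooth_cont _ _ 1 tc.1).
    - by apply: cvgM; [exact: m_cont|exact: (@lie_cont _ _ 0 (lu Jt))].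
    - exact: (@smooth_cont _ _ 2 tc.1).
  have [A A0 hA] := test_functionE tc.
  have iF := int1_supported cF (A := A).
  apply: (eq_trans (Rint_diffeo (phi_diffeo Jt) cF (iF _))) => [x xA|].
    by have := hA 1%N x xA; rewrite derive1n1 => ->; rewrite hA// !mulr0 addr0.
  apply: eq_Rintegral => y _; rewrite /f' mulrDl; congr (_ + _).
    rewrite -(sp_mulr hr).
    have -> : forall m' u' chi' B : R, r^-1 * (m' * u') * chi' * B = r^-1 * (m' * B) * u' * chi'.
      by move=> *; ring.
    rewrite m_phi// u_dx//; field; rewrite r_neq0 gt_eqF//; exact: B_gt0.
  have -> : forall m' u' chi' B : R, m' * u' * chi' * B = (m' * B) * u' * chi'.
    by move=> *; ring.
  by rewrite m_phi// u_phi.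
apply: (hdw_eq tI _ (hdwN (is_derive_hdw _ D))) => s /hd Js.
by rewrite /m pairing.
Qed.

End EulerianHS.

Section EulerianSolution.
Context {R : realType}.
Variable r : R.
Hypothesis hr : 1 < r.
Variable u0 : R -> R.
Hypothesis hu0 : lie_algebra u0.
Implicit Types (t s x y z : R) (I : set R).

Local Notation b := (slope r u0).
Local Notation phi := (explicit_path r u0).
Local Notation u := (ev r b (velocity r)).

Definition eulerian t := time_derivative phi t \o inverse (phi t).

Let wb : wfun b := slope_wfun r hu0.

Lemma eulerianE t : (forall x, 0 < 1 + t * b x) -> eulerian t = u t.
Proof.
move=> B0; apply/funext => x.
rewrite /eulerian /time_derivative explicit_pathE /= derive1E.
have h := gpath_dt hr (@id_derive R) diff_group_id wb (inverse (gpath r id (fun=> 1) b t) x) B0.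
by rewrite (@derive_val _ _ _ _ _ _ _ h) gvel_e.
Qed.

Lemma eulerian_lie_path I : base_pos b I -> lie_algebra_path I u (eulerian_acc r b).
Proof.
move=> B0; have near t : I t -> exists delta eta : R, [/\ 0 < delta, 0 < eta &
    forall s x, `|s - t| < eta -> delta <= 1 + s * b x].
  by move=> It; apply: base_nbhs => // x; exact: B0.
have tt t eta : 0 < eta -> `|t - t| < eta by rewrite subrr normr0.
split; first by move=> t /near[d [eta [d0 e0 h]]]; exact: (eulerian_lie hr wb e0 d0 h (tt _ _ e0)).
split=> t /near[d [eta [d0 e0 h]]].
- exact: (eulerian_acc_lie hr wb e0 d0 h (tt _ _ e0)).
- exact: (eulerian_C1 hr wb e0 d0 h I).1.
- exact: (eulerian_C1 hr wb e0 d0 h I).2.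
Qed.

Lemma eulerian_at0 : u 0 = u0.
Proof.
have B0 x : 0 < 1 + 0 * b x by rewrite mul0r addr0.
rewrite -eulerianE//; apply/funext => x; rewrite /eulerian /time_derivative explicit_pathE /= derive1E.
have h := gpath_dt hr (@id_derive R) diff_group_id wb (inverse (gpath r id (fun=> 1) b 0) x) B0.
rewrite (@derive_val _ _ _ _ _ _ _ h) (gvel0 hr (@id_derive R) diff_group_id wb hu0)//=.
rewrite gpath0; congr (u0 _).
have /inverseK/(_ x) := diff_group_diffeo (@diff_group_id R).
by [].
Qed.

Lemma lie_algebra_path_eq I (v w vt : R -> R -> R) : (forall t, I t -> w t = v t) ->
  lie_algebra_path I v vt -> lie_algebra_path I w vt.
Proof.
move=> E [lv C]; split; first by move=> t It; rewrite E//; exact: lv.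
by apply: (C1_curve_eq _ _ C) => // t It; rewrite E.
Qed.

Lemma eulerian_PJ_solution I v : is_interval I -> I 0 ->
  (forall t, I t -> diff_group (phi t) /\ v t = eulerian t) -> PJ_solution r^-1 I u0 v.
Proof.
move=> Ii I0 h; have B0 := diff_group_base hr hu0 Ii I0 (fun t It => (h t It).1).
have E t : I t -> v t = u t by move=> It; rewrite (h t It).2 eulerianE// => x; exact: B0.
exists (eulerian_acc r b); split.
- exact: lie_algebra_path_eq E (eulerian_lie_path B0).
- move=> t x It; rewrite E//.
  have [d [eta [d0 e0 hd]]] := base_nbhs wb (fun x => B0 t x It).
  by apply: (eulerian_PJ hr wb e0 d0 hd); rewrite subrr normr0.
- by rewrite E// eulerian_at0.
Qed.

Lemma eulerian_HS_solution I v : is_interval I -> I 0 ->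
  (forall t, I t -> diff_group (phi t) /\ v t = eulerian t) -> HS_solution r I u0 v.
Proof.
move=> Ii I0 h; have B0 := diff_group_base hr hu0 Ii I0 (fun t It => (h t It).1).
have E t : I t -> v t = u t by move=> It; rewrite (h t It).2 eulerianE// => x; exact: B0.
exists (eulerian_acc r b); split.
- exact: lie_algebra_path_eq E (eulerian_lie_path B0).
- move=> t chi It tc; rewrite (E t It).
  have [d [eta [d0 e0 hd]]] := base_nbhs wb (fun x => B0 t x It).
  have D := eulerian_HS hr wb e0 d0 hd tc (ltac:(by rewrite subrr normr0) : `|t - t| < eta).
  apply: (ex_intro2 _ _ _ (hdw_eq It _ (is_derive_hdw I D))) => [s Is|].
    by rewrite (E s Is).
  by rewrite -addrA addNr.
- by rewrite E// eulerian_at0.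
Qed.

End EulerianSolution.

(** * Flows and uniqueness *)

Section Flow.
Context {R : realType}.
Implicit Types (A B s t x y L M K a : R).

Lemma is_derive_reflect (D : R -> R) d t : is_derive (- t) (1 : R) D d ->
  is_derive t (1 : R) (fun s => D (- s)) (- d).
Proof.
move=> h.
have h2 : is_derive t (1 : R) -%R (-1 : R) by apply: is_deriveN.
have := @is_derive1_comp R D -%R t _ _ h h2.
by move/is_derive_eq; apply; rewrite mulrN1.
Qed.

Lemma deriv_le_compare (D D' g g' : R -> R) t : 0 <= t ->
  (forall s, is_derive s (1 : R) D (D' s)) -> (forall s, is_derive s (1 : R) g (g' s)) ->
  (forall s, 0 <= s -> `|D' s| <= g' s) -> `|D t - D 0| <= g t - g 0.
Proof.
rewrite le_eqVlt => /predU1P[<-|t0] dD dg h; first by rewrite !subrr normr0.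
have [s1 /andP[s10 _] E1] := hdw_mvt t0 (fun s _ => is_derive_hdw `[0, t]%classic (is_deriveB (dg s) (dD s))).
have [s2 /andP[s20 _] E2] := hdw_mvt t0 (fun s _ => is_derive_hdw `[0, t]%classic (is_deriveD (dg s) (dD s))).
have /ler_normlP[a1 a2] := h s1 (ltW s10); have /ler_normlP[b1 b2] := h s2 (ltW s20).
move: E1 E2; rewrite !fctE => E1 E2.
apply/ler_normlP; split.
  have : 0 <= (g' s2 + D' s2) * (t - 0) by rewrite mulr_ge0//; lra.
  by rewrite -E2; lra.
have : 0 <= (g' s1 - D' s1) * (t - 0) by rewrite mulr_ge0//; lra.
by rewrite -E1; lra.
Qed.

Lemma expR_affine_derive a t : is_derive t (1 : R) (fun s => expR (a * s)) (a * expR (a * t)).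
Proof.
have d1 : is_derive t (1 : R) (fun s => a * s) a.
  by rewrite -[X in is_derive _ _ _ X]mulr1; apply: is_deriveZ.
have := @is_derive1_comp R expR (fun s => a * s) t _ _ (is_derive_expR _) d1.
by move/is_derive_eq; apply; rewrite mulrC.
Qed.

(** In the weight e^(a|t|), integration in time gains a factor 1/a. This makes Picard iteration
    converge globally in time. *)
Lemma exp_bound_pos (D D' : R -> R) K a t : 0 < a -> 0 <= t -> D 0 = 0 ->
  (forall s, is_derive s (1 : R) D (D' s)) -> (forall s, `|D' s| <= K * expR (a * `|s|)) ->
  `|D t| <= K / a * expR (a * `|t|).
Proof.
move=> a0 t0 D0 dD hD.
have K0 : 0 <= K.
  by have := le_trans (normr_ge0 _) (hD 0); rewrite normr0 mulr0 expR0 mulr1.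
have dg s : is_derive s (1 : R) (fun s => K / a * expR (a * s)) (K * expR (a * s)).
  have := is_deriveZ (K / a) (expR_affine_derive a s); move/is_derive_eq; apply.
  by rewrite /GRing.scale/=; field; rewrite gt_eqF.
have := deriv_le_compare t0 dD dg _; rewrite D0 subr0 (ger0_norm t0) => h.
apply: le_trans (h _) _ => [s s0|]; first by have := hD s; rewrite (ger0_norm s0).
by rewrite gerBl mulr_ge0 ?expR_ge0// divr_ge0// ltW.
Qed.

Lemma exp_bound (D D' : R -> R) K a t : 0 < a -> D 0 = 0 ->
  (forall s, is_derive s (1 : R) D (D' s)) -> (forall s, `|D' s| <= K * expR (a * `|s|)) ->
  `|D t| <= K / a * expR (a * `|t|).
Proof.
move=> a0 D0 dD hD; have [t0|t0] := leP 0 t; first exact: exp_bound_pos hD.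
have := @exp_bound_pos (fun s => D (- s)) (fun s => - D' (- s)) K a (- t) a0.
rewrite oppr_ge0 (ltW t0) oppr0 opprK normrN; apply => // s; first exact: is_derive_reflect.
by rewrite normrN -[`|s|]normrN.
Qed.

(** The square D^2 e^(-2Lt) is differentiable, which |D| may fail to be, and it does not
    increase. *)
Lemma gronwall_pos (D D' : R -> R) L t : 0 <= t ->
  (forall s, is_derive s (1 : R) D (D' s)) -> (forall s, `|D' s| <= L * `|D s|) ->
  `|D t| <= `|D 0| * expR (L * `|t|).
Proof.
rewrite le_eqVlt => /predU1P[<- _ _|t0 dD hD]; first by rewrite normr0 mulr0 expR0 mulr1.
pose g s := D s ^+ 2 * expR (- (2 * L) * s).
have dg s : is_derive s (1 : R) g ((2 * D s * D' s - 2 * L * D s ^+ 2) * expR (- (2 * L) * s)).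
  have := is_deriveM (is_deriveX 2 (dD s)) (expR_affine_derive (- (2 * L)) s).
  by move/is_derive_eq; apply; rewrite /GRing.scale/= fctE expr1; ring.
have [s /andP[s0 _] E] := hdw_mvt t0 (fun s _ => is_derive_hdw `[0, t]%classic (dg s)).
have gg : g t <= g 0.
  rewrite -subr_le0 E mulr_le0_ge0//; last by rewrite subr0 ltW.
  rewrite mulr_le0_ge0 ?expR_ge0// subr_le0 -!mulrA ler_wpM2l//.
  apply: (le_trans (ler_norm _)); rewrite normrM -real_normK ?num_real// expr2.
  by rewrite mulrCA ler_wpM2l.
move: gg; rewrite /g mulr0 expR0 mulr1 (gtr0_norm t0) => gg.
have : `|D t| ^+ 2 <= (`|D 0| * expR (L * t)) ^+ 2.
  rewrite real_normK ?num_real// exprMn real_normK ?num_real//.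
  have e : expR (L * t) ^+ 2 * expR (- (2 * L) * t) = 1.
    rewrite expr2 -!expRD -[RHS]expR0; congr expR; ring.
  rewrite -[leLHS]mulr1 -e [_ ^+ 2 * expR _]mulrC mulrA ler_wpM2r// exprn_ge0 ?expR_ge0//.
by rewrite ler_sqr ?nnegrE ?mulr_ge0 ?expR_ge0.
Qed.

Lemma gronwall (D D' : R -> R) L t :
  (forall s, is_derive s (1 : R) D (D' s)) -> (forall s, `|D' s| <= L * `|D s|) ->
  `|D t| <= `|D 0| * expR (L * `|t|).
Proof.
move=> dD hD; have [t0|t0] := leP 0 t; first exact: gronwall_pos hD.
have := @gronwall_pos (fun s => D (- s)) (fun s => - D' (- s)) L (- t).
rewrite oppr_ge0 (ltW t0) oppr0 opprK normrN; apply => // s; first exact: is_derive_reflect.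
by rewrite normrN.
Qed.

Lemma half_pow_eq0 (z C : R) : (forall n : nat, `|z| <= C * 2^-1 ^+ n) -> z = 0.
Proof.
move=> h; apply/eqP; rewrite -normr_le0; apply/ler_addgt0Pl => e e0; rewrite addr0.
have c : (C * 2^-1 ^+ n) @[n --> \oo] --> (0 : R).
  by apply: cvg_geometric; rewrite ger0_norm// invf_lt1// ltr1n.
have /cvgrPdist_le/(_ _ e0)[n _ /(_ n (leqnn n))] := c.
rewrite /= sub0r normrN => l; apply: (le_trans (h n)); exact: le_trans (ler_norm _) l.
Qed.

Lemma half_pow_limit (u : nat -> R) (C : R) : 0 <= C ->
  (forall n, `|u n.+1 - u n| <= C * 2^-1 ^+ n) ->
  exists l, forall n, `|l - u n| <= 2 * C * 2^-1 ^+ n.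
Proof.
(* The geometric tail turns the sequence into nested intervals: [a] increases, [c] decreases, and
   the limit is the supremum of [a]. *)
move=> C0 hu; pose a n := u n - 2 * C * 2^-1 ^+ n; pose c n := u n + 2 * C * 2^-1 ^+ n.
have ac n m : a n <= c m.
  have aS k : a k <= a k.+1.
    by rewrite /a exprS; have /ler_normlP[] := hu k; lra.
  have cS k : c k.+1 <= c k.
    by rewrite /c exprS; have /ler_normlP[] := hu k; lra.
  have amono i k : a i <= a (i + k)%N.
    by elim: k => [|k ih]; [rewrite addn0|rewrite addnS (le_trans ih)].
  have cmono i k : c (i + k)%N <= c i.
    by elim: k => [|k ih]; [rewrite addn0|rewrite addnS (le_trans _ ih)].
  apply: (le_trans (amono n m)); apply: (@le_trans _ _ (c (m + n)%N)); last exact: cmono.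
  rewrite addnC /a /c; have : 0 <= 2 * C * 2^-1 ^+ (m + n) by rewrite !mulr_ge0 ?exprn_ge0.
  by lra.
have ub m : ubound (range a) (c m) by move=> _ [n _ <-]; exact: ac.
have hs : has_sup (range a) by split; [exists (a 0%N), 0%N|exists (c 0%N)].
exists (sup (range a)) => n.
have l1 : a n <= sup (range a) by apply: sup_upper_bound => //; exists n.
have l2 : sup (range a) <= c n by apply: ge_sup; [exact: hs.1|exact: ub].
by apply/ler_normlP; rewrite /a /c in l1 l2; split; lra.
Qed.

Section Picard.
Variables (v : R -> R -> R) (L M : R).
Hypothesis L0 : 0 < L.
Hypothesis v_cont : forall y, continuous (v ^~ y).
Hypothesis v_lip : forall t x y, `|v t x - v t y| <= L * `|x - y|.
Hypothesis v_bd : forall t x, `|v t x| <= M.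

Let v_comp_cont (Y : R -> R) : continuous Y -> continuous (fun t => v t (Y t)).
Proof.
move=> cY t; apply/cvgrPdist_le => e e0.
have e2 : 0 < e / 2 by lra.
have e3 : 0 < e / 2 / L by rewrite divr_gt0.
have /cvgrPdist_le/(_ _ e2) h1 := @v_cont (Y t) t.
have /cvgrPdist_le/(_ _ e3) h2 := cY t.
near=> s.
have -> : v t (Y t) - v s (Y s) = (v t (Y t) - v s (Y t)) + (v s (Y t) - v s (Y s)) by ring.
apply: (le_trans (ler_normD _ _)); rewrite [leRHS](splitr e); apply: lerD; first by near: s.
apply: (le_trans (v_lip _ _ _)); rewrite mulrC -ler_pdivlMr//; by near: s.
Unshelve. all: by end_near. Qed.

Let picard_step (x : R) (Y : R -> R) (cY : continuous Y) :
  {Z : R -> R | Z 0 = x /\ forall t, is_derive t (1 : R) Z (v t (Y t))}.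
Proof.
apply: cid; have [F [F0 dF]] := cont_antideriv (v_comp_cont cY).
exists (fun t => x + F t); split; first by rewrite F0 addr0.
move=> t; have := is_deriveD (is_derive_cst x t (1 : R)) (dF t).
by rewrite add0r.
Qed.

Let picard x (n : nat) : {Y : R -> R | continuous Y}.
Proof.
elim: n => [|n [Y cY]]; first by exists (fun=> x); exact: cst_continuous.
exists (projT1 (picard_step x cY)).
have [_ dZ] := projT2 (picard_step x cY).
exact: (is_derive_continuous dZ).
Defined.

Let Yn x n := projT1 (picard x n).

Let Yn_cont x n : continuous (Yn x n). Proof. exact: projT2 (picard x n). Qed.

Let YnS x n : Yn x n.+1 0 = x /\ forall t, is_derive t (1 : R) (Yn x n.+1) (v t (Yn x n t)).
Proof.
rewrite /Yn /=; case: (picard x n) => Y cY /=.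
exact: projT2 (picard_step x cY).
Qed.

Let M_ge0 : 0 <= M. Proof. by apply: le_trans (v_bd 0 0). Qed.

(** With this weight a Picard step multiplies differences by at most L / a = 1/2. *)
Let a := 2 * L.
Let a_gt0 : 0 < a. Proof. by rewrite mulr_gt0. Qed.
Let C := M / a.

Let Yn_step x n t : `|Yn x n.+1 t - Yn x n t| <= C * expR (a * `|t|) * 2^-1 ^+ n.
Proof.
have a0 := a_gt0; have M0 := M_ge0.
elim: n t => [|n ih] t.
  have [Y0 dY] := YnS x 0; rewrite expr0 mulr1.
  apply: (@exp_bound (fun t => Yn x 1 t - x) (fun t => v t (Yn x 0 t)) M a t a0).
  - by rewrite Y0 subrr.
  - by move=> s; rewrite -[X in is_derive _ _ _ X]subr0; apply: is_deriveB.
  - move=> s; apply: (le_trans (v_bd _ _)); rewrite ler_peMr//.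
    by rewrite -expR0 ler_expR mulr_ge0// ltW.
have [Y0 dY] := YnS x n.+1; have [Z0 dZ] := YnS x n.
have -> : C * expR (a * `|t|) * 2^-1 ^+ n.+1 = (L * C * 2^-1 ^+ n) / a * expR (a * `|t|).
  by rewrite exprS /a; field; rewrite gt_eqF.
apply: (@exp_bound (fun t => Yn x n.+2 t - Yn x n.+1 t)
  (fun t => v t (Yn x n.+1 t) - v t (Yn x n t)) _ a t a0).
- by rewrite Y0 Z0 subrr.
- move=> s; apply: (le_trans (v_lip _ _ _)).
  by rewrite -!mulrA ler_wpM2l ?(ltW L0)// (le_trans (ih s))// -!mulrA [2^-1 ^+ n * _]mulrC.
Qed.

Lemma flow_exists x : exists2 Y : R -> R, Y 0 = x & forall t, is_derive t (1 : R) Y (v t (Y t)).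
Proof.
have C0 : 0 <= C by rewrite divr_ge0 ?M_ge0 ?ltW.
have Ct0 t : 0 <= C * expR (a * `|t|) by rewrite mulr_ge0 ?expR_ge0.
have [Y YY] : exists Y : R -> R, forall t n,
    `|Y t - Yn x n t| <= 2 * (C * expR (a * `|t|)) * 2^-1 ^+ n.
  have h t := cid (half_pow_limit (Ct0 t) (fun n => Yn_step x n t)).
  by exists (fun t => projT1 (h t)) => t n; exact: (projT2 (h t) n).
(* All iterates from the first on are M-Lipschitz in time, and pointwise convergence passes this to
   [Y]. *)
have cY : continuous Y.
  have lip s t : `|Y s - Y t| <= M * `|s - t|.
    rewrite -subr_le0; set z := _ - _; rewrite leNgt; apply/negP => z0.
    have h n : `|z| <= (2 * (C * expR (a * `|s|)) + 2 * (C * expR (a * `|t|))) * 2 * 2^-1 ^+ n.+1.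
      have [_ dY] := YnS x n.
      have l := is_derive_bound dY (fun s => v_bd s _) s t.
      rewrite gtr0_norm// /z lerBlDr -[Y s - Y t](subrK (Yn x n.+1 s - Yn x n.+1 t)).
      apply: (le_trans (ler_normD _ _)); apply: lerD => //.
      have -> : Y s - Y t - (Yn x n.+1 s - Yn x n.+1 t) = (Y s - Yn x n.+1 s) - (Y t - Yn x n.+1 t) by ring.
      apply: (le_trans (ler_normB _ _)).
      have h1 := YY s n.+1; have h2 := YY t n.+1.
      have := lerD h1 h2; move/le_trans; apply; rewrite -mulrDl ler_wpM2r ?exprn_ge0//.
      by rewrite ler_peMr ?ler1n// addr_ge0// mulr_ge0.
    have := half_pow_eq0 (C := (2 * (C * expR (a * `|s|)) + 2 * (C * expR (a * `|t|)))) (z := z).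
    move=> /(_ _) E; move: z0; rewrite E ?ltxx// => n.
    by apply: (le_trans (h n)); rewrite exprS -!mulrA [2 * (2^-1 * _)]mulrA mulfV// mul1r.
  move=> t; apply/cvgrPdist_le => e e0.
  have M1 : 0 < M + 1 by rewrite ltr_wpDl.
  exists (e / (M + 1)) => [|s /= st]; first by rewrite /= divr_gt0.
  apply: (le_trans (lip t s)); apply: (@le_trans _ _ (M * (e / (M + 1)))).
    by rewrite ler_wpM2l ?M_ge0// ltW.
  by rewrite mulrCA ler_piMr ?(ltW e0)// ler_pdivrMr// mul1r lerDl.
have [F [F0 dF]] := cont_antideriv (v_comp_cont cY).
(* The integral equation, since [Y] and [x + F] both differ from the iterate of index n + 1 by a
   multiple of 2^(-n). *)
have E t : Y t = x + F t.
  apply/eqP; rewrite -subr_eq0; apply/eqP.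
  apply: (@half_pow_eq0 _ (2 * (C * expR (a * `|t|)) + C * expR (a * `|t|))) => n.
  have [Y0 dY] := YnS x n.
  have -> : Y t - (x + F t) = (Y t - Yn x n.+1 t) + (Yn x n.+1 t - x - F t) by ring.
  apply: (le_trans (ler_normD _ _)); rewrite mulrDl; apply: lerD.
    apply: (le_trans (YY t n.+1)); apply: ler_wpM2l; first by rewrite mulr_ge0.
    by rewrite exprS ler_piMl ?exprn_ge0// invf_le1// ler1n.
  have -> : C * expR (a * `|t|) * 2^-1 ^+ n = (L * (2 * C * 2^-1 ^+ n)) / a * expR (a * `|t|).
    by rewrite /a; field; rewrite gt_eqF.
  apply: (@exp_bound (fun t => Yn x n.+1 t - x - F t)
    (fun t => v t (Yn x n t) - v t (Y t)) _ a t a_gt0).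
  - by rewrite Y0 F0 subrr subr0.
  - move=> s; have h : is_derive s (1 : R) (fun t => Yn x n.+1 t - x) (v s (Yn x n s)).
      by rewrite -[X in is_derive _ _ _ X]subr0; apply: is_deriveB.
    exact: (is_deriveB h (dF s)).
  - move=> s; apply: (le_trans (v_lip _ _ _)); rewrite -!mulrA ler_wpM2l ?(ltW L0)//.
    rewrite distrC (le_trans (YY s n))// -!mulrA [2^-1 ^+ n * _]mulrC//.
exists Y; first by rewrite E F0 addr0.
move=> t; have := is_deriveD (is_derive_cst x t (1 : R)) (dF t); rewrite add0r.
by have <- : (fun s => x + F s) = Y by apply/funext => s; rewrite E.
Qed.

End Picard.

End Flow.

Section Taylor.
Context {R : realType}.
Implicit Types x y z : R.

Lemma taylor2 (f f1 f2 : R -> R) (K : R) : (forall x, is_derive x (1 : R) f (f1 x)) ->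
  (forall x, is_derive x (1 : R) f1 (f2 x)) -> (forall x, `|f2 x| <= K) ->
  forall y z, `|f y - f z - f1 z * (y - z)| <= K * `|y - z| ^+ 2.
Proof.
move=> d0 d1 hK y z; rewrite expr2 mulrA.
apply: (deriv_affine_bound (@interval_cball R z `|y - z|) (fun w _ => d0 w)) => //=.
  move=> w wz; apply: (@le_trans _ _ (K * `|w - z|)); first exact: (is_derive_bound d1).
  by rewrite ler_wpM2l// (le_trans (normr_ge0 _) (hK 0)).
by rewrite subrr normr0.
Qed.

End Taylor.

(** * Uniqueness through the flow of a given Eulerian solution *)

Section Transport.
Context {R : realType}.
Variable r : R.
Hypothesis hr : 1 < r.
Variables (u0 : R -> R) (I : set R) (v vt : R -> R -> R) (T : R).
Hypothesis hu0 : lie_algebra u0.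
Hypothesis Ii : is_interval I.
Hypothesis I0 : I 0.
Hypothesis dv : lie_algebra_path I v vt.
Hypothesis v0 : v 0 = u0.
Hypothesis IT : I T.
Implicit Types (t s x y z : R).

Let r_gt0 : 0 < r. Proof. by apply: lt_trans hr. Qed.

(** The segment between 0 and [T], in either order: a compact part of [I], which supplies bounds
    uniform in time. *)
Definition seg0 : set R := `[Num.min 0 T, Num.max 0 T]%classic.
Let A := Num.min 0 T.
Let B := Num.max 0 T.
Local Notation J := seg0.

Let A_le : A <= 0 /\ A <= T. Proof. by rewrite /A !ge_min !lexx orbT. Qed.
Let B_ge : 0 <= B /\ T <= B. Proof. by rewrite /B !le_max !lexx orbT. Qed.
Let AB : A <= B. Proof. exact: le_trans A_le.1 B_ge.1. Qed.

Lemma seg0E t : J t <-> A <= t <= B.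
Proof. by rewrite /seg0 /= in_itv. Qed.

Lemma seg00 : J 0. Proof. by apply/seg0E; rewrite A_le.1 B_ge.1. Qed.
Lemma seg0T : J T. Proof. by apply/seg0E; rewrite A_le.2 B_ge.2. Qed.

Lemma seg0_interval : is_interval J.
Proof. by move=> s t Js Jt x; rewrite !/(J _) /= in Js Jt *; exact: interval_is_interval Js Jt x. Qed.

Lemma seg0_sub t : J t -> I t.
Proof.
move=> /seg0E; rewrite /A /B; have [T0|T0] := leP 0 T => tAB.
  exact: (Ii I0 IT tAB).
exact: (Ii IT I0 tAB).
Qed.

Let sc := let: And3 h _ _ := lie_path_C1 dv in h.
Let lc := let: And3 _ h _ := lie_path_C1 dv in h.
Let C1 := let: And3 _ _ h := lie_path_C1 dv in h.
Let lv t : I t -> lie_algebra (v t). Proof. exact: dv.1. Qed.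

Lemma seg0_unif n t e : J t -> 0 < e -> exists2 d, 0 < d & forall s, J s -> `|s - t| < d ->
  forall x, `|derive1n n (v s) x - derive1n n (v t) x| <= e.
Proof.
move=> Jt e0; have [d d0 h] := C1_c_unif sc lc C1 n (seg0_sub Jt) e0.
by exists d => // s /seg0_sub; exact: h.
Qed.

Lemma seg0_bounded n : exists2 M, 0 <= M & forall t x, J t -> `|derive1n n (v t) x| <= M.
Proof.
have [|M hM] := @segment_uniform R A B (fun M s => forall x, `|derive1n n (v s) x| <= M) AB.
  move=> t tAB; have Jt : J t by apply/seg0E.
  have [N N0 hN] := lie_bounded n (lv (seg0_sub Jt)).
  have [d d0 h] := seg0_unif n Jt ltr01.
  exists d, (N + 1); split=> // s M' sAB st NM x; apply: le_trans NM.
  rewrite -[derive1n n (v s) x](subrK (derive1n n (v t) x)) addrC.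
  by apply: (le_trans (ler_normD _ _)); apply: lerD; [exact: hN|apply: h => //; apply/seg0E].
exists M; first by apply: le_trans (hM 0 _ 0) => //; rewrite A_le.1 B_ge.1.
by move=> t x /seg0E h; exact: (hM t h x).
Qed.

(** Tails uniform in time serve twice: with n = 0 for the displacement of trajectories near -oo,
    with n = 1 to make the compensating bump negligible. *)
Lemma seg0_tail n e : 0 < e -> exists N, forall t x, J t -> x <= - N -> `|derive1n n (v t) x| <= e.
Proof.
move=> e0; have e2 : 0 < e / 2 by lra.
have [|N hN] := @segment_uniform R A B
  (fun N s => forall x, x <= - N -> `|derive1n n (v s) x| <= e) AB.
  move=> t tAB; have Jt : J t by apply/seg0E.
  have /cvgrPdist_le/(_ _ e2)[N [_ hN]] := lie_cvgNy n (lv (seg0_sub Jt)).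
  have [d d0 h] := seg0_unif n Jt e2.
  exists d, (1 - N); split=> // s M' sAB st NM x xM.
  rewrite -[derive1n n (v s) x](subrK (derive1n n (v t) x)) [leRHS](splitr e).
  apply: (le_trans (ler_normD _ _)); apply: lerD; first by apply: h => //; apply/seg0E.
  by have /= := hN x ltac:(lra); rewrite sub0r normrN.
by exists N => t x /seg0E h; exact: (hN t h x).
Qed.

Let vc t x := v (clamp A B t) x.

Let clampJ t : J (clamp A B t). Proof. by apply/seg0E; exact: clamp_itv. Qed.

Lemma seg0_clamp_cont n (f : R -> R) : continuous f ->
  continuous (fun t => derive1n n (v (clamp A B t)) (f t)).
Proof.
move=> cf t; apply/cvgrPdist_le => e e0; have e2 : 0 < e / 2 by lra.
have [d d0 h] := seg0_unif n (clampJ t) e2.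
have h2 := cvg_comp _ _ (cf t) (@smooth_cont _ _ n (sc (seg0_sub (clampJ t))) (f t)).
have /cvgrPdist_le/(_ _ e2) h3 := h2.
near=> s.
have -> : derive1n n (v (clamp A B t)) (f t) - derive1n n (v (clamp A B s)) (f s) =
  (derive1n n (v (clamp A B t)) (f t) - derive1n n (v (clamp A B t)) (f s)) +
  (derive1n n (v (clamp A B t)) (f s) - derive1n n (v (clamp A B s)) (f s)) by ring.
rewrite [leRHS](splitr e); apply: (le_trans (ler_normD _ _)); apply: lerD; first by near: s.
rewrite distrC; apply: h => //; apply: le_lt_trans (clamp_lip _ _ _ _) _.
near: s; exists d => // s /= ; by rewrite distrC.
Unshelve. all: by end_near. Qed.

Let flows : exists f : R -> R -> R, forall x, f x 0 = x /\
  forall t, is_derive t (1 : R) (f x) (vc t (f x t)).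
Proof.
have [M M0 hM] := seg0_bounded 0; have [L L0 hL] := seg0_bounded 1.
have L1 : 0 < L + 1 by lra.
have h x : {Y : R -> R | Y 0 = x & forall t, is_derive t (1 : R) Y (vc t (Y t))}.
  apply: cid2; apply: (flow_exists L1 (M := M)) => [y|t y z|t y].
  - exact: (@seg0_clamp_cont 0 (fun=> y) (@cst_continuous _ _ y)).
  - apply: (@le_trans _ _ (L * `|y - z|)); last by rewrite ler_wpM2r// lerDl.
    apply: (@is_derive_bound R (v (clamp A B t)) (v (clamp A B t))^`()%classic L) => w.
      exact: (smooth_dseq (sc (seg0_sub (clampJ t))) 0).
    by have := hL _ w (clampJ t); rewrite derive1n1.
  - exact: hM.
by exists (fun x => s2val (h x)) => x; split; [exact: (s2valP (h x))|exact: (s2valP' (h x))].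
Qed.

(** The interface to the two equations: each of them has only to show that P^(1/r) is affine along a
    trajectory [f], for any [P] solving P' = v_x P. *)
Hypothesis transported : forall f P : R -> R,
  (forall t, J t -> has_deriv_within J f t (v t (f t))) ->
  (forall t, J t -> 0 < P t) ->
  (forall t, J t -> has_deriv_within J P t ((v t)^`()%classic (f t) * P t)) ->
  forall t, J t -> 0 < 1 + t * ((v 0)^`()%classic (f 0) / r) /\
    P t = P 0 * (1 + t * ((v 0)^`()%classic (f 0) / r)) `^ r.

Local Notation b := (slope r u0).

Let f := projT1 (cid flows).
Let f0 x : f x 0 = x. Proof. exact: (projT2 (cid flows) x).1. Qed.
Let df x t : is_derive t (1 : R) (f x) (vc t (f x t)).
Proof. exact: (projT2 (cid flows) x).2. Qed.

Let fJ x t : J t -> has_deriv_within J (f x) t (v t (f x t)).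
Proof.
move=> Jt; have := is_derive_hdw J (df x t); by rewrite /vc (clamp_id (iffLR (seg0E t) Jt)).
Qed.

Let f_cont x : continuous (f x). Proof. exact: (is_derive_continuous (df x)). Qed.

(** The solution of the variational equation along the trajectory, as the exponential of the
    integral of v_x. It is the candidate for the x-derivative of the flow. *)
Let expo x : exists P : R -> R, [/\ P 0 = 1, forall t, 0 < P t &
  forall t, is_derive t (1 : R) P ((v (clamp A B t))^`()%classic (f x t) * P t)].
Proof.
have [G [G0 dG]] := cont_antideriv (@seg0_clamp_cont 1 _ (@f_cont x)).
exists (fun t => expR (G t)); split; first by rewrite G0 expR0.
  by move=> t; exact: expR_gt0.
move=> t; have := @is_derive1_comp R expR G t _ _ (is_derive_expR _) (dG t).
by move/is_derive_eq; apply; rewrite mulrC.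
Qed.

Let expoE x (P : R -> R) t : P 0 = 1 -> (forall t, 0 < P t) ->
  (forall t, is_derive t (1 : R) P ((v (clamp A B t))^`()%classic (f x t) * P t)) ->
  J t -> 0 < 1 + t * b x /\ P t = (1 + t * b x) `^ r.
Proof.
move=> P0 Pp dP Jt; have := @transported (f x) P (@fJ x) (fun t _ => Pp t) _ t Jt.
rewrite P0 mul1r v0 f0 /slope; apply => s Js.
by have := is_derive_hdw J (dP s); rewrite (clamp_id (iffLR (seg0E s) Js)).
Qed.

Lemma transport_base : base_pos b J.
Proof.
by move=> t x Jt; have [P [P0 Pp dP]] := expo x; have [] := expoE P0 Pp dP Jt.
Qed.

(* For E = f(t, x + h) - f(t, x), the derivative (v(f + E) - v(f) - v_x(f) E) / P of
   E / P in time is quadratic in E, hence in h. *)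
Let f_dx t x : J t -> is_derive x (1 : R) (f ^~ t) ((1 + t * b x) `^ r).
Proof.
move=> Jt; have [P [P0 Pp dP]] := expo x.
have [_ <-] := expoE P0 Pp dP Jt.
have [L L0 hL] := seg0_bounded 1; have [K K0 hK] := seg0_bounded 2.
have P_cont : continuous P by exact: (is_derive_continuous dP).
have [Mi hMi] : exists Mi, forall s, J s -> (P s)^-1 <= Mi.
  have cV : continuous (fun s => (P s)^-1).
    by move=> s; apply: cvgV; [rewrite gt_eqF|exact: P_cont].
  have [c _ hc] := EVT_max AB (continuous_subspaceT cV).
  by exists (P c)^-1 => s /seg0E sAB; apply: hc; rewrite in_itv.
have Mi0 : 0 <= Mi by apply: le_trans (hMi 0 seg00); rewrite invr_ge0 ltW.
pose W := `|A| + `|B|.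
have JW s : J s -> `|s| <= W.
  move=> /seg0E /andP[As sB]; have a1 := ler_norm (- A); have b1 := ler_norm B; rewrite normrN in a1.
  have a2 := normr_ge0 A; have b2 := normr_ge0 B.
  by apply/ler_normlP; rewrite /W; split; lra.
pose E h s := f (x + h) s - f x s.
have dE h s : is_derive s (1 : R) (E h) (vc s (f (x + h) s) - vc s (f x s)).
  exact: is_deriveB (df _ _) (df _ _).
have dvx s z : J s -> is_derive z (1 : R) (v s) ((v s)^`()%classic z).
  by move=> Js; exact: (smooth_dseq (sc (seg0_sub Js)) 0).
have dvxx s z : J s -> is_derive z (1 : R) (v s)^`()%classic (derive1n 2 (v s) z).
  by move=> Js; exact: (smooth_dseq (sc (seg0_sub Js)) 1).
have lipv s y z : J s -> `|v s y - v s z| <= L * `|y - z|.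
  move=> Js; apply: (is_derive_bound (fun z => dvx s z Js)) => w.
  by have := hL s w Js; rewrite derive1n1.
have E_le h s : `|E h s| <= `|h| * expR (L * `|s|).
  have := gronwall s (dE h) (fun s => lipv _ _ _ (clampJ s)).
  by rewrite /E !f0 addrAC subrr add0r.
have taylor s y z : J s -> `|v s y - v s z - (v s)^`()%classic z * (y - z)| <= K * `|y - z| ^+ 2.
  by move=> Js; apply: (taylor2 (fun x => dvx s x Js) (fun x => dvxx s x Js)) => w; exact: hK.
(* The product of the Taylor constant, the squared Gronwall growth of [E], the bound of 1/P and a
   bound on the elapsed time. *)
pose D := K * expR (L * W) ^+ 2 * Mi * W.
have key h : `|E h t / P t - h| <= D * `|h| ^+ 2.
  have dEP s : J s -> has_deriv_within J (fun s => E h s * (P s)^-1) s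
      ((v s (f (x + h) s) - v s (f x s) - (v s)^`()%classic (f x s) * E h s) / P s).
    move=> Js; have sAB := iffLR (seg0E s) Js; have Pn : P s != 0 by rewrite gt_eqF.
    have := hdwM (is_derive_hdw J (dE h s)) (is_derive_hdw J (@is_deriveV R P s _ 1 Pn (dP s))).
    rewrite /vc clamp_id//; set X := (X in has_deriv_within _ _ _ X -> _).
    suff -> : X = (v s (f (x + h) s) - v s (f x s) - (v s)^`()%classic (f x s) * E h s) / P s by [].
    by rewrite /X /GRing.scale/=; field.
  have := @hdw_bound R J _ _ (K * (`|h| * expR (L * W)) ^+ 2 * Mi) seg0_interval dEP _ t 0 Jt seg00.
  rewrite P0 invr1 mulr1 {3}/E !f0 (addrAC x) subrr add0r subr0 => hb.
  apply: (le_trans (hb _)) => [s Js|].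
    rewrite normrM [`|(P s)^-1|]ger0_norm ?invr_ge0 ?(ltW (Pp s))//.
    apply: ler_pM; rewrite ?invr_ge0 ?(ltW (Pp s))//; last exact: hMi.
    apply: (le_trans (taylor s _ _ Js)); rewrite ler_wpM2l// ler_sqr ?nnegrE ?mulr_ge0 ?expR_ge0//.
    apply: (le_trans (E_le h s)); rewrite ler_wpM2l// ler_expR ler_wpM2l//; exact: JW.
  have -> : D * `|h| ^+ 2 = K * (`|h| * expR (L * W)) ^+ 2 * Mi * W by rewrite /D; ring.
  by rewrite ler_wpM2l ?JW// !mulr_ge0// exprn_ge0// mulr_ge0// expR_ge0.
have D0 : 0 <= D by rewrite !mulr_ge0// ?exprn_ge0 ?expR_ge0// addr_ge0.
apply/is_derive_hdwT/hdwP => e e0.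
exists (e / (D * P t + 1)) => [|y _ yx].
  by rewrite divr_gt0// ltr_wpDl// mulr_ge0// ltW.
have D1 : 0 < D * P t + 1 by rewrite ltr_wpDl// mulr_ge0// ltW.
have -> : f y t - f x t - P t * (y - x) = P t * (E (y - x) t / P t - (y - x)).
  have -> : E (y - x) t = f y t - f x t by rewrite /E [x + _]addrC subrK.
  by field; rewrite gt_eqF.
rewrite normrM (gtr0_norm (Pp t)).
apply: (@le_trans _ _ (P t * (D * `|y - x| ^+ 2))); first by rewrite ler_wpM2l ?(ltW (Pp t)).
have -> : P t * (D * `|y - x| ^+ 2) = (D * P t * `|y - x|) * `|y - x|.
  by rewrite expr2 mulrCA (mulrA (P t)) (mulrA D) (mulrA D).
rewrite ler_wpM2r//; apply: (@le_trans _ _ ((D * P t) * (e / (D * P t + 1)))).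
  by apply: ler_wpM2l; [apply: mulr_ge0 => //; exact: ltW|exact: ltW].
by rewrite mulrCA ler_piMr ?(ltW e0)// ler_pdivrMr// mul1r lerDl.
Qed.

(** In bounded time a trajectory moves a bounded distance, so one that starts far to the left stays
    where the velocity is uniformly small. *)
Let f_cvgNy t : J t -> f x t - x @[x --> -oo] --> (0 : R).
Proof.
move=> Jt; have [M M0 hM] := seg0_bounded 0.
apply/cvgrPdist_le => e e0.
have t1 : 0 < `|t| + 1 by rewrite ltr_wpDl.
have [N hN] := seg0_tail 0 (divr_gt0 e0 t1).
have bnd x s : J s -> `|f x s - x| <= M * `|s|.
  move=> Js; have := @hdw_bound R J (f x) _ M seg0_interval (@fJ x) _ s 0 Js seg00.
  by rewrite f0 subr0; apply => w Jw; exact: hM.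
have Jts s : J s -> `|s| <= `|A| + `|B|.
  move=> /seg0E /andP[As sB]; have a1 := ler_norm (- A); have b1 := ler_norm B; rewrite normrN in a1.
  have a2 := normr_ge0 A; have b2 := normr_ge0 B.
  by apply/ler_normlP; split; lra.
exists (- N - M * (`|A| + `|B|)); split; first exact: num_real.
move=> x xN /=; rewrite sub0r normrN.
apply: (@le_trans _ _ (e / (`|t| + 1) * `|t|)); last first.
  by rewrite -mulrA ler_piMr ?(ltW e0)// mulrC ler_pdivrMr// mul1r lerDl.
have := @hdw_bound R J (f x) _ (e / (`|t| + 1)) seg0_interval (@fJ x) _ t 0 Jt seg00.
rewrite f0 subr0; apply => w Jw; apply: hN => //.
have /ler_normlP[_ h] := bnd x w Jw.
have := Jts w Jw => h2; have : M * `|w| <= M * (`|A| + `|B|) by rewrite ler_wpM2l.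
by lra.
Qed.

Lemma transport_unique : (forall x, 0 < 1 + T * b x) /\ v T = eulerian r u0 T.
Proof.
have B0 := transport_base; have wb := slope_wfun r hu0.
have BT x : 0 < 1 + T * b x by exact: (B0 T x seg0T).
split=> //; rewrite (eulerianE hr hu0 BT).
(* For T = 0 the segment is a point and relative derivatives do not determine the velocity; the
   initial condition does. *)
have [T0|Tn0] := eqVneq T 0; first by rewrite T0 v0 (eulerian_at0 hr hu0).
pose phi := gpath r id (fun=> 1) b.
have dp := gpath_path hr (@id_derive R) diff_group_id wb B0.
have fphi t x : J t -> f x t = phi t x.
  move=> Jt.
  have dd z : is_derive z (1 : R) (fun x => f x t - phi t x) 0.
    rewrite -[X in is_derive _ _ _ X](subrr ((1 + t * b z) `^ r)); apply: is_deriveB.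
      exact: f_dx.
    have := gpath_dx hr (@id_derive R) diff_group_id wb z (fun x => B0 t x Jt).
    by rewrite mul1r.
  have c0 := is_derive_const dd.
  have lim : f x t - phi t x @[x --> -oo] --> (0 : R).
    have [l2 _] := dp.1 t Jt.
    have -> : (fun x => f x t - phi t x) = (fun x => (f x t - x) - (phi t x - x)).
      by apply/funext => z; ring.
    by rewrite -(subr0 0); apply: cvgB; [exact: f_cvgNy|exact: (lie_cvgNy 0 l2)].
  apply/eqP; rewrite -subr_eq0; apply/eqP.
  have h : f z t - phi t z @[z --> -oo] --> f x t - phi t x.
    by under eq_fun do rewrite (c0 _ x); exact: cvg_cst.
  exact: (cvg_unique _ h lim).
have vphi x : v T (phi T x) = gvel r (fun=> 1) b T x.
  have h1 := @fJ x T seg0T; rewrite fphi in h1; last exact: seg0T.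
  have h2 := is_derive_hdw J (gpath_dt hr (@id_derive R) diff_group_id wb x BT).
  have h3 : has_deriv_within J (phi ^~ x) T (v T (phi T x)).
    by apply: (hdw_eq seg0T _ h1) => s Js; exact: fphi.
  by apply: (hdw_uniq seg0_interval seg0T seg00 _ h3 h2); rewrite eq_sym.
have dphi := diff_group_diffeo (dp.1 T seg0T).
apply/funext => y; rewrite -{1}(inverseK dphi y) -/phi vphi gvel_e.
by [].
Qed.

End Transport.

Section BumpEstimates.
Context {R : realType}.
Implicit Types (g : R -> R) (k n : nat) (p z : R).

Local Notation mu := (@lebesgue_measure R).

Lemma bump_int1 g k n p : continuous g -> int1 (fun z => g z * stepk k n.+1 (z - p)).
Proof.
move=> cg; apply: (@int1_supported _ _ (`|p| + 1)).
  by move=> x; apply: cvgM; [exact: cg|exact: stepkB_cont].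
move=> x h; rewrite stepkB_out ?mulr0//.
move: (k.+1%:R^-1) (@invk_le1 R k) => i i1.
have := ler_norm p; have := ler_norm (- p); rewrite normrN => ? ?.
by case: h => h; [left|right]; lra.
Qed.

Lemma stepk_bounded k n : exists2 M : R, 0 <= M & forall x, `|stepk k n.+1 x| <= M.
Proof.
have [M M0 hM] := @dstep_bounded R n.
exists (k.+1%:R ^+ n.+1 * M) => [|x]; first by rewrite mulr_ge0// exprn_ge0.
by rewrite /stepk normrM (ger0_norm (exprn_ge0 _ _))// ler_wpM2l// exprn_ge0.
Qed.

Lemma bump_derive g k n p : continuous g ->
  is_derive p (1 : R) (fun q => \int[mu]_z (g z * stepk k n.+1 (z - q)))
    (- \int[mu]_z (g z * stepk k n.+2 (z - p))).
Proof.
move=> cg; have [M M0 hM] := stepk_bounded k n.+1.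
have ci := bump_int1 k n.+1 p cg.
pose K z : R := \1_`[p - 1, p + 2] z.
have [G [G0 hG]] : exists G : R, 0 <= G /\ forall z, p - 1 <= z <= p + 2 -> `|g z| <= G.
  have p12 : p - 1 <= p + 2 by lra.
  have cn : continuous (fun z => `|g z|) by move=> z; apply: cvg_norm; exact: cg.
  have [c _ hc] := EVT_max p12 (continuous_subspaceT cn).
  by exists `|g c|; split=> // z hz; apply: hc; rewrite in_itv.
rewrite -RintN//.
apply: (@integral_time_derive R setT (fun q z => g z * stepk k n.+1 (z - q))
  (fun q z => - (g z * stepk k n.+2 (z - q))) (fun z => G * M * K z) p 1 measurableT ltr01).
- by move=> q _; exact: bump_int1.
- move=> q z _.
  have d1 : is_derive q (1 : R) (fun q => z - q) (-1).
    by rewrite -[X in is_derive _ _ _ X]add0r; apply: is_deriveB.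
  have := is_deriveZ (g z) (@is_derive1_comp R (stepk k n.+1) (fun q => z - q) q _ _ (stepk_derive _ _ _) d1).
  by move/is_derive_eq; apply; rewrite /GRing.scale/= mulrN1 mulrN.
- by apply: int1Z; exact: int1_indic.
- move=> q z qp; rewrite normrN /K indicE.
  have [zI|zI] := boolP (z \in `[p - 1, p + 2]%classic).
    rewrite mulr1 normrM ler_pM//; apply: hG.
    by move: zI; rewrite mem_setE /= in_itv.
  rewrite stepkB_out ?mulr0 ?normr0 ?mulr_ge0//.
  move: zI qp; rewrite mem_setE /= in_itv/= negb_and -!ltNge => zI /ltr_normlP[q1 q2].
  by move: (k.+1%:R^-1) (@invk_le1 R k) => i i1; case/orP: zI => ?; [left|right]; lra.
Qed.

Lemma bump_average g k p (c e : R) : continuous g ->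
  (forall z, p <= z <= p + k.+1%:R^-1 -> `|g z - c| <= e) ->
  `|\int[mu]_z (g z * stepk k 1 (z - p)) - c| <= e.
Proof.
move=> cg h; have i1 := stepkB_int1 k 0 p; have ig := bump_int1 k 0 p cg.
have I1 := stepkB_integral k p.
have -> : \int[mu]_z (g z * stepk k 1 (z - p)) - c =
    \int[mu]_z (g z * stepk k 1 (z - p) - c * stepk k 1 (z - p)).
  by rewrite (RintB ig (int1Z c i1)) RintZ// I1 mulr1.
have -> : e = \int[mu]_z (e * stepk k 1 (z - p)) by rewrite RintZ// I1 mulr1.
apply: Rint_abs_le; [by apply: int1B => //; exact: int1Z|exact: int1Z|].
move=> z; rewrite -mulrBl normrM (ger0_norm (stepk_ge0 _ _)).
have [zp|zp] := boolP (p <= z <= p + k.+1%:R^-1).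
  by rewrite ler_wpM2r ?stepk_ge0// h.
rewrite stepkB_out ?mulr0//.
by move: zp; rewrite negb_and -!ltNge => /orP[]; by [left|right].
Qed.

Definition bump_const : R := s2val (cid2 (@dstep_bounded R 1)).

(** The derivative of the bump has size (k+1)^2 on a support of length 1/(k+1), so its L^1 norm is
    of order k+1. *)
Lemma bump_deriv_le g k p (e : R) : continuous g -> 0 <= e ->
  (forall z, p <= z <= p + k.+1%:R^-1 -> `|g z| <= e) ->
  `|\int[mu]_z (g z * stepk k 2 (z - p))| <= e * k.+1%:R * bump_const.
Proof.
rewrite /bump_const; case: cid2 => M /= M0 hM cg e0 h.
have kn : (k.+1%:R : R) != 0 by rewrite pnatr_eq0.
pose K z : R := \1_`[p, p + k.+1%:R^-1] z.
have iK : int1 K by exact: int1_indic.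
have IK : \int[mu]_z K z = k.+1%:R^-1.
  rewrite /Rintegral integral_indic//= setIT lebesgue_measure_itv/= lte_fin ltrDl invk_gt0.
  by rewrite -EFinD/= addrAC subrr add0r.
have -> : e * k.+1%:R * M = \int[mu]_z (e * k.+1%:R ^+ 2 * M * K z).
  by rewrite RintZ// IK; field.
apply: Rint_abs_le; [exact: bump_int1|exact: int1Z|] => z; rewrite /K indicE.
have [zI|zI] := boolP (z \in `[p, p + k.+1%:R^-1]%classic).
  rewrite mulr1 normrM -mulrA; apply: ler_pM => //.
    by apply: h; move: zI; rewrite mem_setE /= in_itv.
  rewrite /stepk normrM (ger0_norm (exprn_ge0 _ _))//.
  by apply: ler_wpM2l; [exact: exprn_ge0|exact: hM].
rewrite stepkB_out ?mulr0 ?normr0//.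
by move: zI; rewrite mem_setE /= in_itv/= negb_and -!ltNge => /orP[]; by [left|right].
Qed.

(** Integration by parts against the unit mass of the bump. *)
Lemma bump_moment k p : \int[mu]_z ((z - p) * stepk k 2 (z - p)) = -1.
Proof.
have cid : continuous (fun z : R => z - p).
  by move=> z; apply: cvgB; [exact: cvg_id|exact: cvg_cst].
have i1 := stepkB_int1 k 0 p; have i2 := bump_int1 k 1 p cid; have i0 := bump_int1 k 0 p cid.
have := @int1_deriv0 R (fun z => (z - p) * stepk k 1 (z - p))
  (fun z => stepk k 1 (z - p) + (z - p) * stepk k 2 (z - p)).
rewrite RintD// stepkB_integral => h.
apply/eqP; rewrite eq_sym -subr_eq0 -opprD oppr_eq0; apply/eqP; apply: h.
- move=> z; apply: cvgD; first exact: stepkB_cont.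
  by apply: cvgM; [exact: cid|exact: stepkB_cont].
- exact: i0.
- exact: int1D.
- move=> z; have d1 : is_derive z (1 : R) (fun z => z - p) 1.
    by rewrite -[X in is_derive _ _ _ X]subr0; apply: is_deriveB.
  have := is_deriveM d1 (stepkB_derive k 1 p z); move/is_derive_eq; apply.
  by rewrite /GRing.scale/=; ring.
Qed.

(** Subtracting a linear term costs exactly [a], by [bump_moment]. With [a] the slope of the
    integrand at [p], what remains is small enough to beat the growth k+1 in [bump_deriv_le]. *)
Lemma bump_deriv_split (g w : R -> R) k (p w0 a : R) : continuous g -> continuous w ->
  \int[mu]_z ((g z * (w z - w0) - a * (z - p)) * stepk k 2 (z - p)) =
  \int[mu]_z (g z * w z * stepk k 2 (z - p)) - w0 * \int[mu]_z (g z * stepk k 2 (z - p)) + a.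
Proof.
move=> cg cw; have czp : continuous (fun z : R => z - p).
  by move=> z; apply: cvgB; [exact: cvg_id|exact: cvg_cst].
have cgw : continuous (fun z => g z * w z) by move=> z; apply: cvgM; [exact: cg|exact: cw].
have i1 := bump_int1 k 1 p cgw; have i2 := bump_int1 k 1 p cg.
have i3 := bump_int1 k 1 p czp.
have E : - (a * \int[mu]_z ((z - p) * stepk k 2 (z - p))) = a.
  by rewrite bump_moment mulrN1 opprK.
rewrite -[X in _ = _ + X]E -(RintZ w0 i2) -(RintB i1 (int1Z w0 i2)).
rewrite -(RintZ a i3) -(RintB (int1B i1 (int1Z w0 i2)) (int1Z a i3)).
by apply: eq_Rintegral => z _; ring.
Qed.

Lemma segment_unif_cont g (L e : R) : continuous g -> 0 <= L -> 0 < e -> exists2 d, 0 < d &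
  forall x y, `|x| <= L -> `|x - y| <= d -> `|g x - g y| <= e.
Proof.
move=> cg L0 e0; have e2 : 0 < e / 2 by lra.
have LL : - L <= L by lra.
have N0 M : 0 < Num.max M 1 :> R by rewrite lt_max ltr01 orbT.
have [|M hM] := @segment_uniform R (- L) L
   (* The radius of continuity is encoded as the inverse of max(M, 1), so that enlarging [M] weakens
      the condition as the compactness lemma requires. *)
   (fun M s => forall y, `|s - y| * Num.max M 1 <= 1 -> `|g s - g y| <= e) LL.
  move=> t _; have /cvgrPdist_le/(_ _ e2)[d /= d0 hd] := cg t.
  exists (d / 2), (3 / d); split; first by lra.
  move=> s M' _ st MM y sy.
  have sy' : `|s - y| < d / 2.
    have : `|s - y| * (3 / d) <= 1.
      by apply: le_trans sy; rewrite ler_wpM2l// le_max MM.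
    by rewrite mulrA ler_pdivrMr// mul1r; have := normr_ge0 (s - y); lra.
  have -> : g s - g y = (g t - g y) - (g t - g s) by ring.
  rewrite [leRHS](splitr e); apply: (le_trans (ler_normB _ _)); apply: lerD; apply: hd => /=.
    have -> : t - y = (s - y) - (s - t) by ring.
    by rewrite (le_lt_trans (ler_normB _ _))// [ltRHS](splitr d) ltrD.
  by rewrite distrC (lt_le_trans st)//; lra.
exists (Num.max M 1)^-1; first by rewrite invr_gt0.
move=> x y xL xy; apply: (hM x) => //; first by rewrite -ler_norml.
apply: (@le_trans _ _ ((Num.max M 1)^-1 * Num.max M 1)); first by rewrite ler_wpM2r// ltW.
by rewrite mulVf// gt_eqF.
Qed.

Lemma two_steps_integral (g1 g2 : R -> R) k l (p q : R) : continuous g1 -> continuous g2 ->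
  \int[mu]_z (g1 z * (stepk k 1 (z - p) - stepk l 1 (z - q)) +
    g2 z * (stepk k 2 (z - p) - stepk l 2 (z - q))) =
  \int[mu]_z (g1 z * stepk k 1 (z - p)) - \int[mu]_z (g1 z * stepk l 1 (z - q)) +
  (\int[mu]_z (g2 z * stepk k 2 (z - p)) - \int[mu]_z (g2 z * stepk l 2 (z - q))).
Proof.
move=> c1 c2; have i1 := bump_int1 k 0 p c1; have i2 := bump_int1 l 0 q c1.
have i3 := bump_int1 k 1 p c2; have i4 := bump_int1 l 1 q c2.
apply: (etrans _ (congr2 +%R (RintB i1 i2) (RintB i3 i4))).
apply: (etrans _ (RintD (int1B i1 i2) (int1B i3 i4))).
by apply: eq_Rintegral => z _; rewrite !mulrBr.
Qed.

End BumpEstimates.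

(** * The transported equation for v_x along a trajectory *)

Section Transported.
Context {R : realType}.
Variable r : R.
Hypothesis hr : 1 < r.
Variables (I : set R) (v vt : R -> R -> R) (T : R).
Hypothesis Ii : is_interval I.
Hypothesis I0 : I 0.
Hypothesis dv : lie_algebra_path I v vt.
Hypothesis IT : I T.
Implicit Types (t s x y z : R).

Local Notation mu := (@lebesgue_measure R).
Local Notation sp := (signed_power r).
Local Notation J := (seg0 T).

Let r_gt0 : 0 < r. Proof. by apply: lt_trans hr. Qed.
Let rm1_gt0 : 0 < r - 1. Proof. by rewrite subr_gt0. Qed.
Let r_neq0 : r != 0. Proof. by rewrite gt_eqF. Qed.

Let sc := let: And3 h _ _ := lie_path_C1 dv in h.
Let lc := let: And3 _ h _ := lie_path_C1 dv in h.
Let C1 := let: And3 _ _ h := lie_path_C1 dv in h.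
Let JI := seg0_sub Ii I0 IT.
Let lvt t : I t -> lie_algebra (vt t). Proof. by case: C1 => h _ _; exact: h. Qed.

Variables f P : R -> R.
Hypothesis df : forall t, J t -> has_deriv_within J f t (v t (f t)).
Hypothesis P_gt0 : forall t, J t -> 0 < P t.
Hypothesis dP : forall t, J t -> has_deriv_within J P t ((v t)^`()%classic (f t) * P t).

Let Q t := (v t)^`()%classic (f t).

Let dn t n x : I t -> is_derive x (1 : R) (derive1n n (v t)) (derive1n n.+1 (v t) x).
Proof. by move=> It; exact: (smooth_dseq (sc It) n). Qed.

(** The left side has zero x-derivative by the equation, and its limit 0 at -oo fixes the constant
    of integration. *)
Lemma PJ_integrated : PJ_equation r^-1 I v vt -> forall t x, I t ->
  (vt t)^`()%classic x + r^-1 * (v t)^`()%classic x ^+ 2 + v t x * derive1n 2 (v t) x = 0.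
Proof.
move=> pj t x It.
pose G x := (vt t)^`()%classic x + r^-1 * (v t)^`()%classic x ^+ 2 + v t x * derive1n 2 (v t) x.
have lv := dv.1 t It; have lw := lvt It.
have dG y : is_derive y (1 : R) G 0.
  have d0 : is_derive y (1 : R) (v t) ((v t)^`()%classic y) by exact: (dn 0 y It).
  have d1 : is_derive y (1 : R) (v t)^`()%classic (derive1n 2 (v t) y) by exact: (dn 1 y It).
  have d2 := dn 2 y It.
  have w1 : is_derive y (1 : R) (vt t)^`()%classic (derive1n 2 (vt t) y).
    exact: (lie_derive 1 y lw).
  have h1 : is_derive y (1 : R) (fun x => r^-1 * (v t)^`()%classic x ^+ 2)
      (r^-1 * (2 * (v t)^`()%classic y * derive1n 2 (v t) y)).
    have := is_deriveZ r^-1 (is_deriveX 2 d1); move/is_derive_eq; apply.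
    by rewrite /GRing.scale/= expr1.
  have := is_deriveD (is_deriveD w1 h1) (is_deriveM d0 d2); move/is_derive_eq; apply.
  have := pj t y It.
  move: (derive1n 2 (vt t) y) ((v t)^`()%classic y) (derive1n 2 (v t) y) (derive1n 3 (v t) y) (v t y).
  by move=> a1 a2 a3 a4 a5 E; rewrite -[RHS]E /GRing.scale/=; ring.
have lim : G x @[x --> -oo] --> (0 : R).
  have l1 := lie_cvgNy 1 lw; have l2 := lie_cvgNy 1 lv; have l3 := lie_cvgNy 0 lv.
  have l4 := lie_cvgNy 2 lv.
  have := cvgD (cvgD l1 (cvgM (cvg_cst r^-1) (cvgM l2 l2))) (cvgM l3 l4).
  rewrite !mulr0 !addr0 => h; have -> : G = (fun x => derive1n 1 (vt t) x +
      r^-1 * (derive1n 1 (v t) x * derive1n 1 (v t) x) + derive1n 0 (v t) x * derive1n 2 (v t) x).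
    by apply/funext => z; rewrite /G expr2.
  exact: h.
have c0 := is_derive_const dG.
have h : G z @[z --> -oo] --> G x.
  by under eq_fun do rewrite (c0 _ x); exact: cvg_cst.
exact: (cvg_unique _ h lim).
Qed.

Let Q_deriv t : J t -> has_deriv_within J Q t
  ((vt t)^`()%classic (f t) + derive1n 2 (v t) (f t) * v t (f t)).
Proof.
move=> Jt; have It := JI Jt.
have := @hdw_chain R J (fun s => (v s)^`()%classic) (fun s => derive1n 2 (v s)) f t
  ((vt t)^`()%classic (f t)) (v t (f t)).
apply.
- by move=> s y Js; exact: (dn 1 y (JI Js)).
- exact: Jt.
- move=> e e0; have e2 : 0 < e / 2 by lra.
  have [d1 d10 h1] := seg0_unif Ii I0 dv IT 2 Jt e2.
  have /cvgrPdist_le/(_ _ e2)[d2 /= d20 h2] := @smooth_cont _ _ 2 (sc It) (f t).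
  exists (Num.min d1 d2); first by rewrite lt_min d10.
  move=> s y Js; rewrite !lt_min => /andP[s1 _] /andP[_ y2].
  have -> : derive1n 2 (v s) y - derive1n 2 (v t) (f t) =
     (derive1n 2 (v s) y - derive1n 2 (v t) y) - (derive1n 2 (v t) (f t) - derive1n 2 (v t) y).
    by rewrite opprB addrA subrK.
  rewrite [leRHS](splitr e); apply: (le_trans (ler_normB _ _)); apply: lerD; first exact: h1.
  by apply: h2; rewrite /= distrC.
- exact: (hdw_sub (@seg0_sub R I T Ii I0 IT) (@C1_hdw R I v vt sc lc C1 1 t (f t) It)).
- exact: df.
Qed.

(** Along the trajectory the integrated equation reads Q' = - Q^2 / r, which with P' = Q P makes Q
    P^(1/r) constant. *)
Lemma PJ_transported : PJ_equation r^-1 I v vt -> forall t, J t ->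
  0 < 1 + t * (Q 0 / r) /\ P t = P 0 * (1 + t * (Q 0 / r)) `^ r.
Proof.
move=> pj; apply: (@conserved_power R r hr J P Q (@seg0_interval R T) (@seg00 R T) P_gt0 dP).
move=> t Jt; apply: (@hdw_const R J (fun s => Q s * P s `^ r^-1) (@seg0_interval R T)) => //; last exact: seg00.
move=> s Js.
have := hdwM (Q_deriv Js) (hdw_comp (is_derive1_powR r^-1 (P_gt0 Js)) (dP Js)).
have E := PJ_integrated pj (f s) (JI Js).
have -> : (vt s)^`()%classic (f s) + derive1n 2 (v s) (f s) * v s (f s) = - (r^-1 * Q s ^+ 2).
  apply/eqP; rewrite -subr_eq0 opprK; apply/eqP; rewrite -[RHS]E /Q.
  by move: (derive1n 2 (v s) (f s)) => a; ring.
suff -> : - (r^-1 * Q s ^+ 2) * P s `^ r^-1 +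
  Q s * (r^-1 * P s `^ (r^-1 - 1) * ((v s)^`()%classic (f s) * P s)) = 0 by [].
rewrite -(@mulr_powRB1 _ (P s) r^-1) ?invr_gt0//; last exact/ltW/P_gt0.
by rewrite -/(Q s); ring.
Qed.

Hypothesis hs : HS_equation r I v.

Let m s x := sp ((v s)^`()%classic x).

Let v_cont t n : I t -> continuous (derive1n n (v t)).
Proof. by move=> It; exact: (@smooth_cont _ _ n (sc It)). Qed.

Let vx_cont t : I t -> continuous (v t)^`()%classic.
Proof. exact: (@v_cont t 1). Qed.

Let m_cont t : I t -> continuous (m t).
Proof. by move=> It x; exact: (cont_sp hr (@vx_cont t It x)). Qed.

Let kin t x := r^-1 * `|(v t)^`()%classic x| `^ r.

Let kin_cont t : I t -> continuous (kin t).
Proof.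
move=> It x; apply: cvgM; first exact: cvg_cst.
exact: (cont_abs_powR r_gt0 (@vx_cont t It x)).
Qed.

Let mv_cont t : I t -> continuous (fun x => m t x * v t x).
Proof. by move=> It x; apply: cvgM; [exact: m_cont|exact: (@v_cont t 0 It x)]. Qed.

(* The bump at p extracts m(s, p) as n grows.  The bump at [q n] makes the
   antiderivative in z compactly supported; its contribution tends to 0. *)
Let q (n : nat) : R := - n%:R.

Let left_bump (n : nat) s := \int[mu]_z (m s z * stepk 0 1 (z - (q n))).
Let mass (n : nat) s p := \int[mu]_z (m s z * stepk n 1 (z - p)) - left_bump n s.
Let mass_dp (n : nat) s p := - \int[mu]_z (m s z * stepk n 2 (z - p)).

Let mass_pairing (n : nat) s p : I s -> mass n s p = - dx_pairing (m s) (two_steps n 0 p (q n)).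
Proof.
move=> Is; rewrite /dx_pairing opprK -derive1n1 two_steps_deriv /mass /left_bump.
rewrite -RintB; [|exact: (bump_int1 n 0 p (@m_cont s Is))|exact: (bump_int1 0 0 (q n) (@m_cont s Is))].
by apply: eq_Rintegral => z _; rewrite mulrBr.
Qed.

Let flux (n : nat) t p := \int[mu]_z (kin t z * stepk n 1 (z - p)) - \int[mu]_z (kin t z * stepk 0 1 (z - (q n))) +
  (\int[mu]_z (m t z * v t z * stepk n 2 (z - p)) - \int[mu]_z (m t z * v t z * stepk 0 2 (z - (q n)))).

Let mass_dt (n : nat) t p : J t -> has_deriv_within J (mass n ^~ p) t (flux n t p).
Proof.
move=> Jt; have It := JI Jt.
have tc := two_steps_test n 0 p (q n).
have [d dd E] := hs It tc.
have Ed : d = - flux n t p.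
  have F := HS_flux hr (dv.1 t It) tc.
  have e1 : (two_steps n 0 p (q n))^`()%classic = (fun z => stepk n 1 (z - p) - stepk 0 1 (z - (q n))).
    by rewrite -derive1n1 two_steps_deriv.
  apply/eqP; rewrite -addr_eq0; apply/eqP; rewrite -[RHS]E -addrA; congr (d + _).
  rewrite F /flux -(two_steps_integral n 0 p (q n) (@kin_cont t It) (@mv_cont t It)).
  by apply: eq_Rintegral => z _; rewrite e1 two_steps_deriv.
have := hdwN (hdw_sub (@seg0_sub R I T Ii I0 IT) dd); rewrite Ed opprK.
by apply: (hdw_eq Jt) => s Js; rewrite mass_pairing//; exact: JI.
Qed.

(** For r < 2 [signed_power] is not Lipschitz at 0; uniform continuity on the bounded range of v_x
    takes the place of a Lipschitz bound. *)
Let m_unif t e : J t -> 0 < e -> exists2 d, 0 < d & forall s, J s -> `|s - t| < d ->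
  forall x, `|m s x - m t x| <= e.
Proof.
move=> Jt e0; have [L L0 hL] := seg0_bounded Ii I0 dv IT 1.
have csp : continuous (fun z : R => sp z) by move=> z; apply: (cont_sp hr); exact: cvg_id.
have [d1 d10 h1] := segment_unif_cont csp L0 e0.
have [d d0 h] := seg0_unif Ii I0 dv IT 1 Jt d10.
by exists d => // s Js st x; apply: h1; [exact: (hL s x Js)|exact: h].
Qed.

Let mass_hdw (n : nat) t : J t -> has_deriv_within J (fun s => mass n s (f s)) t
  (flux n t (f t) + mass_dp n t (f t) * v t (f t)).
Proof.
move=> Jt; have It := JI Jt.
have := @hdw_chain R J (mass n) (mass_dp n) f t (flux n t (f t)) (v t (f t)).
apply.
- move=> s p Js; rewrite -[mass_dp n s p]subr0; apply: is_deriveB.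
  exact: (bump_derive n 0 p (@m_cont s (JI Js))).
- exact: Jt.
- move=> e e0; have e2 : 0 < e / 2 by lra.
  have Cb : 0 <= @bump_const R by rewrite /bump_const; case: cid2.
  pose C := n.+1%:R * @bump_const R + 1.
  have C0 : 0 < C by rewrite ltr_wpDl// mulr_ge0.
  have [d1 d10 h1] := m_unif Jt (divr_gt0 e2 C0).
  have cp : {for f t, continuous (mass_dp n t)}.
    have := is_derive_cont (bump_derive n 1 (f t) (@m_cont t It)).
    exact: continuousN.
  have /cvgrPdist_le/(_ _ e2)[d2 /= d20 h2] := cp.
  exists (Num.min d1 d2); first by rewrite lt_min d10.
  move=> s y Js; rewrite !lt_min => /andP[s1 _] /andP[_ y2].
  have -> : mass_dp n s y - mass_dp n t (f t) =
     (mass_dp n s y - mass_dp n t y) - (mass_dp n t (f t) - mass_dp n t y).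
    by rewrite opprB addrA subrK.
  rewrite [leRHS](splitr e); apply: (le_trans (ler_normB _ _)); apply: lerD; last first.
    by apply: h2; rewrite /= distrC.
  have cm : continuous (fun z => m s z - m t z).
    by move=> z; apply: cvgB; apply: m_cont => //; exact: JI.
  have -> : mass_dp n s y - mass_dp n t y = - \int[mu]_z ((m s z - m t z) * stepk n 2 (z - y)).
    under [in RHS]eq_Rintegral do rewrite mulrBl.
    rewrite RintB; [|exact: (bump_int1 n 1 y (@m_cont s (JI Js)))|exact: (bump_int1 n 1 y (@m_cont t It))].
    by rewrite opprB addrC opprK.
  rewrite normrN; apply: (le_trans (bump_deriv_le cm (ltW (divr_gt0 e2 C0)) _)).
    by move=> z _; exact: h1.
  rewrite -mulrA -mulrA ler_piMr ?(ltW e2)// mulrC ler_pdivrMr// mul1r.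
  by rewrite lerDl.
- exact: mass_dt.
- exact: df.
Qed.

(** The derivative of sp(Q) that the geodesic equation prescribes. It equals the kinetic term |Q|^r
    / r minus m Q = |Q|^r. *)
Let target t := - ((1 - r^-1) * `|Q t| `^ r).

(** Uniform convergence on the segment both of the regularised quantities and of their time
    derivatives. The only delicate term is m v against the derivative of the bump, where v must be
    expanded to first order at [p]. *)
Let approx (e : R) : 0 < e -> exists n : nat, forall t, J t ->
  `|mass n t (f t) - sp (Q t)| <= e /\
  `|flux n t (f t) + mass_dp n t (f t) * v t (f t) - target t| <= e.
Proof.
have aux (A1 A2 A3 A4 A5 c a w G tg : R) : G = A3 - w * A5 + a -> tg = c - a ->
  A1 - A2 + (A3 - A4) + - A5 * w - tg = (A1 - c) - A2 + G - A4 by move=> -> ->; ring.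
move=> e0.
have [M0 M00 hM] := seg0_bounded Ii I0 dv IT 0; have [L L0 hL] := seg0_bounded Ii I0 dv IT 1.
have [K K0 hK] := seg0_bounded Ii I0 dv IT 2.
have Cb : 0 <= @bump_const R by rewrite /bump_const; case: cid2.
set cb := @bump_const R in Cb.
have LC : 0 <= L * cb by rewrite mulr_ge0.
have MC : 0 <= M0 * cb by rewrite mulr_ge0.
(* The coefficients of the error terms: 2 for the two kinetic integrals, (1 + L) cb for the expanded
   term at [p], M0 cb for the left bump. *)
pose C := 2 + cb + L * cb + M0 * cb.
have C2 : 2 <= C by rewrite /C; lra.
have C0 : 0 < C by lra.
have [e' e'0 eC] : exists2 e', 0 < e' & e = e' * C.
  by exists (e / C); [rewrite divr_gt0|rewrite divfK// gt_eqF].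
have ee : e' + e' <= e by rewrite [leRHS]eC; nra.
have csp : continuous (fun z : R => sp z) by move=> z; apply: (cont_sp hr); exact: cvg_id.
have ckin : continuous (fun z : R => r^-1 * `|z| `^ r).
  by move=> z; apply: cvgM; [exact: cvg_cst|apply: (cont_abs_powR r_gt0); exact: cvg_id].
have [d1 d10 h1] := segment_unif_cont ckin L0 e'0.
have [d2 d20 h2] := segment_unif_cont csp L0 e'0.
pose d := Num.min d1 d2.
have d0 : 0 < d by rewrite lt_min d10.
have [N hN] := seg0_tail Ii I0 dv IT 1 d0.
pose Mm := L `^ (r - 1).
have Mm0 : 0 <= Mm by exact: powR_ge0.
have mM t x : J t -> `|m t x| <= Mm.
  move=> Jt; rewrite (sp_norm hr); apply: ge0_ler_powR; rewrite ?nnegrE ?(ltW rm1_gt0)//.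
  exact: (hL t x Jt).
(* In turn: v_x is nearly constant across the bump at [p], the second-order remainder of v is
   negligible, and the left bump lies in the region of small v_x. *)
have [n [n1 n2 n3]] : exists n : nat, [/\ K * n.+1%:R^-1 <= d, Mm * (K * n.+1%:R^-1) <= e' &
    N + 1 <= n%:R].
  pose X := K / d + Mm * K / e' + `|N| + 1.
  have x1 : 0 <= K / d by apply: divr_ge0 => //; exact: ltW.
  have x2 : 0 <= Mm * K / e' by apply: divr_ge0; [exact: mulr_ge0|exact: ltW].
  have X0 : 0 <= X by rewrite /X; have := normr_ge0 N; lra.
  exists (Num.bound X); have := archi_boundP X0; set n := Num.bound X => Xn.
  have n0 : (0 : R) < n.+1%:R by rewrite ltr0n.
  have Xn1 : X <= n.+1%:R by rewrite (le_trans (ltW Xn))// ler_nat.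
  have aN := normr_ge0 N; have lN := ler_norm N.
  split.
  - rewrite ler_pdivrMr// -ler_pdivrMl// mulrC; apply: le_trans Xn1; rewrite /X; lra.
  - rewrite mulrA ler_pdivrMr// -ler_pdivrMl// mulrC; apply: le_trans Xn1; rewrite /X; lra.
  - by apply: le_trans (ltW Xn); rewrite /X; lra.
exists n => t Jt; have It := JI Jt.
have i0 := @invk_gt0 R n; set i : R := n.+1%:R^-1 in i0 n1 n2.
set p := f t.
have near z : p <= z <= p + i -> `|(v t)^`()%classic p - (v t)^`()%classic z| <= d.
  move=> /andP[z1 z2]; apply: le_trans n1.
  apply: (@le_trans _ _ (K * `|p - z|)).
    apply: (is_derive_bound (fun x => dn 1 x It)) => w; exact: (hK t w Jt).
  by rewrite ler_wpM2l// distrC ger0_norm ?subr_ge0// lerBlDl.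
have far z : q n <= z <= q n + 0.+1%:R^-1 -> `|(0 : R) - (v t)^`()%classic z| <= d.
  rewrite invr1 => /andP[_ z2]; rewrite sub0r normrN; apply: (hN t z Jt).
  by move: z2; rewrite /q; lra.
have dd1 : d <= d1 by rewrite /d ge_min lexx.
have dd2 : d <= d2 by rewrite /d ge_min lexx orbT.
have Qm : sp (Q t) = m t p by [].
have QL : `|(v t)^`()%classic p| <= L by exact: (hL t p Jt).
have z0L : `|(0 : R)| <= L by rewrite normr0.
have nm z : p <= z <= p + i -> `|m t z - m t p| <= e'.
  by move=> /near h; rewrite distrC; exact: (h2 _ _ QL (le_trans h dd2)).
have fm z : q n <= z <= q n + 0.+1%:R^-1 -> `|m t z| <= e'.
  move=> /far h; have := h2 _ _ z0L (le_trans h dd2).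
  by rewrite sp0 sub0r normrN.
have cm := @m_cont t It; have ck := @kin_cont t It; have cmv := @mv_cont t It.
split.
  rewrite Qm /mass addrAC; apply: (le_trans (ler_normB _ _)); apply: le_trans ee; apply: lerD.
    exact: (bump_average cm nm).
  have := @bump_average R (m t) 0 (q n) 0 e' cm; rewrite subr0; apply => z /fm h.
  by rewrite subr0.
have T1 : `|\int[mu]_z (kin t z * stepk n 1 (z - p)) - kin t p| <= e'.
  by apply: (bump_average ck) => z /near h; rewrite distrC; exact: (h1 _ _ QL (le_trans h dd1)).
have T2 : `|\int[mu]_z (kin t z * stepk 0 1 (z - q n))| <= e'.
  have := @bump_average R (kin t) 0 (q n) 0 e' ck; rewrite subr0; apply => z /far h.
  have := h1 _ _ z0L (le_trans h dd1); rewrite normr0 powR0// mulr0 sub0r normrN.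
  by rewrite subr0.
have T4 : `|\int[mu]_z (m t z * v t z * stepk 0 2 (z - q n))| <= e' * M0 * cb.
  have := @bump_deriv_le R (fun z => m t z * v t z) 0 (q n) (e' * M0) cmv.
  rewrite mulr1; apply; first by rewrite mulr_ge0// ltW.
  by move=> z /fm h; rewrite normrM ler_pM//; exact: hM.
pose g z := m t z * (v t z - v t p) - m t p * Q t * (z - p).
have cv : continuous (v t) by exact: (@v_cont t 0 It).
have czp (c : R) : continuous (fun z : R => z - c).
  by move=> z; apply: cvgB; [exact: cvg_id|exact: cvg_cst].
have cg : continuous g.
  move=> z; apply: cvgB; apply: cvgM; [exact: cm| |exact: cvg_cst|exact: czp].
  by apply: cvgB; [exact: cv|exact: cvg_cst].
have T3 : `|\int[mu]_z (g z * stepk n 2 (z - p))| <= (e' + e' * L) * cb.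
  have nn : (n.+1%:R : R) != 0 by rewrite pnatr_eq0.
  have -> : (e' + e' * L) * cb = (e' + e' * L) * i * n.+1%:R * cb.
    by rewrite -[_ * i * _]mulrA mulVf// mulr1.
  apply: (bump_deriv_le cg); first by rewrite mulr_ge0 ?(ltW i0)// addr_ge0 ?mulr_ge0// ltW.
  move=> z zp; have /andP[z1 z2] := zp.
  have zi : `|z - p| <= i by rewrite ger0_norm ?subr_ge0// lerBlDl.
  (* The Taylor remainder of v, quadratic in the width [i] of the bump, plus the oscillation of m
     times a linear term; each is a small multiple of [i]. *)
  have -> : g z = m t z * (v t z - v t p - Q t * (z - p)) + (m t z - m t p) * (Q t * (z - p)).
    by rewrite /g; move: (m t z) (m t p) (v t z) (v t p) (Q t) => *; ring.
  apply: (le_trans (ler_normD _ _)); rewrite [leRHS]mulrDl; apply: lerD.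
    rewrite normrM; apply: (@le_trans _ _ (Mm * (K * i * i))).
      apply: ler_pM => //; first exact: mM.
      apply: (le_trans (taylor2 (fun x => dn 0 x It) (fun x => dn 1 x It) (fun x => hK t x Jt) z p)).
      by rewrite -mulrA ler_wpM2l// expr2 ler_pM.
    by rewrite mulrA ler_wpM2r ?(ltW i0).
  rewrite normrM -mulrA; apply: ler_pM => //; first exact: nm.
  by rewrite normrM ler_pM.
have E : flux n t p + mass_dp n t p * v t p - target t =
    (\int[mu]_z (kin t z * stepk n 1 (z - p)) - kin t p) -
    \int[mu]_z (kin t z * stepk 0 1 (z - q n)) +
    \int[mu]_z (g z * stepk n 2 (z - p)) - \int[mu]_z (m t z * v t z * stepk 0 2 (z - q n)).
  have tE : target t = kin t p - m t p * Q t.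
    by rewrite /target -Qm (sp_mulr hr) /kin -/(Q t); ring.
  exact: (aux _ _ _ _ _ _ _ _ _ _ (bump_deriv_split n p (v t p) (m t p * Q t) cm cv) tE).
rewrite E; apply: (le_trans (ler_normB _ _)).
have -> : e = e' + e' + (e' + e' * L) * cb + e' * M0 * cb by rewrite [LHS]eC /C; ring.
apply: lerD => //; apply: (le_trans (ler_normD _ _)); apply: lerD => //.
by apply: (le_trans (ler_normB _ _)); apply: lerD.
Qed.

Let f_lip : exists2 M0, 0 <= M0 & forall s t, J s -> J t -> `|f s - f t| <= M0 * `|s - t|.
Proof.
have [M0 M00 hM] := seg0_bounded Ii I0 dv IT 0; exists M0 => // s t Js Jt.
by apply: (hdw_bound (@seg0_interval R T) df) => // w Jw; exact: (hM w (f w) Jw).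
Qed.

(** The limit is taken in integrated form: the regularised masses minus a primitive [A] of [target]
    have uniformly small derivative, so sp(Q) - A is constant, and differentiability of sp(Q) is
    inherited from [A]. *)
Let spQ_deriv t : J t -> has_deriv_within J (fun s => sp (Q s)) t (target t).
Proof.
have aux (x1 x2 x3 e1 e2 : R) : `|x1| <= e1 -> `|x2| <= e1 -> `|x3| <= e2 ->
    `|- x1 + x2 + x3| <= e1 + e1 + e2.
  move=> h1 h2 h3; apply: (le_trans (ler_normD _ _)); apply: lerD => //.
  by apply: (le_trans (ler_normD _ _)); apply: lerD => //; rewrite normrN.
move=> Jt0; pose cl := clamp (Num.min 0 T) (Num.max 0 T).
have mM : Num.min 0 T <= Num.max 0 T by have /seg0E/andP[a1 a2] := @seg00 R T; exact: le_trans a2.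
have clJ s : J (cl s) by apply/seg0E; exact: clamp_itv.
have [M M0 hM] := f_lip.
have cfc : continuous (fun s => f (cl s)).
  move=> s; apply/cvgrPdist_le => e e0; have M1 : 0 < M + 1 by rewrite ltr_wpDl.
  exists (e / (M + 1)) => [|w /= sw]; first by rewrite /= divr_gt0.
  apply: (le_trans (hM _ _ (clJ _) (clJ _))); apply: (@le_trans _ _ (M * (e / (M + 1)))).
    by rewrite ler_wpM2l// (le_trans (clamp_lip _ _ _ _))// ltW.
  by rewrite mulrCA ler_piMr ?(ltW e0)// ler_pdivrMr// mul1r lerDl.
have cQ : continuous (fun s => Q (cl s)).
  exact: (@seg0_clamp_cont R I v vt T Ii I0 dv IT 1 _ cfc).
have ct : continuous (fun s => target (cl s)).
  have cN (g : R -> R) : continuous g -> continuous (fun s => - ((1 - r^-1) * g s)).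
    by move=> cg s; apply: cvgN; apply: cvgM; [exact: cvg_cst|exact: cg].
  apply: (cN (fun s => `|Q (cl s)| `^ r)) => s.
  exact: (cont_abs_powR r_gt0 (cQ s)).
have [A [A0 dA]] := cont_antideriv ct.
have dAJ s : J s -> has_deriv_within J A s (target s).
  by move=> Js; have := is_derive_hdw J (dA s); rewrite /cl (clamp_id (iffLR (seg0E T s) Js)).
have E s : J s -> sp (Q s) = A s + (sp (Q 0) - A 0).
  move=> Js; apply/eqP; rewrite -subr_eq0 -normr_le0; apply/ler_addgt0Pl => e e0; rewrite addr0.
  (* The error budget: one approximation at each of the times [s] and 0, and a derivative error
     accumulated over a duration |s|. *)
  have s2 : 0 < 2 + `|s| by rewrite ltr_wpDr.
  have [n hn] := approx (divr_gt0 e0 s2); set e' := e / _ in hn.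
  have e'0 : 0 < e' by rewrite divr_gt0.
  have [a1 _] := hn s Js; have [a2 _] := hn 0 (@seg00 R T).
  have D w : J w -> has_deriv_within J (fun s => mass n s (f s) - A s) w
     (flux n w (f w) + mass_dp n w (f w) * v w (f w) - target w).
    by move=> Jw; have h := @mass_hdw n w Jw; have h2 := dAJ w Jw; have h3 := hdwB h h2; exact: h3.
  have := hdw_bound (@seg0_interval R T) D (fun w Jw => (hn w Jw).2) Js (@seg00 R T).
  rewrite subr0 => a3.
  have -> : sp (Q s) - (A s + (sp (Q 0) - A 0)) =
    - (mass n s (f s) - sp (Q s)) + (mass n 0 (f 0) - sp (Q 0)) +
    (mass n s (f s) - A s - (mass n 0 (f 0) - A 0)).
    by move: (sp (Q s)) (A s) (sp (Q 0)) (A 0) (mass n s (f s)) (mass n 0 (f 0)) => *; ring.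
  have -> : e = e' + e' + e' * `|s| by rewrite /e'; field; rewrite gt_eqF.
  exact: (aux _ _ _ _ _ a1 a2 a3).
rewrite -[target t]addr0.
have := hdwD (dAJ t Jt0) (@hdw_cst R J (sp (Q 0) - A 0) t).
by apply: (hdw_eq Jt0) => s Js; exact: (esym (E s Js)).
Qed.

Lemma HS_transported t : J t ->
  0 < 1 + t * (Q 0 / r) /\ P t = P 0 * (1 + t * (Q 0 / r)) `^ r.
Proof.
move: t; apply: (@conserved_sp R r hr J P Q target (@seg0_interval R T) (@seg00 R T) P_gt0 dP spQ_deriv).
by move=> t Jt; rewrite /target; field.
Qed.

End Transported.

(** * General initial data and conclusion *)

Section Composition.
Context {R : realType}.
Implicit Types (f g h F phi : R -> R) (n : nat).

Fixpoint bounded_derivs n h : Prop := (exists M, forall x, `|h x| <= M) /\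
  if n is m.+1 then exists2 h', (forall x, is_derive x (1 : R) h (h' x)) & bounded_derivs m h'
  else True.

Fixpoint int1_derivs n h : Prop := int1 h /\
  if n is m.+1 then exists2 h', (forall x, is_derive x (1 : R) h (h' x)) & int1_derivs m h'
  else True.

Lemma bounded_derivsW n h : bounded_derivs n.+1 h -> bounded_derivs n h.
Proof.
elim: n h => [|n ih] h [b [h' d c]]; first by split.
by split=> //; exists h' => //; exact: ih.
Qed.

Lemma bounded_derivsD n f g : bounded_derivs n f -> bounded_derivs n g ->
  bounded_derivs n (fun x => f x + g x).
Proof.
elim: n f g => [|n ih] f g [[M hM] cf] [[N hN] cg].
  by split=> //; exists (M + N) => x; rewrite (le_trans (ler_normD _ _))// lerD.
split; first by exists (M + N) => x; rewrite (le_trans (ler_normD _ _))// lerD.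
case: cf cg => f' df cf [g' dg cg].
by exists (fun x => f' x + g' x); [move=> x; apply: is_deriveD|exact: ih].
Qed.

Lemma bounded_derivsM n f g : bounded_derivs n f -> bounded_derivs n g ->
  bounded_derivs n (fun x => f x * g x).
Proof.
elim: n f g => [|n ih] f g hf hg; have [[M hM] cf] := hf; have [[N hN] cg] := hg.
  by split=> //; exists (M * N) => x; rewrite normrM ler_pM.
split; first by exists (M * N) => x; rewrite normrM ler_pM.
case: cf cg => f' df cf [g' dg cg].
exists (fun x => f x * g' x + g x * f' x); first by move=> x; exact: is_deriveM.
by apply: bounded_derivsD; apply: ih => //; exact: bounded_derivsW.
Qed.

Lemma int1_derivsD n f g : int1_derivs n f -> int1_derivs n g ->
  int1_derivs n (fun x => f x + g x).
Proof.
elim: n f g => [|n ih] f g [jf cf] [jg cg]; first by split=> //; exact: int1D.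
split; first exact: int1D.
case: cf cg => f' df cf [g' dg cg].
by exists (fun x => f' x + g' x); [move=> x; apply: is_deriveD|exact: ih].
Qed.

Lemma int1_derivs_wfun f : (forall n, int1_derivs n f) -> wfun f.
Proof.
move=> h; split.
  apply: Cn_smooth => n; have := h n; elim: n f {h} => // n ih f [_ [f' d c]].
  by exists f' => //; exact: ih.
move=> n; have := h n; elim: n f {h} => [|n ih] f; first by case.
move=> [_ [f' d c]]; rewrite derive1Sn (is_derive_der d); exact: ih.
Qed.

Lemma wfun_bounded_derivs n f c : wfun (fun x => f x - c) -> bounded_derivs n f.
Proof.
move=> w.
have b m : exists M, forall x, `|derive1n m (fun x => f x - c) x| <= M.
  by eexists => x; exact: (wfun_sup m x w).
have d m x := wfun_derive m x w.
have bd m k : bounded_derivs m (derive1n k (fun x => f x - c)).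
  elim: m k => [|m ih] k; first by split.
  by split=> //; exists (derive1n k.+1 (fun x => f x - c)).
have cst m : bounded_derivs m (fun=> c).
  case: m => [|m]; first by split=> //; exists `|c|.
  split; first by exists `|c|.
  exists (fun=> 0); first by move=> x; exact: is_derive_cst.
  elim: m => [|m ih]; first by split=> //; exists 0 => x; rewrite normr0.
  split; first by exists 0 => x; rewrite normr0.
  by exists (fun=> 0) => // x; exact: is_derive_cst.
have -> : f = (fun x => (f x - c) + c) by apply/funext => x; rewrite subrK.
by apply: bounded_derivsD; [exact: (bd n 0)|exact: cst].
Qed.

(** The bounded factor [h] makes the class stable: the derivative is F'(phi) (phi' h) + F(phi) h', a
    sum of two terms of the same form, so induction applies without a formula for higher derivatives
    of a composite. *)
Lemma wfun_comp_mul F phi h : wfun F -> diff_group phi -> (forall n, bounded_derivs n h) ->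
  wfun (fun x => F (phi x) * h x).
Proof.
move=> wF gphi hh; apply: int1_derivs_wfun => n.
have [dphi wp [c c0 hc] _] := diff_group_deriv gphi.
have df := diff_group_diffeo gphi.
have bp k : bounded_derivs k phi^`()%classic by exact: wfun_bounded_derivs wp.
elim: n F h wF hh => [|n ih] F h wF hh.
all: have hI : int1 (fun x => F (phi x) * h x).
1,3: have [[M hM] [h' dh _]] := hh 1%N.
1,2: apply: (int1_bdM (int1_comp_diffeo df c0 hc (@wfun_cont _ _ 0 wF) (wfun_int 0 wF)) _ hM).
1,2: by apply: cont_meas; exact: is_derive_continuous dh.
  by split.
split=> //; have [_ [h' dh _]] := hh 1%N.
exists (fun x => F^`()%classic (phi x) * (phi^`()%classic x * h x) + F (phi x) * h' x).
  move=> x; have d1 : is_derive x (1 : R) (F \o phi) (F^`()%classic (phi x) * phi^`()%classic x).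
    by apply: is_derive1_comp; exact: (wfun_derive 0 _ wF).
  have := is_deriveM d1 (dh x); move/is_derive_eq; apply.
  by rewrite /GRing.scale/=; ring.
apply: int1_derivsD; apply: ih => //.
- exact: wfun_der.
- by move=> k; exact: bounded_derivsM.
- move=> k; have [_ [h2 dh2 b2]] := hh k.+1.
  have -> // : h' = h2.
  by rewrite -(is_derive_der dh) (is_derive_der dh2).
Qed.

Lemma wfun_comp F phi c : wfun F -> diff_group phi -> wfun (fun x => F (phi x) / c).
Proof.
move=> wF gphi; apply: (wfun_comp_mul wF gphi) => n.
apply: (@wfun_bounded_derivs n _ c^-1).
have -> : (fun _ : R => c^-1 - c^-1) = (fun=> 0) by apply/funext => x; rewrite subrr.
apply: (@wfun_dseq _ (fun _ _ => 0)) => [k x|k]; first exact: is_derive_cst.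
exact: int1_0.
Qed.

End Composition.

Section Conclusion.
Context {R : realType}.
Variable r : R.
Hypothesis hr : 1 < r.
Implicit Types (X : R -> R) (I : set R) (v psi : R -> R -> R).

Local Notation phi := (explicit_path r).

Lemma explicit_diff_group (u0 : R -> R) t : lie_algebra u0 -> (forall x, 0 < 1 + t * slope r u0 x) ->
  diff_group (phi u0 t).
Proof.
move=> lu B0; rewrite explicit_pathE.
have B : base_pos (slope r u0) [set t] by move=> s x /= ->.
exact: (gpath_path hr (@id_derive R) diff_group_id (slope_wfun r lu) B).1.
Qed.

Lemma PJ_unique (u0 : R -> R) I v : lie_algebra u0 -> is_interval I -> I 0 -> PJ_solution r^-1 I u0 v ->
  forall t, I t -> diff_group (phi u0 t) /\ v t = eulerian r u0 t.
Proof.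
move=> lu Ii I0 [vt [dv pj v0]] t It.
have [B0 E] := transport_unique hr lu Ii I0 dv v0 It (fun f P df P0 dP =>
  PJ_transported hr Ii I0 dv It df P0 dP pj).
by split=> //; exact: explicit_diff_group.
Qed.

Lemma HS_unique (u0 : R -> R) I v : lie_algebra u0 -> is_interval I -> I 0 -> HS_solution r I u0 v ->
  forall t, I t -> diff_group (phi u0 t) /\ v t = eulerian r u0 t.
Proof.
move=> lu Ii I0 [vt [dv hs v0]] t It.
have [B0 E] := transport_unique hr lu Ii I0 dv v0 It (fun f P df P0 dP =>
  HS_transported hr Ii I0 dv It df P0 dP hs).
by split=> //; exact: explicit_diff_group.
Qed.

(** At time 0 the base is 1, hence bounded below for |t| < e uniformly in x; the explicit path from
    [phi0] with b = X'(phi0)/r lives at least that long. *)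
Lemma local_geodesic (phi0 : R -> R) X : diff_group phi0 -> lie_algebra X ->
  exists2 e : R, 0 < e & exists2 psi : R -> R -> R,
    geodesic r `]-e, e[ phi0 (X \o phi0) psi &
    forall I psi', is_interval I -> I 0 -> geodesic r I phi0 (X \o phi0) psi' ->
      forall t, I t -> - e < t < e -> psi' t = psi t.
Proof.
move=> g0 lX; have [dphi0 _ _ _] := diff_group_deriv g0.
have [_ wX _] := iffLR (lie_algebraP X) lX.
pose b x := X^`()%classic (phi0 x) / r.
have wb : wfun b by exact: wfun_comp.
have [d [e [d0 e0 hd]]] := base_nbhs (t0 := 0) wb (fun x => ltac:(by rewrite mul0r addr0)).
exists e => //; exists (gpath r phi0 phi0^`()%classic b).
  have B0 : base_pos b `]-e, e[%classic.
    move=> t x; rewrite /= in_itv/= => te; apply: lt_le_trans d0 _; apply: hd.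
    by rewrite subr0 ltr_norml.
  exists (gvel r phi0^`()%classic b); split.
  - exact: (gpath_path hr dphi0 g0 wb B0).
  - exact: (gpath_geodesic_eq hr dphi0 g0 wb B0).
  - exact: gpath0.
  - exact: (gvel0 hr dphi0 g0 wb lX).
move=> I psi' Ii I0 g t It _.
by have [_ ->] := geodesic_gpath hr dphi0 g0 wb Ii I0 lX erefl g.
Qed.

End Conclusion.

Theorem theorem2p3p1 (R : realType) (r : R) (hr : 1 < r)
    (u0 : R -> R) (hu0 : lie_algebra u0) :
  let phi := explicit_path r u0 in
  let u t := time_derivative phi t \o inverse (phi t) in
  (* existence, uniqueness and explicit form, on every time interval I *)
  (forall I : set R, is_interval I -> I 0 ->
    [/\ (forall psi : R -> R -> R,
          geodesic r I id u0 psi <->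
          (forall t, I t -> diff_group (phi t) /\ psi t = phi t)),
        (forall v : R -> R -> R,
          HS_solution r I u0 v <->
          (forall t, I t -> diff_group (phi t) /\ v t = u t)),
        (forall v : R -> R -> R,
          PJ_solution r^-1 I u0 v <->
          (forall t, I t -> diff_group (phi t) /\ v t = u t)) &
        (* the solutions are length minimizing *)
        ((forall t, I t -> diff_group (phi t)) ->
          forall a b, I a -> I b -> a < b ->
            path_length r a b phi = finsler_dist r (phi a) (phi b))]) /\
  (* the geodesic equation is well-defined on Diff_{-oo}(R): for all initial
     data (phi0, X o phi0) in the tangent bundle, it has a local solution in
     Diff_{-oo}(R), and solutions are unique *)
  (forall phi0 X : R -> R, diff_group phi0 -> lie_algebra X ->
    exists2 e : R, 0 < e &
    exists2 psi : R -> R -> R,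
      geodesic r `]-e, e[ phi0 (X \o phi0) psi &
      forall (I : set R) (psi' : R -> R -> R), is_interval I -> I 0 ->
        geodesic r I phi0 (X \o phi0) psi' ->
        forall t, I t -> - e < t < e -> psi' t = psi t).
Proof.
move=> phi u; split; last by move=> phi0 X; exact: local_geodesic.
move=> I Ii I0; split.
- by move=> psi; exact: explicit_geodesic.
- move=> v; split; first exact: HS_unique.
  exact: eulerian_HS_solution.
- move=> v; split; first exact: PJ_unique.
  exact: eulerian_PJ_solution.
- exact: explicit_minimizing.
Qed.
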